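(* Let $\eta<\xi$ be real numbers, $I=[\eta,\xi]$, and let $f:I\to\mathbb{R}$ be twice differentiable with $f''$ continuous and bounded away from $0$ on $I$. Suppose $0<\theta<1$ and $f''\in \mathrm{Lip}_\theta([\eta,\xi])$. Fix $\varepsilon>0$. For $Q\ge 1$ and $0<\delta<1/2$ define $$\widetilde{N}(Q,\delta) := \#\{ (a,q)\in\mathbb{Z}\times\mathbb{N} : Q<q\le 2Q,\ \eta q<a\le \xi q,\ \|qf(a/q)\|<\delta\},$$ and $E(Q,\delta):=\widetilde{N}(Q,\delta)-3(\xi-\eta)\delta Q^2$. Then for $Q$ sufficiently large and all $\delta$ with $Q^{-\frac{1+\theta}{3-\theta}+\varepsilon}\le \delta<1/2$ we have $$\widetilde{N}(Q,\delta)=3(\xi-\eta)\delta Q^2+E(Q,\delta),$$ where, writing $T(Q)=Q^{\frac{1-2\theta}{2-\theta}}(\log Q)^{-\frac{5-\theta}{2-\theta}}$, $$E(Q,\delta)\ll \begin{cases} \delta^{2/3}Q^{5/3}(\log Q)^{2/3} & \text{if } \delta\gg T(Q),\\ \delta^{\frac{2}{5-\theta}}Q^{\frac{3(3-\theta)}{5-\theta}} & \text{if } \delta\ll T(Q),\end{cases}$$ with implied constants depending only on $f,\eta,\xi,\theta,\varepsilon$. (Since $\delta<1/2$, the first range does not occur when $\theta\le 1/2$.)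
   Context: For real $x$, $\|x\|=\min_{m\in\mathbb{Z}}|x-m|$ denotes the distance to the nearest integer. $f''\in\mathrm{Lip}_\theta([\eta,\xi])$ means there is a constant $C$ with $|f''(x)-f''(y)|\le C|x-y|^\theta$ for all $x,y\in[\eta,\xi]$. The notation $A\ll B$ (equivalently $B\gg A$) means $|A|\le cB$ for a constant $c>0$. *)

(* Defs.v *)
From Stdlib Require Import Reals Lra Lia ZArith List Ensembles Finite_sets
  Finite_sets_facts ClassicalEpsilon.
From Coquelicot Require Import Rbar Lub.

Open Scope R_scope.

Definition Icc (a b x : R) : Prop := a <= x <= b.

(* [x <> y] because [Rpower 0 theta] is not [0]. *)
Definition Lip (theta : R) (D : R -> Prop) (g : R -> R) : Prop :=
  exists C : R, forall x y : R, D x -> D y -> x <> y ->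
    Rabs (g x - g y) <= C * Rpower (Rabs (x - y)) theta.

(* The infimum is attained, see [dist_Z_min]. *)
Definition dist_Z (x : R) : R :=
  real (Glb_Rbar (fun d => exists m : Z, d = Rabs (x - IZR m))).

Lemma dist_Z_min (x : R) :
  exists m : Z, dist_Z x = Rabs (x - IZR m) /\
    forall k : Z, dist_Z x <= Rabs (x - IZR k).
Proof.
assert (H : exists m : Z, forall k : Z, Rabs (x - IZR m) <= Rabs (x - IZR k)).
{ destruct (archimed x) as [H1 H2].
  set (u := up x) in *.
  assert (Hk : forall k : Z, IZR k <= IZR u - 1 \/ IZR u <= IZR k).
  { intros k. destruct (Z_lt_le_dec k u) as [h|h].
    - left. rewrite <- minus_IZR. apply IZR_le. lia.
    - right. now apply IZR_le. }
  destruct (Rle_dec (x - (IZR u - 1)) (IZR u - x)) as [h|h].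
  - exists (u - 1)%Z. intros k. rewrite minus_IZR.
    destruct (Hk k); unfold Rabs; repeat destruct Rcase_abs; lra.
  - exists u. intros k.
    destruct (Hk k); unfold Rabs; repeat destruct Rcase_abs; lra. }
destruct H as [m Hm]. exists m.
assert (E : dist_Z x = Rabs (x - IZR m)).
{ unfold dist_Z. erewrite (is_glb_Rbar_unique _ (Finite (Rabs (x - IZR m)))).
  - reflexivity.
  - split.
    + intros d [k ->]. apply Hm.
    + intros b Hb. apply Hb. now exists m. }
split; [exact E|]. intros k. rewrite E. apply Hm.
Qed.

(* Meaningful only for finite sets. *)
Definition card {U : Type} (A : Ensemble U) : nat :=
  epsilon (inhabits 0%nat) (cardinal U A).

Definition near_points (f : R -> R) (eta xi Q delta : R) : Ensemble (Z * nat) :=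
  fun p => let (a, q) := p in
    Q < INR q <= 2 * Q /\
    eta * INR q < IZR a <= xi * INR q /\
    dist_Z (INR q * f (IZR a / INR q)) < delta.

Lemma near_points_finite (f : R -> R) (eta xi Q delta : R) :
  cardinal _ (near_points f eta xi Q delta)
    (card (near_points f eta xi Q delta)).
Proof.
unfold card. apply epsilon_spec, finite_cardinal.
set (A := near_points _ _ _ _ _).
assert (L : forall l : list (Z * nat), Finite_sets.Finite _ (fun p => List.In p l)).
{ induction l as [|p l IH].
  - apply Finite_downward_closed with (Empty_set _); [constructor|].
    intros p H. destruct H.
  - apply Finite_downward_closed with (Add _ (fun p => List.In p l) p).
    + now apply Add_preserves_Finite.
    + intros p' [->|H]; [right; constructor|now left]. }
set (B := (Rabs eta + Rabs xi) * (2 * Rabs Q)).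
set (K := Z.to_nat (up B)).
set (M := Z.to_nat (up (2 * Q))).
apply Finite_downward_closed with (1 := L (list_prod
  (map (fun n => Z.of_nat n - Z.of_nat K)%Z (seq 0 (2 * K + 1))) (seq 0 (S M)))).
intros [a q] [[H1 H2] [[H3 H4] _]].
assert (Hq := pos_INR q).
assert (HqQ : INR q <= 2 * Rabs Q) by (pose proof (Rle_abs Q); lra).
assert (Ha : Rabs (IZR a) <= B).
{ assert (G : forall z, Rabs z * INR q <= Rabs z * (2 * Rabs Q))
    by (intros z; apply Rmult_le_compat_l; [apply Rabs_pos|lra]).
  pose proof (G eta). pose proof (G xi).
  assert (0 <= Rabs eta * INR q) by (apply Rmult_le_pos; auto using Rabs_pos).
  assert (0 <= Rabs xi * INR q) by (apply Rmult_le_pos; auto using Rabs_pos).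
  assert (xi * INR q <= Rabs xi * INR q)
    by (apply Rmult_le_compat_r; [lra|apply Rle_abs]).
  assert (- Rabs eta * INR q <= eta * INR q)
    by (apply Rmult_le_compat_r; [lra|]; pose proof (Rle_abs (- eta));
        rewrite Rabs_Ropp in *; lra).
  unfold B. apply Rabs_le. lra. }
assert (HK : (Z.abs a < up B)%Z).
{ apply lt_IZR. rewrite abs_IZR. destruct (archimed B). lra. }
assert (HM : (Z.of_nat q < up (2 * Q))%Z).
{ apply lt_IZR. rewrite <- INR_IZR_INZ. destruct (archimed (2 * Q)). lra. }
apply in_prod; [|apply in_seq; unfold M; lia].
apply in_map_iff. exists (Z.to_nat (a + Z.of_nat K)).
split; [|apply in_seq]; unfold K; lia.
Qed.

Definition Ntilde (f : R -> R) (eta xi Q delta : R) : R :=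
  INR (card (near_points f eta xi Q delta)).

Definition Err (f : R -> R) (eta xi Q delta : R) : R :=
  Ntilde f eta xi Q delta - 3 * (xi - eta) * delta * Q ^ 2.

Definition T (theta Q : R) : R :=
  Rpower Q ((1 - 2 * theta) / (2 - theta)) *
  Rpower (ln Q) (- ((5 - theta) / (2 - theta))).

(* Main.v *)
Require Import Defs.
From Coquelicot Require Import Coquelicot.
From Stdlib Require Import Reals Lra Lia Psatz ZArith
  Ensembles Finite_sets ClassicalEpsilon List.
Open Scope R_scope.

(** Replace [f] by a uniformly convex function on the line and cut [(eta, xi]] into short
    arcs. The points counted on an arc are the points of [Z^3] in a plank, whose number
    agrees with the volume up to a relative error of the order of the covering radius; by
    transference this is at most a constant over the length of the shortest dual vector. A
    short dual vector is a line [y = (j x - k) / h] nearly tangent to the curve, that is a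
    rational point [(j/h, k/h)] very close to the Legendre transform of [f]. Such points are
    counted by Huxley's bound: the points very close to a curve on an arc of length
    comparable to the inverse of their denominators are collinear, and the lines carrying
    many of them have much smaller height and are again points very close to the Legendre
    transform. This gives the error [Q (delta Q)^(2/3)], stronger than both claims. *)

(** All scales come from one balance. [R0 ^ 3] is of order [d * Q], and the arcs have length [L]
    with [L ^ 2 * Q * R0] of order [d], so that [L * Q] is of order [R0]. On such an arc the tangent
    misses the curve by at most a multiple [1 / R0] of the thickness of the plank; if the dual
    vector has length [m >= 2 * R0], the lattice error is no worse, and all arcs together lose
    [d * Q ^ 2 / R0], which is of order [Q * R0 ^ 2], the final bound. The obstacle is the arcs with
    [m < 2 * R0], which lose [L * d * Q ^ 2 / m]. There [m >= h * d] for the denominator [h] of the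
    dual point, and one dual point serves, with suitable weights, about [sqrt R0] arcs. This gives
    [Q * R0 * sqrt R0] times the sum of [1 / h], which Huxley's bound makes at most an arbitrarily
    small power of [Q]. Since [d * Q] is at least a fixed positive power of [Q], that factor is
    absorbed by another [sqrt R0]. Huxley's induction closes because a function and its transform
    lie in one class, so the bound for smaller denominators is available for the transform. *)

Lemma Rdiv_nonneg (x y : R) : 0 <= x -> 0 < y -> 0 <= x / y.
Proof. intros. apply Rmult_le_pos; [assumption|]. left. now apply Rinv_0_lt_compat. Qed.

Lemma Rabs_le_of_sq (x y : R) : 0 <= y -> x ^ 2 <= y ^ 2 -> Rabs x <= y.
Proof.
  intros Hy H. rewrite <- (Rabs_pos_eq y) by assumption. apply Rsqr_le_abs_0.
  now rewrite !Rsqr_pow2.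
Qed.

Lemma Rinv_ge_1 (x : R) : 0 < x <= 1 -> 1 <= / x.
Proof. intros. rewrite <- Rinv_1. apply Rinv_le_contravar; lra. Qed.

Lemma Rinv_le_mult (x y : R) : 0 < x -> / x <= y -> 1 <= x * y.
Proof. intros Hx H. apply (Rmult_le_compat_l x) in H; [|lra]. rewrite Rinv_r in H; lra. Qed.

Lemma Rmult_sq_nonneg (k x : R) : 0 <= k -> 0 <= k * x ^ 2.
Proof. intros. apply Rmult_le_pos; [assumption|apply pow2_ge_0]. Qed.

Lemma sq_le_of_Rabs (x y : R) : Rabs x <= y -> x ^ 2 <= y ^ 2.
Proof. intros. rewrite <- pow2_abs. apply pow_incr. split; [apply Rabs_pos|assumption]. Qed.

(** * Counting in lists *)

Definition cdec (P : Prop) : bool :=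
  if excluded_middle_informative P then true else false.

Lemma cdec_true (P : Prop) : cdec P = true <-> P.
Proof. unfold cdec. destruct excluded_middle_informative; split; intuition discriminate. Qed.

Lemma cdec_if {A : Type} (P : Prop) (x y : A) : P -> (if cdec P then x else y) = x.
Proof. intros H. apply <- cdec_true in H. now rewrite H. Qed.

Definition ceq {A : Type} (x y : A) : {x = y} + {x <> y} :=
  excluded_middle_informative (x = y).

Definition sel {A : Type} (P : A -> Prop) (l : list A) : list A :=
  filter (fun x => cdec (P x)) l.

Lemma sel_in {A : Type} (P : A -> Prop) (l : list A) (x : A) :
  In x (sel P l) <-> In x l /\ P x.
Proof. unfold sel. rewrite filter_In, cdec_true. tauto. Qed.

Lemma sel_nodup {A : Type} (P : A -> Prop) (l : list A) :
  NoDup l -> NoDup (sel P l).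
Proof. apply NoDup_filter. Qed.

Fixpoint lsum {A : Type} (F : A -> R) (l : list A) : R :=
  match l with
  | nil => 0
  | x :: l' => F x + lsum F l'
  end.

Lemma lsum_le {A : Type} (F G : A -> R) (l : list A) :
  (forall x, In x l -> F x <= G x) -> lsum F l <= lsum G l.
Proof.
  induction l as [|x l IH]; simpl; intros H; [lra|].
  assert (F x <= G x) by auto. assert (lsum F l <= lsum G l) by auto. lra.
Qed.

Lemma lsum_ext {A : Type} (F G : A -> R) (l : list A) :
  (forall x, In x l -> F x = G x) -> lsum F l = lsum G l.
Proof. intros H. apply Rle_antisym; apply lsum_le; intros x Hx; rewrite (H x Hx); lra. Qed.

Lemma lsum_plus {A : Type} (F G : A -> R) (l : list A) :
  lsum (fun x => F x + G x) l = lsum F l + lsum G l.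
Proof. induction l; simpl; lra. Qed.

Lemma lsum_scal {A : Type} (k : R) (F : A -> R) (l : list A) :
  lsum (fun x => k * F x) l = k * lsum F l.
Proof. induction l as [|x l IH]; simpl; [lra|rewrite IH; lra]. Qed.

Lemma lsum_const {A : Type} (k : R) (l : list A) :
  lsum (fun _ => k) l = k * INR (length l).
Proof.
  induction l as [|x l IH]; [simpl; lra|].
  cbn [lsum length]. rewrite IH, S_INR. lra.
Qed.

Lemma lsum_abs {A : Type} (F : A -> R) (l : list A) :
  Rabs (lsum F l) <= lsum (fun x => Rabs (F x)) l.
Proof.
  induction l as [|x l IH]; simpl; [rewrite Rabs_R0; lra|].
  pose proof (Rabs_triang (F x) (lsum F l)). lra.
Qed.

Lemma lsum_sel {A : Type} (P : A -> Prop) (F : A -> R) (l : list A) :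
  lsum F (sel P l) = lsum (fun x => if cdec (P x) then F x else 0) l.
Proof.
  unfold sel. induction l as [|x l IH]; simpl; [lra|].
  destruct (cdec (P x)); simpl; rewrite IH; lra.
Qed.

Lemma lsum_point {B : Type} (k : B) (v : R) (ks : list B) :
  NoDup ks -> In k ks -> lsum (fun k' => if cdec (k = k') then v else 0) ks = v.
Proof.
  induction ks as [|k' ks IH]; intros Hn Hk; [destruct Hk|].
  inversion Hn as [|? ? Hn1 Hn2]; subst. simpl.
  destruct (ceq k k') as [->|Hne].
  - replace (cdec (k' = k')) with true by (symmetry; now apply <- cdec_true).
    rewrite (lsum_ext _ (fun _ => 0)).
    + rewrite lsum_const. lra.
    + intros x Hx. destruct (cdec (k' = x)) eqn:E; [|reflexivity].
      apply -> cdec_true in E. subst. now elim Hn1.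
  - replace (cdec (k = k')) with false.
    + rewrite IH; [lra|assumption|]. destruct Hk; congruence.
    + destruct (cdec (k = k')) eqn:E; [|reflexivity]. apply -> cdec_true in E. contradiction.
Qed.

Lemma lsum_fibers {A B : Type} (phi : A -> B) (F : A -> R) (l : list A) (ks : list B) :
  NoDup ks -> (forall x, In x l -> In (phi x) ks) ->
  lsum F l = lsum (fun k => lsum F (sel (fun x => phi x = k) l)) ks.
Proof.
  intros Hn. induction l as [|x l IH]; intros H.
  - simpl. rewrite lsum_const. lra.
  - simpl. rewrite IH by (intros; apply H; now right).
    rewrite (lsum_ext (fun k => lsum F (sel (fun x0 => phi x0 = k) (x :: l)))
      (fun k => (if cdec (phi x = k) then F x else 0)
        + lsum F (sel (fun x0 => phi x0 = k) l))).
    + rewrite lsum_plus, lsum_point; auto. apply H. now left.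
    + intros k _. unfold sel. simpl. destruct (cdec (phi x = k)); simpl; lra.
Qed.

(** A cardinality bound tested on duplicate-free lists: no finiteness or decidability has to be
    shown first, and a real [n] lets bounds be multiplied and compared analytically. *)
Definition atmost {A : Type} (P : A -> Prop) (n : R) : Prop :=
  forall l, NoDup l -> (forall x, In x l -> P x) -> INR (length l) <= n.

Lemma atmost_sub {A : Type} (P P' : A -> Prop) (n n' : R) :
  (forall x, P x -> P' x) -> n' <= n -> atmost P' n' -> atmost P n.
Proof.
  intros H Hn HP l Hl Hx. apply Rle_trans with n'; [|assumption].
  apply HP; auto.
Qed.

Lemma atmost_nonneg {A : Type} (P : A -> Prop) (n : R) : atmost P n -> 0 <= n.
Proof. intros H. apply (H nil); [constructor|intros x []]. Qed.

Lemma length_lsum {A : Type} (l : list A) : INR (length l) = lsum (fun _ => 1) l.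
Proof. rewrite lsum_const. lra. Qed.

Lemma sel_split {A : Type} (P : A -> Prop) (l : list A) :
  INR (length l) = INR (length (sel P l)) + INR (length (sel (fun x => ~ P x) l)).
Proof.
  rewrite !length_lsum, !lsum_sel, <- lsum_plus. apply lsum_ext. intros x _.
  unfold cdec. repeat destruct excluded_middle_informative; try lra; tauto.
Qed.

Lemma atmost_union {A : Type} (P P1 P2 : A -> Prop) (n1 n2 : R) :
  (forall x, P x -> P1 x \/ P2 x) -> atmost P1 n1 -> atmost P2 n2 ->
  atmost P (n1 + n2).
Proof.
  intros H H1 H2 l Hl Hx. rewrite (sel_split P1).
  assert (INR (length (sel P1 l)) <= n1).
  { apply H1; [now apply sel_nodup|]. intros x Hi. now apply sel_in in Hi. }
  assert (INR (length (sel (fun x => ~ P1 x) l)) <= n2).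
  { apply H2; [now apply sel_nodup|]. intros x Hi. apply sel_in in Hi.
    destruct Hi as [Hi1 Hi2]. destruct (H x); [auto|contradiction|assumption]. }
  lra.
Qed.

(** Counting by classes that may overlap: [epsilon] picks one class for each element, and the
    classes picked are at most [n]. *)
Lemma atmost_rel {A B : Type} (P : A -> Prop) (K : B -> Prop) (rel : B -> A -> Prop)
  (n N : R) :
  (forall x, P x -> exists k, K k /\ rel k x) -> atmost K n -> 0 <= N ->
  (forall k, K k -> atmost (fun x => P x /\ rel k x) N) -> atmost P (n * N).
Proof.
  intros H HK HN Hf l Hl Hx.
  (* A nonempty list provides the inhabitant of [B] that [epsilon] asks for. *)
  destruct l as [|x0 l0].
  { simpl. apply Rmult_le_pos; [exact (atmost_nonneg _ _ HK)|exact HN]. }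
  remember (x0 :: l0) as l.
  destruct (H x0) as [k0 _]; [apply Hx; subst; now left|].
  set (phi := fun x => epsilon (inhabits k0) (fun k => K k /\ rel k x)).
  assert (Hphi : forall x, In x l -> K (phi x) /\ rel (phi x) x).
  { intros x Hi. unfold phi. apply epsilon_spec. auto. }
  set (ks := nodup ceq (map phi l)).
  rewrite length_lsum, (lsum_fibers phi _ l ks).
  - apply Rle_trans with (lsum (fun _ => N) ks).
    + apply lsum_le. intros k Hk. rewrite <- length_lsum.
      apply nodup_In, in_map_iff in Hk. destruct Hk as [x [<- Hi]].
      apply (Hf (phi x)); [now apply Hphi|now apply sel_nodup|].
      intros y Hy. apply sel_in in Hy. destruct Hy as [Hy1 Hy2].
      split; [auto|]. rewrite <- Hy2. now apply Hphi.
    + rewrite lsum_const, Rmult_comm. apply Rmult_le_compat_r; [assumption|].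
      apply HK; [apply NoDup_nodup|]. intros k Hk.
      apply nodup_In, in_map_iff in Hk. destruct Hk as [x [<- Hi]]. now apply Hphi.
  - apply NoDup_nodup.
  - intros x Hi. apply nodup_In. now apply in_map.
Qed.

Lemma nodup_map_inj {A B : Type} (phi : A -> B) (l : list A) :
  NoDup l -> (forall x y, In x l -> In y l -> phi x = phi y -> x = y) ->
  NoDup (map phi l).
Proof.
  intros Hl Hinj. induction Hl as [|x l Hx Hl IH]; simpl; constructor.
  - intros Hi. apply in_map_iff in Hi. destruct Hi as [y [E Hy]].
    apply Hx. rewrite <- (Hinj y x); simpl; auto.
  - apply IH. intros y z Hy Hz. apply Hinj; now right.
Qed.

Lemma atmost_inj {A B : Type} (phi : A -> B) (P : B -> Prop) (n : R) (l : list A) :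
  NoDup l -> (forall x y, In x l -> In y l -> phi x = phi y -> x = y) ->
  (forall x, In x l -> P (phi x)) -> atmost P n -> INR (length l) <= n.
Proof.
  intros Hl Hinj HP Hn. rewrite <- (length_map phi). apply Hn.
  - now apply nodup_map_inj.
  - intros y Hy. apply in_map_iff in Hy. destruct Hy as [x [<- Hx]]. auto.
Qed.

(** * Integers in half-open intervals *)

Definition zint (u v : R) : list Z :=
  map (fun i => (Int_part u + 1 + Z.of_nat i)%Z)
    (seq 0 (Z.to_nat (Int_part v - Int_part u))).

Lemma Int_part_bounds (x : R) : IZR (Int_part x) <= x < IZR (Int_part x) + 1.
Proof. destruct (base_Int_part x). lra. Qed.

Lemma Int_part_le (x : R) (n : Z) : (n <= Int_part x)%Z <-> IZR n <= x.
Proof.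
  pose proof (Int_part_bounds x) as H. split; intros h.
  - apply IZR_le in h. lra.
  - assert (IZR n < IZR (Int_part x + 1)) by (rewrite plus_IZR; lra).
    apply lt_IZR in H0. lia.
Qed.

Lemma zint_in (u v : R) (n : Z) : In n (zint u v) <-> u < IZR n <= v.
Proof.
  unfold zint. rewrite in_map_iff. split.
  - intros [i [<- Hi]]. apply in_seq in Hi.
    split.
    + pose proof (Int_part_bounds u). rewrite !plus_IZR.
      assert (0 <= IZR (Z.of_nat i)) by (apply IZR_le; lia). lra.
    + apply Int_part_le. lia.
  - intros [H1 H2]. apply Int_part_le in H2.
    assert (~ (n <= Int_part u)%Z) by (rewrite Int_part_le; lra).
    exists (Z.to_nat (n - Int_part u - 1)). split; [lia|]. apply in_seq. lia.
Qed.

Lemma zint_nodup (u v : R) : NoDup (zint u v).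
Proof.
  unfold zint. apply nodup_map_inj; [apply seq_NoDup|].
  intros i j _ _. lia.
Qed.

Lemma zint_len_up (u v : R) : u - 1 <= v -> INR (length (zint u v)) <= v - u + 1.
Proof.
  intros H. unfold zint. rewrite length_map, length_seq.
  pose proof (Int_part_bounds u). pose proof (Int_part_bounds v).
  rewrite INR_IZR_INZ. destruct (Z_le_dec (Int_part u) (Int_part v)).
  - rewrite Z2Nat.id by lia. rewrite minus_IZR. lra.
  - replace (Z.of_nat _) with 0%Z by lia. lra.
Qed.

Lemma zint_len_low (u v : R) : v - u - 1 <= INR (length (zint u v)).
Proof.
  unfold zint. rewrite length_map, length_seq.
  pose proof (Int_part_bounds u). pose proof (Int_part_bounds v).
  rewrite INR_IZR_INZ.
  assert (IZR (Int_part v - Int_part u) <= IZR (Z.of_nat (Z.to_nat (Int_part v - Int_part u))))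
    by (apply IZR_le; lia).
  rewrite minus_IZR in H1. lra.
Qed.

Lemma zint_sum (u v : R) : u <= v ->
  lsum IZR (zint u v) =
    (IZR (Int_part v) - IZR (Int_part u)) * (IZR (Int_part v) + IZR (Int_part u) + 1) / 2.
Proof.
  intros H. unfold zint.
  assert (Hle : (Int_part u <= Int_part v)%Z).
  { apply Int_part_le. pose proof (Int_part_bounds u). lra. }
  assert (G : forall k a, lsum IZR (map (fun i => (a + 1 + Z.of_nat i)%Z) (seq 0 k)) =
     INR k * (2 * IZR a + INR k + 1) / 2).
  { induction k as [|k IH]; intros a; [simpl; lra|].
    rewrite seq_S, map_app.
    assert (E : forall l1 l2, lsum IZR (l1 ++ l2) = lsum IZR l1 + lsum IZR l2)
      by (induction l1; simpl; intros; [lra|rewrite IHl1; lra]).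
    rewrite E, IH. cbn [map lsum]. rewrite S_INR, !plus_IZR, Nat.add_0_l, <- INR_IZR_INZ.
    field. }
  rewrite G, INR_IZR_INZ, Z2Nat.id by lia. rewrite minus_IZR. field.
Qed.

Lemma zint_sum_up (u v : R) : u <= v -> 0 <= u + v + 1 ->
  lsum IZR (zint u v) <= (v - u + 1) * (u + v + 1) / 2.
Proof.
  intros H H1. rewrite zint_sum by assumption.
  pose proof (Int_part_bounds u). pose proof (Int_part_bounds v).
  assert (IZR (Int_part u) <= IZR (Int_part v)).
  { apply IZR_le, Int_part_le. lra. }
  set (a := IZR (Int_part u)) in *. set (b := IZR (Int_part v)) in *.
  assert ((b - a) * (b + a + 1) <= (b - a) * (u + v + 1)) by (apply Rmult_le_compat_l; lra).
  assert ((b - a) * (u + v + 1) <= (v - u + 1) * (u + v + 1)) by (apply Rmult_le_compat_r; lra).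
  lra.
Qed.

Lemma zint_sum_low (u v : R) : u <= v -> 1 <= u + v ->
  (v - u - 1) * (u + v - 1) / 2 <= lsum IZR (zint u v).
Proof.
  intros H H1. rewrite zint_sum by assumption.
  pose proof (Int_part_bounds u). pose proof (Int_part_bounds v).
  assert (IZR (Int_part u) <= IZR (Int_part v)).
  { apply IZR_le, Int_part_le. lra. }
  set (a := IZR (Int_part u)) in *. set (b := IZR (Int_part v)) in *.
  assert ((b - a) * (b + a + 1) >= (b - a) * (u + v - 1)) by (apply Rle_ge, Rmult_le_compat_l; lra).
  assert ((b - a) * (u + v - 1) >= (v - u - 1) * (u + v - 1)) by (apply Rle_ge, Rmult_le_compat_r; lra).
  lra.
Qed.

Lemma atmost_zint (u v : R) : u - 1 <= v -> atmost (fun n => u < IZR n <= v) (v - u + 1).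
Proof.
  intros H l Hl Hx. apply Rle_trans with (INR (length (zint u v))); [|now apply zint_len_up].
  apply le_INR, NoDup_incl_length; [assumption|]. intros n Hn. apply zint_in. auto.
Qed.

Lemma atmost_fiberZ {A : Type} (P : A -> Prop) (phi : A -> Z) (B N : R) :
  0 <= B -> 0 <= N -> (forall x, P x -> 0 <= IZR (phi x) <= B) ->
  (forall k, atmost (fun x => P x /\ phi x = k) N) -> atmost P ((B + 1) * N).
Proof.
  intros HB HN H Hf.
  apply atmost_rel with (K := fun k => 0 <= IZR k <= B) (rel := fun k x => phi x = k).
  - intros x Hx. exists (phi x). auto.
  (* [atmost_zint] on [(-1, B]] would give [B + 2]; one is saved because the left endpoint is an
     integer. *)
  - apply atmost_sub with (P' := fun k => -1 < IZR k <= B) (n' := B - -1 + 1 - 1).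
    + intros; lra.
    + lra.
    + intros l Hl Hx. apply Rle_trans with (INR (length (zint (-1) B))).
      * apply le_INR, NoDup_incl_length; [assumption|]. intros n Hn. apply zint_in. auto.
      * unfold zint. rewrite length_map, length_seq.
        assert (E : Int_part (-1) = (-1)%Z).
        { pose proof (Int_part_bounds (-1)) as h.
          assert (h1 : (Int_part (-1) <= -1)%Z) by (apply le_IZR; lra).
          assert (h2 : (-1 <= Int_part (-1))%Z) by (apply Int_part_le; lra). lia. }
        rewrite E. pose proof (Int_part_bounds B).
        assert (0 <= Int_part B)%Z by (apply Int_part_le; lra).
        rewrite INR_IZR_INZ, Z2Nat.id by lia. rewrite minus_IZR. lra.
  - assumption.
  - intros k _. apply Hf.
Qed.

Lemma list_min {A : Type} (phi : A -> R) (l : list A) : l <> nil ->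
  exists x, In x l /\ forall y, In y l -> phi x <= phi y.
Proof.
  induction l as [|x l IH]; intros H; [congruence|].
  destruct l as [|y l].
  - exists x. split; [now left|]. intros y [<-|[]]. lra.
  - destruct IH as [m [Hm1 Hm2]]; [discriminate|].
    destruct (Rle_dec (phi x) (phi m)).
    + exists x. split; [now left|]. intros z [<-|Hz]; [lra|].
      specialize (Hm2 z Hz). lra.
    + exists m. split; [now right|]. intros z [<-|Hz]; [lra|auto].
Qed.

(** Measured from the leftmost point, the values of [phi] fall into at most [w / s + 1] cells of
    length [s], and two points in one cell would be closer than [s]. *)
Lemma atmost_spaced {A : Type} (P : A -> Prop) (phi : A -> R) (s w : R) :
  0 < s -> 0 <= w ->
  (forall x y, P x -> P y -> x <> y -> s <= Rabs (phi x - phi y) <= w) ->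
  atmost P (w / s + 1).
Proof.
  intros Hs Hw H l Hl Hx.
  assert (Hws : 0 <= w / s) by (apply Rdiv_nonneg; lra).
  destruct (ceq l nil) as [->|Hne]; [simpl; lra|].
  destruct (list_min phi l Hne) as [m [Hm1 Hm2]].
  set (i := fun x => Int_part ((phi x - phi m) / s)).
  rewrite <- (Rmult_1_r (w / s + 1)).
  apply (atmost_fiberZ (fun x => In x l) i); auto; [lra| |].
  - intros x Hi. specialize (Hm2 x Hi). unfold i. split.
    + apply IZR_le, Int_part_le. apply Rdiv_nonneg; lra.
    + pose proof (Int_part_bounds ((phi x - phi m) / s)).
      assert ((phi x - phi m) / s <= w / s).
      { apply Rmult_le_compat_r; [left; now apply Rinv_0_lt_compat|].
        destruct (ceq x m) as [->|Hd]; [lra|].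
        destruct (H x m) as [_ h]; auto. rewrite Rabs_pos_eq in h; lra. }
      lra.
  - intros k l' Hl' Hx'. destruct l' as [|x [|y l']]; simpl; [lra|lra|].
    exfalso. assert (Hxy : x <> y).
    { inversion Hl' as [|? ? h _]; subst. intros ->. apply h. now left. }
    destruct (Hx' x) as [Hx1 Hx2]; [simpl; auto|].
    destruct (Hx' y) as [Hy1 Hy2]; [simpl; auto|].
    destruct (H x y) as [h _]; auto. unfold i in *.
    pose proof (Int_part_bounds ((phi x - phi m) / s)) as b1.
    pose proof (Int_part_bounds ((phi y - phi m) / s)) as b2.
    rewrite Hx2 in b1. rewrite Hy2 in b2.
    assert (Hd : Rabs ((phi x - phi m) / s - (phi y - phi m) / s) < 1)
      by (apply Rabs_def1; lra).
    replace ((phi x - phi m) / s - (phi y - phi m) / s) with ((phi x - phi y) / s) in Hd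
      by (field; lra).
    unfold Rdiv in Hd. rewrite Rabs_mult, (Rabs_pos_eq (/ s)) in Hd
      by (left; now apply Rinv_0_lt_compat).
    apply (Rmult_lt_compat_r s) in Hd; [|assumption].
    rewrite Rmult_assoc, Rinv_l in Hd by lra. lra.
Qed.

(** * Uniformly convex functions and the Legendre transform *)

(** For twice differentiable [f] with [g = f'] this is [c <= f'' <= / c]. In this form it passes to
    the Legendre transform without any discussion of second derivatives. *)
Definition cvx (c : R) (f g : R -> R) : Prop :=
  0 < c /\ forall x y : R,
    c / 2 * (y - x) ^ 2 <= f y - f x - g x * (y - x) <= / (2 * c) * (y - x) ^ 2.

Lemma cvx_pos (c : R) (f g : R -> R) : cvx c f g -> 0 < c <= 1.
Proof.
  intros [Hc H]. split; [assumption|].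
  destruct (H 0 1) as [h1 h2].
  assert (h : c / 2 <= / (2 * c)) by lra.
  apply (Rmult_le_compat_r (2 * c)) in h; [|lra].
  rewrite Rinv_l in h by lra. nra.
Qed.

Lemma cvx_grad (c : R) (f g : R -> R) (x y : R) : cvx c f g ->
  c * (y - x) ^ 2 <= (g y - g x) * (y - x) <= / c * (y - x) ^ 2.
Proof.
  intros [Hc H]. destruct (H x y) as [h1 h2]. destruct (H y x) as [h3 h4].
  replace (/ c) with (/ (2 * c) + / (2 * c)) by (field; lra).
  set (k := / (2 * c)) in *. split; nra.
Qed.

Lemma cvx_grad_abs (c : R) (f g : R -> R) (x y : R) : cvx c f g ->
  c * Rabs (y - x) <= Rabs (g y - g x) <= / c * Rabs (y - x).
Proof.
  intros H. pose proof (cvx_grad c f g x y H) as [h1 h2].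
  destruct (Req_dec x y) as [->|Hne].
  { rewrite !Rminus_diag, Rabs_R0. lra. }
  assert (0 < c) by apply H.
  assert (0 < / c) by (now apply Rinv_0_lt_compat).
  assert (Hp : 0 < Rabs (y - x)) by (apply Rabs_pos_lt; lra).
  assert (E : (g y - g x) * (y - x) = Rabs (g y - g x) * Rabs (y - x)).
  { rewrite <- Rabs_mult. symmetry. apply Rabs_pos_eq.
    apply Rle_trans with (c * (y - x) ^ 2); [|assumption].
    apply Rmult_le_pos; [lra|apply pow2_ge_0]. }
  rewrite E, <- (pow2_abs (y - x)) in *.
  split; apply Rmult_le_reg_r with (Rabs (y - x)); try assumption; nra.
Qed.

Lemma cvx_grad_mono (c : R) (f g : R -> R) (x y : R) : cvx c f g ->
  x <= y -> g x <= g y.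
Proof.
  intros H Hxy. destruct (Req_dec x y) as [->|Hne]; [lra|].
  pose proof (cvx_grad c f g x y H) as [h1 _]. assert (0 < c) by apply H.
  assert (0 <= c * (y - x) ^ 2) by (apply Rmult_sq_nonneg; lra).
  nra.
Qed.

Lemma cvx_grad_cont (c : R) (f g : R -> R) : cvx c f g -> continuity g.
Proof.
  intros H x e He. assert (Hc : 0 < c) by apply H.
  exists (e * c). split; [nra|]. intros y [_ Hy]. simpl in *.
  unfold R_dist in *. pose proof (cvx_grad_abs c f g x y H) as [_ h].
  apply Rle_lt_trans with (1 := h). apply Rmult_lt_reg_l with c; [assumption|].
  rewrite <- Rmult_assoc, Rinv_r by lra. lra.
Qed.

(** [g] grows at rate at least [c], so it has passed [p] at distance [(Rabs (p - g 0) + 1) / c] from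
    the origin. *)
Lemma cvx_grad_surj (c : R) (f g : R -> R) (p : R) : cvx c f g -> exists x, g x = p.
Proof.
  intros H. assert (Hc : 0 < c) by apply H.
  set (d := (Rabs (p - g 0) + 1) / c).
  assert (Hd : 0 < d).
  { apply Rmult_lt_0_compat; [pose proof (Rabs_pos (p - g 0)); lra|].
    now apply Rinv_0_lt_compat. }
  assert (Hcd : c * d = Rabs (p - g 0) + 1) by (unfold d; field; lra).
  assert (H1 : g (- d) < p).
  { pose proof (cvx_grad c f g (- d) 0 H) as [h _].
    pose proof (Rle_abs (- (p - g 0))) as h1. rewrite Rabs_Ropp in h1. nra. }
  assert (H2 : p < g d).
  { pose proof (cvx_grad c f g 0 d H) as [h _].
    pose proof (Rle_abs (p - g 0)) as h1. nra. }
  destruct (IVT (fun x => g x - p) (- d) d) as [x [_ Hx]]; try lra.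
  - apply continuity_minus; [now apply (cvx_grad_cont c f)|].
    apply continuity_const. intros ? ?. reflexivity.
  - exists x. lra.
Qed.

(** The supremum of [p * x - f x] is attained where [g x = p]; hence [gs] is both a right inverse of
    [g] and, by [cvx_legendre], the gradient of the transform. *)
Definition legendre (f g fs gs : R -> R) : Prop :=
  forall p, g (gs p) = p /\ fs p = p * gs p - f (gs p).

(* Keeping the same constant [c] makes the class self-dual under the Legendre transform. *)
Lemma cvx_legendre (c : R) (f g : R -> R) : cvx c f g ->
  exists fs gs, cvx c fs gs /\ legendre f g fs gs.
Proof.
  intros H. assert (Hc : 0 < c) by apply H.
  set (gs := fun p => epsilon (inhabits 0) (fun x => g x = p)).
  assert (Hg : forall p, g (gs p) = p).
  { intros p. unfold gs. apply epsilon_spec. now apply (cvx_grad_surj c f). }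
  exists (fun p => p * gs p - f (gs p)), gs. split; [|intros p; now split].
  split; [assumption|]. intros p p'.
  set (x := gs p). set (x' := gs p').
  assert (Hx : g x = p) by apply Hg. assert (Hx' : g x' = p') by apply Hg.
  destruct H as [_ H].
  replace (p' * x' - f x' - (p * x - f x) - x * (p' - p))
    with (f x - f x' - g x' * (x - x')) by (rewrite Hx'; ring).
  split.
  (* A gradient step of length [c] for the function [f] minus the line of slope [p']: comparing at
     this [y] the upper quadratic bound from [x] with the lower bound from [x'] gives the
     estimate. *)
  - set (y := x - (p - p') * c).
    destruct (H x y) as [_ h1]. destruct (H x' y) as [h2 _].
    assert (0 <= c / 2 * (y - x') ^ 2) by (apply Rmult_sq_nonneg; lra).
    replace (y - x) with (- (p - p') * c) in h1 by (unfold y; ring).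
    replace (/ (2 * c) * (- (p - p') * c) ^ 2) with (c / 2 * (p - p') ^ 2) in h1
      by (field; lra).
    rewrite Hx in h1. rewrite Hx' in *. unfold y in *. nra.
  - destruct (H x x') as [h1 _]. rewrite Hx in h1. rewrite Hx'.
    apply Rle_trans with ((p - p') * (x - x') - c / 2 * (x' - x) ^ 2); [nra|].
    apply Rmult_le_reg_l with (2 * c); [lra|].
    rewrite <- Rmult_assoc, Rinv_r by lra.
    pose proof (pow2_ge_0 (p - p' - c * (x - x'))). nra.
Qed.

Lemma cvx_affine (c : R) (f g : R -> R) (p s : R) : cvx c f g ->
  cvx c (fun x => f x - (p * x - s)) (fun x => g x - p).
Proof.
  intros [Hc H]. split; [assumption|]. intros x y. specialize (H x y).
  replace (f y - (p * y - s) - (f x - (p * x - s)) - (g x - p) * (y - x))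
    with (f y - f x - g x * (y - x)) by ring. exact H.
Qed.

(** Used for the curve minus a line: a small slope at [x] forces the value at [x] to be close to the
    minimum (the middle bound) and [x] to be close to the point of tangency (the last one). *)
Lemma cvx_min (c : R) (f g : R -> R) (x0 x : R) : cvx c f g -> g x0 = 0 ->
  f x0 <= f x /\ f x - f x0 <= (g x) ^ 2 / (2 * c) /\ c * Rabs (x - x0) <= Rabs (g x).
Proof.
  intros H H0. assert (Hc : 0 < c) by apply H. split; [|split].
  - destruct H as [_ H]. destruct (H x0 x) as [h _]. rewrite H0 in h.
    assert (0 <= c / 2 * (x - x0) ^ 2) by (apply Rmult_sq_nonneg; lra). lra.
  - destruct H as [_ H]. destruct (H x x0) as [h _].
    apply Rmult_le_reg_l with (2 * c); [lra|].
    replace (2 * c * ((g x) ^ 2 / (2 * c))) with ((g x) ^ 2) by (field; lra).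
    pose proof (pow2_ge_0 (g x + c * (x0 - x))). nra.
  - pose proof (cvx_grad_abs c f g x0 x H) as [h _]. rewrite H0, Rminus_0_r in h. exact h.
Qed.

(** Away from the minimizer the gradient term has the right sign, so [f] grows by at least
    [c / 2 * (y - x) ^ 2], while it can change by at most [2 * e]. Both points must be on one side
    of [x0]: if the minimum is very negative, the set [Rabs (f x) <= e] consists of two distant
    intervals. *)
Lemma cvx_sublevel (c : R) (f g : R -> R) (x0 x y e : R) : cvx c f g -> g x0 = 0 ->
  0 <= (x - x0) * (y - x0) -> Rabs (f x) <= e -> Rabs (f y) <= e ->
  c * (y - x) ^ 2 <= 4 * e.
Proof.
  intros H H0 Hs.
  assert (G : forall x y, 0 <= (y - x) * (x - x0) -> Rabs (f x) <= e -> Rabs (f y) <= e ->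
    c * (y - x) ^ 2 <= 4 * e).
  { clear x y Hs. intros x y Hs Hx Hy. apply Rabs_le_between in Hx, Hy.
    assert (Hg : 0 <= g x * (y - x)).
    { destruct (Rle_dec x0 x) as [h|h].
      - assert (0 <= g x) by (rewrite <- H0; now apply (cvx_grad_mono c f)).
        destruct (Req_dec x x0) as [->|]; [rewrite H0; lra|].
        apply Rmult_le_pos; nra.
      - assert (g x <= 0) by (rewrite <- H0; apply (cvx_grad_mono c f); [assumption|lra]).
        assert (y - x <= 0) by nra. nra. }
    destruct H as [_ H]. destruct (H x y) as [h _]. lra. }
  intros Hx Hy.
  destruct (Rle_dec 0 ((y - x) * (x - x0))) as [h|h]; [now apply G|].
  replace ((y - x) ^ 2) with ((x - y) ^ 2) by ring. apply G; auto. nra.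
Qed.

(** * Rational points and lines *)

(* [mkpt q a b] is the rational point [(a/q, b/q)] in homogeneous coordinates; the same
   type is used for the dual points [mkpt h j k], i.e. the lines [y = (j x - k) / h]. *)
Record pt : Set := mkpt { pq : Z; pa : Z; pb : Z }.

Lemma pt_eq (z w : pt) : pq z = pq w -> pa z = pa w -> pb z = pb w -> z = w.
Proof. destruct z, w; simpl; congruence. Qed.

(** Vanishes when [z] lies on the line [y = (j x - k) / h] attached to [l]. With these signs the
    dual point [(j/h, k/h)] is the slope and minus the intercept, as for a Legendre transform. *)
Definition inc (l z : pt) : Z := (pq l * pb z - pa l * pa z + pb l * pq z)%Z.

Definition cross (z w : pt) : pt :=
  mkpt (pq z * pa w - pq w * pa z) (pq z * pb w - pq w * pb z) (pa z * pb w - pa w * pb z).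

(** Coprimality in Bezout form, because the coefficients directly provide the integral multipliers
    in [cross_on_line] and [prim_parallel]. *)
Definition prim (z : pt) : Prop :=
  exists s1 s2 s3 : Z, (s1 * pq z + s2 * pa z + s3 * pb z = 1)%Z.

Definition dil (n : Z) (z : pt) : pt := mkpt (n * pq z) (n * pa z) (n * pb z).

Lemma prim_part (z : pt) : z <> mkpt 0 0 0 ->
  exists d w, (0 < d)%Z /\ prim w /\ z = dil d w.
Proof.
  destruct z as [q a b]. intros Hz.
  set (g1 := Z.gcd q a). set (d := Z.gcd g1 b).
  assert (Hd0 : (0 <= d)%Z) by apply Z.gcd_nonneg.
  destruct (Z.gcd_divide_l q a) as [q1 Hq1]. destruct (Z.gcd_divide_r q a) as [a1 Ha1].
  destruct (Z.gcd_divide_l g1 b) as [g2 Hg2]. destruct (Z.gcd_divide_r g1 b) as [b1 Hb1].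
  destruct (Z.gcd_bezout q a g1 eq_refl) as [u [v Huv]].
  destruct (Z.gcd_bezout g1 b d eq_refl) as [u' [v' Huv']].
  fold g1 in Hq1, Ha1. fold d in Hg2, Hb1. clearbody d g1.
  assert (Hd : d <> 0%Z).
  { intros E. apply Hz. rewrite E in *. f_equal; nia. }
  exists d, (mkpt (q1 * g2) (a1 * g2) b1). split; [lia|]. split.
  - exists (u' * u)%Z, (u' * v)%Z, v'. simpl.
    apply Z.mul_reg_r with d; [assumption|].
    transitivity (u' * (u * (q1 * (g2 * d)) + v * (a1 * (g2 * d))) + v' * (b1 * d))%Z;
      [ring|].
    rewrite <- Hg2, <- Hb1, <- Hq1, <- Ha1, Huv, Huv'. ring.
  - unfold dil. simpl. f_equal; [rewrite Hq1, Hg2|rewrite Ha1, Hg2|rewrite Hb1]; ring.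
Qed.

Lemma inc_cross_l (z w : pt) : inc (cross z w) z = 0%Z.
Proof. unfold inc, cross; simpl; ring. Qed.

Lemma inc_cross_r (z w : pt) : inc (cross z w) w = 0%Z.
Proof. unfold inc, cross; simpl; ring. Qed.

Lemma inc_dil (n : Z) (l z : pt) : inc (dil n l) z = (n * inc l z)%Z.
Proof. unfold inc, dil; simpl; ring. Qed.

(** [cross z w] is parallel to [l], as [E1], [E2], [E3] say; pairing it with the Bezout coefficients
    of [l] makes the ratio an integer. *)
Lemma cross_on_line (l z w : pt) : prim l -> inc l z = 0%Z -> inc l w = 0%Z ->
  exists n, cross z w = dil n l.
Proof.
  intros [s1 [s2 [s3 Hs]]] Hz Hw. unfold inc in Hz, Hw.
  destruct l as [h j k], z as [q a b], w as [q' a' b']; simpl in *.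
  exists (s1 * (q * a' - q' * a) + s2 * (q * b' - q' * b) + s3 * (a * b' - a' * b))%Z.
  unfold cross, dil; simpl.
  assert (E1 : ((q * a' - q' * a) * j = h * (q * b' - q' * b))%Z) by (assert (q * (h * b' - j * a' + k * q') - q' * (h * b - j * a + k * q) = 0)%Z by (rewrite Hz, Hw; ring); lia).
  assert (E2 : (k * (q * a' - q' * a) = h * (a * b' - a' * b))%Z) by (assert (a * (h * b' - j * a' + k * q') - a' * (h * b - j * a + k * q) = 0)%Z by (rewrite Hz, Hw; ring); lia).
  assert (E3 : (k * (q * b' - q' * b) = j * (a * b' - a' * b))%Z) by (assert (b * (h * b' - j * a' + k * q') - b' * (h * b - j * a + k * q) = 0)%Z by (rewrite Hz, Hw; ring); lia).
  set (H := (q * a' - q' * a)%Z) in *. set (J := (q * b' - q' * b)%Z) in *.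
  set (K := (a * b' - a' * b)%Z) in *.
  f_equal.
  - replace H with (H * (s1 * h + s2 * j + s3 * k))%Z at 1 by (rewrite Hs; ring).
    transitivity (s1 * H * h + s2 * (H * j) + s3 * (k * H))%Z; [ring|].
    rewrite E1, E2. ring.
  - replace J with (J * (s1 * h + s2 * j + s3 * k))%Z at 1 by (rewrite Hs; ring).
    transitivity (s1 * (h * J) + s2 * J * j + s3 * (k * J))%Z; [ring|].
    rewrite <- E1, E3. ring.
  - replace K with (K * (s1 * h + s2 * j + s3 * k))%Z at 1 by (rewrite Hs; ring).
    transitivity (s1 * (h * K) + s2 * (j * K) + s3 * K * k)%Z; [ring|].
    rewrite <- E2, <- E3. ring.
Qed.

Lemma prim_parallel (v z : pt) : prim v -> cross v z = mkpt 0 0 0 ->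
  exists m, z = dil m v.
Proof.
  intros [s1 [s2 [s3 Hs]]] H.
  destruct v as [q a b], z as [q' a' b']; unfold cross in H; simpl in *.
  injection H as H1 H2 H3.
  assert (G : forall s, (s * (q * a' - q' * a) = 0 /\ s * (q * b' - q' * b) = 0 /\
    s * (a * b' - a' * b) = 0)%Z) by (intros s; rewrite H1, H2, H3; lia).
  pose proof (G s1) as [? [? ?]]. pose proof (G s2) as [? [? ?]].
  pose proof (G s3) as [? [? ?]].
  exists (s1 * q' + s2 * a' + s3 * b')%Z. unfold dil; simpl. f_equal.
  - replace q' with (q' * (s1 * q + s2 * a + s3 * b))%Z at 1 by (rewrite Hs; ring). lia.
  - replace a' with (a' * (s1 * q + s2 * a + s3 * b))%Z at 1 by (rewrite Hs; ring). lia.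
  - replace b' with (b' * (s1 * q + s2 * a + s3 * b))%Z at 1 by (rewrite Hs; ring). lia.
Qed.

Lemma prim_parallel_eq (v z : pt) : prim v -> prim z -> (0 < pq v)%Z -> (0 < pq z)%Z ->
  cross v z = mkpt 0 0 0 -> v = z.
Proof.
  intros Hv Hz Hqv Hqz H. destruct (prim_parallel v z Hv H) as [m E].
  subst z. simpl in Hqz. destruct Hz as [s1 [s2 [s3 Hs]]]. simpl in Hs.
  assert (Hm : (m * (s1 * pq v + s2 * pa v + s3 * pb v) = 1)%Z) by (rewrite <- Hs; ring).
  apply Z.mul_eq_1 in Hm. destruct v as [q a b]; unfold dil; simpl in *.
  assert (m = 1%Z) by nia. subst m. f_equal; ring.
Qed.

Definition xc (z : pt) : R := IZR (pa z) / IZR (pq z).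
Definition yc (z : pt) : R := IZR (pb z) / IZR (pq z).

Lemma pa_xc (z : pt) : (0 < pq z)%Z -> IZR (pa z) = IZR (pq z) * xc z.
Proof. intros H. apply IZR_lt in H. unfold xc. field. lra. Qed.

Lemma pb_yc (z : pt) : (0 < pq z)%Z -> IZR (pb z) = IZR (pq z) * yc z.
Proof. intros H. apply IZR_lt in H. unfold yc. field. lra. Qed.

Lemma cross_h (z w : pt) : (0 < pq z)%Z -> (0 < pq w)%Z ->
  IZR (pq (cross z w)) = IZR (pq z) * IZR (pq w) * (xc w - xc z).
Proof.
  intros Hz Hw. unfold cross; simpl. rewrite minus_IZR, !mult_IZR.
  rewrite (pa_xc z), (pa_xc w) by assumption. ring.
Qed.

Lemma cross_j (z w : pt) : (0 < pq z)%Z -> (0 < pq w)%Z ->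
  IZR (pa (cross z w)) = IZR (pq z) * IZR (pq w) * (yc w - yc z).
Proof.
  intros Hz Hw. unfold cross; simpl. rewrite minus_IZR, !mult_IZR.
  rewrite (pb_yc z), (pb_yc w) by assumption. ring.
Qed.

Lemma cross_zero (z w : pt) : (0 < pq z)%Z -> (0 < pq w)%Z -> xc z = xc w -> yc z = yc w ->
  cross z w = mkpt 0 0 0.
Proof.
  intros Hz Hw Hx Hy.
  apply pt_eq; apply eq_IZR.
  - rewrite cross_h, Hx by assumption. simpl. ring.
  - rewrite cross_j, Hy by assumption. simpl. ring.
  - unfold cross; simpl. rewrite minus_IZR, !mult_IZR.
    rewrite (pa_xc z), (pa_xc w), (pb_yc z), (pb_yc w), Hx, Hy by assumption. ring.
Qed.

Lemma inc_yc (l z : pt) : (0 < pq l)%Z -> (0 < pq z)%Z -> inc l z = 0%Z ->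
  yc z = xc l * xc z - yc l.
Proof.
  intros Hl Hz H. unfold inc in H. apply (f_equal IZR) in H.
  rewrite plus_IZR, minus_IZR, !mult_IZR in H.
  rewrite (pa_xc l), (pa_xc z), (pb_yc l), (pb_yc z) in H by assumption.
  apply IZR_lt in Hl, Hz.
  apply Rmult_eq_reg_l with (IZR (pq l) * IZR (pq z)).
  - lra.
  - apply Rmult_integral_contrapositive. lra.
Qed.

(** * Points very close to a curve *)

(* The constant [c / 200] is small enough to be reproduced by [near_dual]. *)
Definition near (c : R) (f : R -> R) (z : pt) : Prop :=
  (0 < pq z)%Z /\ prim z /\
  Rabs (IZR (pq z) * f (xc z) - IZR (pb z)) <= c / 200 / IZR (pq z).

Lemma Rabs_mult_le (x y a b : R) : Rabs x <= a -> Rabs y <= b -> Rabs (x * y) <= a * b.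
Proof. intros. rewrite Rabs_mult. apply Rmult_le_compat; auto using Rabs_pos. Qed.

Lemma near_yc (c A : R) (f : R -> R) (z : pt) : 0 < c -> 0 < A -> near c f z ->
  A <= IZR (pq z) -> Rabs (f (xc z) - yc z) <= c / (200 * A ^ 2).
Proof.
  intros Hc HA [Hq [_ Hn]] Hz. rewrite pb_yc in Hn by assumption.
  set (q := IZR (pq z)) in *.
  replace (q * f (xc z) - q * yc z) with (q * (f (xc z) - yc z)) in Hn by ring.
  rewrite Rabs_mult, (Rabs_pos_eq q) in Hn by lra.
  apply Rle_trans with (c / 200 / (q * q)).
  - apply Rmult_le_reg_l with q; [lra|]. apply Rle_trans with (1 := Hn).
    right. field. lra.
  - replace (c / (200 * A ^ 2)) with (c / 200 / (A * A)) by (field; lra).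
    apply Rmult_le_compat_l; [lra|]. apply Rinv_le_contravar; nra.
Qed.

Lemma inc_cross_R (z1 z2 z3 : pt) : (0 < pq z1)%Z -> (0 < pq z2)%Z -> (0 < pq z3)%Z ->
  IZR (inc (cross z1 z2) z3) = IZR (pq z1) * IZR (pq z2) * IZR (pq z3) *
    ((xc z2 - xc z1) * (yc z3 - yc z1) - (xc z3 - xc z1) * (yc z2 - yc z1)).
Proof.
  intros H1 H2 H3. unfold inc, cross; simpl.
  rewrite ?plus_IZR, ?minus_IZR, ?mult_IZR, ?minus_IZR, ?mult_IZR, ?minus_IZR, ?mult_IZR.
  rewrite !(pa_xc z1), !(pa_xc z2), !(pa_xc z3), !(pb_yc z1), !(pb_yc z2), !(pb_yc z3)
    by assumption. ring.
Qed.

Lemma Rabs_IZR_lt_1 (n : Z) : Rabs (IZR n) < 1 -> n = 0%Z.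
Proof.
  rewrite <- abs_IZR. intros H. apply lt_IZR in H. lia.
Qed.

(* The determinant of the three integer vectors is less than 1 in absolute value. *)
Lemma near_collinear (c A : R) (f g : R -> R) (z1 z2 z3 : pt) : cvx c f g -> 0 < A ->
  near c f z1 -> near c f z2 -> near c f z3 ->
  A <= IZR (pq z1) <= 2 * A -> A <= IZR (pq z2) <= 2 * A -> A <= IZR (pq z3) <= 2 * A ->
  Rabs (xc z2 - xc z1) <= c / (15 * A) -> Rabs (xc z3 - xc z1) <= c / (15 * A) ->
  inc (cross z1 z2) z3 = 0%Z.
Proof.
  intros H HA N1 N2 N3 Q1 Q2 Q3 X2 X3.
  pose proof (cvx_pos c f g H) as Hc.
  apply Rabs_IZR_lt_1. rewrite inc_cross_R by (apply N1 || apply N2 || apply N3).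
  pose proof (near_yc c A f z1 (proj1 Hc) HA N1 (proj1 Q1)) as Y1.
  set (e := c / (200 * A ^ 2)) in *.
  (* Relative to [z1], the points leave the tangent at [z1] by at most [c / (80 * A ^ 2)]. The
     determinant is then at most [8 * A ^ 3 * 2 * (c / (15 * A)) * (c / (80 * A ^ 2))], which is
     [c ^ 2 / 75]. *)
  assert (G : forall z, near c f z -> A <= IZR (pq z) <= 2 * A ->
    Rabs (xc z - xc z1) <= c / (15 * A) ->
    Rabs ((yc z - yc z1) - g (xc z1) * (xc z - xc z1)) <= c / (80 * A ^ 2)).
  { intros z Nz Qz Xz. pose proof (near_yc c A f z (proj1 Hc) HA Nz (proj1 Qz)) as Yz.
    fold e in Yz. destruct H as [_ H]. destruct (H (xc z1) (xc z)) as [h1 h2].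
    assert (0 <= c / 2 * (xc z - xc z1) ^ 2) by (apply Rmult_sq_nonneg; lra).
    assert (/ (2 * c) * (xc z - xc z1) ^ 2 <= / (2 * c) * (c / (15 * A)) ^ 2).
    { apply Rmult_le_compat_l; [left; apply Rinv_0_lt_compat; lra|].
      now apply sq_le_of_Rabs. }
    replace (/ (2 * c) * (c / (15 * A)) ^ 2) with (200 / 450 * e) in H1
      by (unfold e; field; lra).
    apply Rabs_le_between in Y1, Yz. apply Rabs_le_between.
    replace (c / (80 * A ^ 2)) with (5 / 2 * e) by (unfold e; field; lra).
    split; lra. }
  pose proof (G z2 N2 Q2 X2) as R2. pose proof (G z3 N3 Q3 X3) as R3.
  set (x2 := xc z2 - xc z1) in *. set (x3 := xc z3 - xc z1) in *.
  set (y2 := yc z2 - yc z1) in *. set (y3 := yc z3 - yc z1) in *.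
  replace (x2 * y3 - x3 * y2)
    with (x2 * (y3 - g (xc z1) * x3) - x3 * (y2 - g (xc z1) * x2)) by ring.
  pose proof (Rabs_mult_le _ _ _ _ X2 R3) as P1. pose proof (Rabs_mult_le _ _ _ _ X3 R2) as P2.
  set (u := x2 * (y3 - g (xc z1) * x3)) in *. set (v := x3 * (y2 - g (xc z1) * x2)) in *.
  assert (Rabs (u - v) <= c ^ 2 / (600 * A ^ 3)).
  { replace (c ^ 2 / (600 * A ^ 3)) with (c / (15 * A) * (c / (80 * A ^ 2)) +
      c / (15 * A) * (c / (80 * A ^ 2))) by (field; lra).
    apply Rabs_le_between in P1, P2. apply Rabs_le_between. lra. }
  assert (Rabs (IZR (pq z1) * IZR (pq z2) * IZR (pq z3)) <= 2 * A * (2 * A) * (2 * A)).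
  { apply Rabs_mult_le; [apply Rabs_mult_le|]; rewrite Rabs_pos_eq; lra. }
  pose proof (Rabs_mult_le _ _ _ _ H1 H0) as P3.
  apply Rle_lt_trans with (1 := P3).
  replace (2 * A * (2 * A) * (2 * A) * (c ^ 2 / (600 * A ^ 3))) with (c * c / 75)
    by (field; lra). nra.
Qed.

(** Two different ordinates over one abscissa differ by at least [1 / (pq z * pq w)], far more than
    [near] permits; primitivity then fixes the homogeneous coordinates. *)
Lemma near_xc_inj (c A : R) (f : R -> R) (z w : pt) : 0 < c <= 1 -> 0 < A ->
  near c f z -> near c f w ->
  A <= IZR (pq z) <= 2 * A -> A <= IZR (pq w) <= 2 * A -> xc z = xc w -> z = w.
Proof.
  intros Hc HA Nz Nw Qz Qw Hx.
  pose proof (proj1 Nz) as Hqz. pose proof (proj1 Nw) as Hqw.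
  pose proof (near_yc c A f z (proj1 Hc) HA Nz (proj1 Qz)) as Yz.
  pose proof (near_yc c A f w (proj1 Hc) HA Nw (proj1 Qw)) as Yw.
  rewrite Hx in Yz.
  assert (J : pa (cross z w) = 0%Z).
  { apply Rabs_IZR_lt_1. rewrite cross_j by assumption.
    assert (h : Rabs (yc w - yc z) <= c / (100 * A ^ 2)).
    { replace (c / (100 * A ^ 2)) with (2 * (c / (200 * A ^ 2))) by (field; lra).
      apply Rabs_le_between in Yz, Yw. apply Rabs_le_between. lra. }
    assert (h1 : Rabs (IZR (pq z) * IZR (pq w)) <= 2 * A * (2 * A)).
    { apply Rabs_mult_le; rewrite Rabs_pos_eq; lra. }
    pose proof (Rabs_mult_le _ _ _ _ h1 h) as P. apply Rle_lt_trans with (1 := P).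
    replace (2 * A * (2 * A) * (c / (100 * A ^ 2))) with (c / 25) by (field; lra). lra. }
  apply prim_parallel_eq; try assumption; [apply Nz|apply Nw|].
  apply cross_zero; try assumption.
  apply (f_equal IZR) in J. rewrite cross_j in J by assumption.
  apply IZR_lt in Hqz, Hqw.
  apply Rmult_integral in J. destruct J as [J|J]; [|lra].
  apply Rmult_integral in J. lra.
Qed.

(** Up to sign and the factor [pq l], the error of [l] as a point near [fs] is the minimum of the
    curve minus the line. By [cvx_min] it is bounded through the value and the squared slope at [x];
    the constants work because [/ 500 + / 800 < / 200]. *)
Lemma tangent_near (c x : R) (f g fs gs : R -> R) (l : pt) : cvx c f g ->
  legendre f g fs gs -> prim l -> (0 < pq l)%Z ->
  Rabs (f x - (xc l * x - yc l)) <= c / (500 * IZR (pq l) ^ 2) ->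
  Rabs (g x - xc l) <= c / (20 * IZR (pq l)) ->
  near c fs l /\ Rabs (gs (xc l) - x) <= 1.
Proof.
  intros H HL Pl Hl HFx HGx. pose proof (cvx_pos c f g H) as Hc.
  assert (Hh : 1 <= IZR (pq l)) by (apply IZR_le; lia).
  set (x0 := gs (xc l)). destruct (HL (xc l)) as [Hg Hfs]. fold x0 in Hg, Hfs.
  destruct (cvx_min c _ _ x0 x (cvx_affine c f g (xc l) (yc l) H)) as [m1 [m2 m3]];
    [rewrite Hg; ring|].
  cbv beta in m1, m2, m3. set (h := IZR (pq l)) in *.
  split; [split; [assumption|split; [assumption|]]|].
  - fold h. replace (h * fs (xc l) - IZR (pb l)) with (- (h * (f x0 - (xc l * x0 - yc l))))
      by (rewrite pb_yc by assumption; fold h; rewrite Hfs; ring).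
    rewrite Rabs_Ropp, Rabs_mult, (Rabs_pos_eq h) by lra.
    assert (E1 : (g x - xc l) ^ 2 / (2 * c) <= c / (800 * h ^ 2)).
    { rewrite <- pow2_abs.
      apply Rle_trans with ((c / (20 * h)) ^ 2 / (2 * c)); [|right; field; lra].
      apply Rmult_le_compat_r; [left; apply Rinv_0_lt_compat; lra|].
      apply pow_incr. split; [apply Rabs_pos|assumption]. }
    assert (0 <= c / (800 * h ^ 2)) by (apply Rdiv_nonneg; nra).
    apply Rle_trans with (h * (c / (500 * h ^ 2) + c / (800 * h ^ 2))).
    + apply Rmult_le_compat_l; [lra|].
      apply Rabs_le_between in HFx. apply Rabs_le_between. lra.
    + replace (h * (c / (500 * h ^ 2) + c / (800 * h ^ 2))) with ((/ 500 + / 800) * (c / h))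
        by (field; lra).
      replace (c / 200 / h) with (/ 200 * (c / h)) by (field; lra).
      assert (0 <= c / h) by (apply Rdiv_nonneg; lra). lra.
  - rewrite Rabs_minus_sym. apply Rmult_le_reg_l with c; [lra|].
    apply Rle_trans with (1 := m3). apply Rle_trans with (1 := HGx).
    unfold Rdiv. apply Rmult_le_compat_l; [lra|]. rewrite <- Rinv_1.
    apply Rinv_le_contravar; lra.
Qed.

(** The line through two close points is nearly tangent: the curve almost returns to it at both
    ends, so its slope relative to the line is small there, and [cross_h] keeps the height of the
    line small enough for this to count as [near]. *)
Lemma near_dual (c A : R) (f g fs gs : R -> R) (z w : pt) : cvx c f g ->
  legendre f g fs gs -> 0 < A ->
  near c f z -> near c f w ->
  A <= IZR (pq z) <= 2 * A -> A <= IZR (pq w) <= 2 * A ->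
  Rabs (xc w - xc z) <= c / (15 * A) -> z <> w ->
  exists l n, near c fs l /\ inc l z = 0%Z /\ (n <> 0)%Z /\ cross z w = dil n l /\
    Rabs (gs (xc l) - xc z) <= 1.
Proof.
  intros H HL HA Nz Nw Qz Qw Hx Hne.
  pose proof (cvx_pos c f g H) as Hc.
  pose proof (proj1 Nz) as Hqz. pose proof (proj1 Nw) as Hqw.
  assert (Hxne : xc z <> xc w).
  { intros E. apply Hne. now apply (near_xc_inj c A f). }
  assert (Hh : pq (cross z w) <> 0%Z).
  { intros E. apply (f_equal IZR) in E. rewrite cross_h in E by assumption.
    apply Rmult_integral in E. destruct E as [E|E]; [|lra].
    apply Rmult_integral in E. lra. }
  destruct (prim_part (cross z w)) as [d [l0 [Hd [Hl0 El0]]]].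
  { intros E. apply Hh. now rewrite E. }
  assert (Hl00 : pq l0 <> 0%Z).
  { intros E. apply Hh. rewrite El0. simpl. rewrite E. ring. }
  (* The primitive part of [cross z w], with its sign changed if necessary so that [pq l] is
     positive. *)
  assert (exists l n, (0 < pq l)%Z /\ prim l /\ (n <> 0)%Z /\ cross z w = dil n l) as
    [l [n [Hl [Pl [Hn El]]]]].
  { destruct (Z_lt_le_dec 0 (pq l0)) as [h|h].
    - exists l0, d. repeat split; auto; lia.
    - exists (dil (-1) l0), (- d)%Z. split; [cbn [pq dil]; lia|]. split; [|split; [lia|]].
      + destruct Hl0 as [s1 [s2 [s3 Hs]]]. exists (- s1)%Z, (- s2)%Z, (- s3)%Z.
        cbn [pq pa pb dil]. lia.
      + rewrite El0. unfold dil; cbn [pq pa pb]. f_equal; ring. }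
  assert (Iz : inc l z = 0%Z).
  { pose proof (inc_cross_l z w) as I. rewrite El, inc_dil in I. apply Z.mul_eq_0 in I. tauto. }
  assert (Iw : inc l w = 0%Z).
  { pose proof (inc_cross_r z w) as I. rewrite El, inc_dil in I. apply Z.mul_eq_0 in I. tauto. }
  set (F := fun x => f x - (xc l * x - yc l)). set (G := fun x => g x - xc l).
  assert (HF : cvx c F G) by (now apply cvx_affine).
  assert (Fz : Rabs (F (xc z)) <= c / (200 * A ^ 2)).
  { unfold F. rewrite <- inc_yc by assumption. now apply near_yc. }
  assert (Fw : Rabs (F (xc w)) <= c / (200 * A ^ 2)).
  { unfold F. rewrite <- inc_yc by assumption. now apply near_yc. }
  set (h := IZR (pq l)). assert (Hhp : 1 <= h) by (apply IZR_le; lia).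
  set (d' := Rabs (xc w - xc z)) in *.
  assert (Hdp : 0 < d') by (apply Rabs_pos_lt; lra).
  assert (Hd1 : h <= 4 * A ^ 2 * d').
  { assert (E : IZR n * h = IZR (pq z) * IZR (pq w) * (xc w - xc z)).
    { rewrite <- cross_h, El by assumption. simpl. now rewrite mult_IZR. }
    apply (f_equal Rabs) in E. rewrite !Rabs_mult in E.
    rewrite (Rabs_pos_eq h), (Rabs_pos_eq (IZR (pq z))), (Rabs_pos_eq (IZR (pq w))) in E by lra.
    fold d' in E.
    assert (1 <= Rabs (IZR n)) by (rewrite <- abs_IZR; apply IZR_le; lia).
    assert (IZR (pq z) * IZR (pq w) <= 2 * A * (2 * A)) by (apply Rmult_le_compat; lra).
    assert (h <= Rabs (IZR n) * h) by nra.
    assert (IZR (pq z) * IZR (pq w) * d' <= 2 * A * (2 * A) * d') by (apply Rmult_le_compat_r; lra).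
    lra. }
  assert (HhA : h <= 4 * A * c / 15).
  { apply Rle_trans with (1 := Hd1).
    apply Rle_trans with (4 * A ^ 2 * (c / (15 * A))); [|right; field; lra].
    apply Rmult_le_compat_l; [nra|assumption]. }
  assert (GZ : Rabs (G (xc z)) <= c / (20 * h)).
  (* Slope times distance is at most the change of [F] between the two points plus the curvature
     term; division by [d'] uses [Hd1] for the first and the upper bound on [d'] for the second. *)
  { assert (GZ1 : Rabs (G (xc z)) * d' <= c / (100 * A ^ 2) + / (2 * c) * d' ^ 2).
    { unfold d'. rewrite <- Rabs_mult, pow2_abs.
      destruct HF as [_ HF]. destruct (HF (xc z) (xc w)) as [h1 h2].
      assert (0 <= c / 2 * (xc w - xc z) ^ 2) by (apply Rmult_sq_nonneg; lra).
      assert (0 <= / (2 * c) * (xc w - xc z) ^ 2)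
        by (apply Rmult_sq_nonneg; left; apply Rinv_0_lt_compat; lra).
      replace (c / (100 * A ^ 2)) with (2 * (c / (200 * A ^ 2))) by (field; lra).
      apply Rabs_le_between in Fz, Fw. apply Rabs_le_between. lra. }
    apply Rmult_le_reg_r with d'; [assumption|]. apply Rle_trans with (1 := GZ1).
    assert (E1 : c / (100 * A ^ 2) <= c / (25 * h) * d').
    { apply Rmult_le_reg_r with (100 * A ^ 2 * h); [nra|].
      replace (c / (100 * A ^ 2) * (100 * A ^ 2 * h)) with (c * h) by (field; lra).
      replace (c / (25 * h) * d' * (100 * A ^ 2 * h)) with (c * (4 * A ^ 2 * d')) by (field; lra).
      apply Rmult_le_compat_l; lra. }
    assert (E2 : / (2 * c) * d' ^ 2 <= c / (100 * h) * d').
    { replace (d' ^ 2) with (d' * d') by ring. rewrite <- Rmult_assoc.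
      apply Rmult_le_compat_r; [lra|].
      apply Rle_trans with (/ (2 * c) * (c / (15 * A))).
      { apply Rmult_le_compat_l; [left; apply Rinv_0_lt_compat; lra|assumption]. }
      apply Rmult_le_reg_r with (30 * A * h); [nra|].
      replace (/ (2 * c) * (c / (15 * A)) * (30 * A * h)) with h by (field; lra).
      replace (c / (100 * h) * (30 * A * h)) with (3 * A * c / 10) by (field; lra).
      assert (0 <= A * c) by nra. lra. }
    replace (c / (20 * h)) with (c / (25 * h) + c / (100 * h)) by (field; lra). lra. }
  destruct (tangent_near c (xc z) f g fs gs l H HL Pl Hl) as [Nl Xl]; [|exact GZ|].
  - apply Rle_trans with (1 := Fz). fold h. apply Rmult_le_compat_l; [lra|].
    apply Rinv_le_contravar; [nra|].
    assert (0 <= 4 * A * c / 15 <= 4 * A / 15) by nra.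
    assert (h ^ 2 <= (4 * A / 15) ^ 2) by (apply pow_incr; lra). nra.
  - exists l, n. auto.
Qed.

(** By [cross_on_line] and [cross_h], the product of the two denominators and the distance of the
    abscissas is a nonzero multiple of the height of [l]. *)
Lemma near_spaced (c A : R) (f : R -> R) (l z w : pt) : 0 < c <= 1 -> 0 < A ->
  prim l -> (0 < pq l)%Z -> near c f z -> near c f w ->
  A <= IZR (pq z) <= 2 * A -> A <= IZR (pq w) <= 2 * A ->
  inc l z = 0%Z -> inc l w = 0%Z -> z <> w ->
  IZR (pq l) / (4 * A ^ 2) <= Rabs (xc z - xc w).
Proof.
  intros Hc HA Pl Hl Nz Nw Qz Qw Iz Iw Hne.
  pose proof (proj1 Nz) as Hqz. pose proof (proj1 Nw) as Hqw.
  assert (Hx : xc z <> xc w).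
  { intros E. apply Hne. now apply (near_xc_inj c A f). }
  destruct (cross_on_line l z w Pl Iz Iw) as [n En].
  apply (f_equal (fun v => IZR (pq v))) in En.
  rewrite cross_h in En by assumption. cbn [pq dil] in En. rewrite mult_IZR in En.
  assert (Hh : 1 <= IZR (pq l)) by (apply IZR_le; lia).
  set (h := IZR (pq l)) in *.
  assert (Hn : n <> 0%Z).
  { intros ->. rewrite Rmult_0_l in En. apply Rmult_integral in En.
    destruct En as [E|E]; [|lra]. apply Rmult_integral in E. lra. }
  apply (f_equal Rabs) in En. rewrite !Rabs_mult in En.
  rewrite (Rabs_pos_eq h), (Rabs_pos_eq (IZR (pq z))), (Rabs_pos_eq (IZR (pq w))) in En by lra.
  rewrite Rabs_minus_sym in En. set (d := Rabs (xc z - xc w)) in *.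
  assert (0 <= d) by apply Rabs_pos.
  assert (1 <= Rabs (IZR n)) by (rewrite <- abs_IZR; apply IZR_le; lia).
  assert (IZR (pq z) * IZR (pq w) <= 2 * A * (2 * A)) by (apply Rmult_le_compat; lra).
  assert (IZR (pq z) * IZR (pq w) * d <= 2 * A * (2 * A) * d) by (apply Rmult_le_compat_r; lra).
  apply Rmult_le_reg_r with (4 * A ^ 2); [nra|].
  replace (h / (4 * A ^ 2) * (4 * A ^ 2)) with h by (field; lra). nra.
Qed.

(** On each side of the point of tangency [cvx_sublevel] confines the points to a window of length
    [1 / (7 * A)], and [near_spaced] separates them by [h / (4 * A ^ 2)]. The two additive constants
    are absorbed since [h <= A]. *)
Lemma near_on_line (c A : R) (f g : R -> R) (l : pt) : cvx c f g ->
  prim l -> (0 < pq l)%Z -> IZR (pq l) <= A ->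
  atmost (fun z => near c f z /\ A <= IZR (pq z) <= 2 * A /\ inc l z = 0%Z)
    (4 * A / IZR (pq l)).
Proof.
  intros H Pl Hl HhA. pose proof (cvx_pos c f g H) as Hc.
  assert (Hh : 1 <= IZR (pq l)) by (apply IZR_le; lia).
  assert (HA : 0 < A) by lra.
  destruct (cvx_grad_surj c f g (xc l) H) as [x0 Hx0].
  set (h := IZR (pq l)) in *.
  set (F := fun x => f x - (xc l * x - yc l)). set (G := fun x => g x - xc l).
  assert (HF : cvx c F G) by (now apply cvx_affine).
  assert (HG0 : G x0 = 0) by (unfold G; rewrite Hx0; ring).
  set (B := 1 / (7 * A) / (h / (4 * A ^ 2)) + 1).
  assert (Hone : forall s, s = 1 \/ s = -1 -> atmost (fun z => near c f z /\
    A <= IZR (pq z) <= 2 * A /\ inc l z = 0%Z /\ 0 <= s * (xc z - x0)) B).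
  { intros s Hs. apply atmost_spaced with (phi := xc).
    - apply Rdiv_lt_0_compat; nra.
    - apply Rdiv_nonneg; lra.
    - intros z w [Nz [Qz [Iz Sz]]] [Nw [Qw [Iw Sw]]] Hne. split.
      + now apply (near_spaced c A f).
      + assert (Fz : Rabs (F (xc z)) <= c / (200 * A ^ 2)).
        { unfold F. rewrite <- inc_yc by (assumption || apply Nz). now apply near_yc. }
        assert (Fw : Rabs (F (xc w)) <= c / (200 * A ^ 2)).
        { unfold F. rewrite <- inc_yc by (assumption || apply Nw). now apply near_yc. }
        assert (Hzw : 0 <= (xc w - x0) * (xc z - x0)) by (destruct Hs; subst s; nra).
        pose proof (cvx_sublevel c F G x0 _ _ _ HF HG0 Hzw Fw Fz) as K.
        apply Rabs_le_of_sq; [apply Rdiv_nonneg; lra|].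
        apply Rmult_le_reg_l with c; [lra|]. apply Rle_trans with (1 := K).
        replace (4 * (c / (200 * A ^ 2))) with (c * / A ^ 2 * / 50) by (field; lra).
        replace (c * (1 / (7 * A)) ^ 2) with (c * / A ^ 2 * / 49) by (field; lra).
        apply Rmult_le_compat_l; [|lra].
        apply Rdiv_nonneg; nra. }
  apply atmost_sub with (n' := B + B) (P' := fun z => near c f z /\ A <= IZR (pq z) <= 2 * A /\
    inc l z = 0%Z); [auto| |].
  - unfold B. replace (1 / (7 * A) / (h / (4 * A ^ 2))) with (4 / 7 * (A / h)) by (field; lra).
    assert (1 <= A / h).
    { apply Rmult_le_reg_r with h; [lra|]. unfold Rdiv. rewrite Rmult_assoc, Rinv_l by lra. lra. }
    replace (4 * A / h) with (4 * (A / h)) by (field; lra). lra.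
  - apply atmost_union with (2 := Hone 1 (or_introl eq_refl)) (3 := Hone (-1) (or_intror eq_refl)).
    intros z [N [Q I]]. destruct (Rle_dec 0 (xc z - x0)); [left|right]; repeat split; auto;
    try apply N; try apply Q; lra.
Qed.

(** * Huxley's bound by induction on the dyadic size of the denominator *)

Lemma pow2_ge_1 (n : nat) : 1 <= 2 ^ n.
Proof. apply pow_R1_Rle. lra. Qed.

Lemma atmost_geom {A : Type} (P : nat -> A -> Prop) (B r : R) (k : nat) : 1 < r -> 0 <= B ->
  (forall m, (m < k)%nat -> atmost (P m) (B * r ^ m)) ->
  atmost (fun z => exists m, (m < k)%nat /\ P m z) (B * ((r ^ k - 1) / (r - 1))).
Proof.
  intros Hr HB. induction k as [|k IH]; intros H.
  - intros [|x l] Hl Hx.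
    + simpl. unfold Rdiv. rewrite Rminus_diag. lra.
    + destruct (Hx x) as [m [Hm _]]; [now left|]. lia.
  - replace (B * ((r ^ S k - 1) / (r - 1))) with (B * ((r ^ k - 1) / (r - 1)) + B * r ^ k)
      by (simpl; field; lra).
    apply atmost_union with (2 := IH (fun m Hm => H m (Nat.lt_lt_succ_r _ _ Hm)))
      (3 := H k (Nat.lt_succ_diag_r k)).
    intros z [m [Hm Hz]]. destruct (Nat.eq_dec m k) as [->|]; [now right|left].
    exists m. split; [lia|assumption].
Qed.

Definition near_level (c : R) (f : R -> R) (n : nat) (z : pt) : Prop :=
  near c f z /\ 2 ^ n <= IZR (pq z) < 2 ^ S n.

Lemma atmost_windows (P : pt -> Prop) (N y w : R) : 0 <= N -> 0 <= w ->
  (forall y, atmost (fun z => P z /\ y <= xc z <= y + 1) N) ->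
  atmost (fun z => P z /\ y <= xc z <= y + w) ((w + 1) * N).
Proof.
  intros HN Hw H. apply atmost_fiberZ with (phi := fun z => Int_part (xc z - y)); auto.
  - intros z [_ Hz]. split.
    + apply IZR_le, Int_part_le. lra.
    + pose proof (Int_part_bounds (xc z - y)). lra.
  - intros k. apply atmost_sub with (3 := H (y + IZR k)); [|lra].
    intros z [[HP Hz] <-]. split; [assumption|].
    pose proof (Int_part_bounds (xc z - y)). lra.
Qed.

Lemma log2_bounds (q : Z) : (0 < q)%Z ->
  2 ^ Z.to_nat (Z.log2 q) <= IZR q < 2 ^ S (Z.to_nat (Z.log2 q)).
Proof.
  intros Hq. pose proof (Z.log2_spec q Hq) as [h1 h2].
  pose proof (Z.log2_nonneg q) as h0.
  rewrite !pow_IZR.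
  rewrite Nat2Z.inj_succ, Z2Nat.id by assumption.
  split; [now apply IZR_le|now apply IZR_lt].
Qed.

(** The induction step. Arcs of length [c / (15 * 2 ^ n)] with at most [1 + 4 * 2 ^ k] points give
    the first term. A fuller arc has all its points on one line, and their spacing forces the height
    of that line below [2 ^ (n - k)]. Lines of level [m] are bounded by the hypothesis for [fs] and
    carry at most [4 * 2 ^ n / 2 ^ m] points each; summing over [m < n - k] gives the second term,
    which a large [k] makes small. *)
Lemma near_arcs (c r : R) (f g fs gs : R -> R) (y M : R) (n k : nat) :
  cvx c f g -> cvx c fs gs ->
  legendre f g fs gs -> 1 < r -> 0 <= M ->
  (forall m y, (m < n)%nat ->
     atmost (fun z => near_level c fs m z /\ y <= xc z <= y + 1) (M * (2 * r) ^ m)) ->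
  atmost (fun z => near_level c f n z /\ y <= xc z <= y + 1)
    ((15 * 2 ^ n / c + 1) * (1 + 4 * 2 ^ k)
     + 4 * (3 / c + 1) * M * 2 ^ n * ((r ^ (n - k) - 1) / (r - 1))).
Proof.
  intros H Hs HL Hr HM IH. pose proof (cvx_pos c f g H) as Hc.
  set (A := 2 ^ n). assert (HA : 1 <= A) by apply pow2_ge_1.
  assert (Hk : 1 <= 2 ^ k) by apply pow2_ge_1.
  set (P := fun z => near_level c f n z /\ y <= xc z <= y + 1).
  assert (HP : forall z, P z -> near c f z /\ A <= IZR (pq z) <= 2 * A).
  { intros z [[Nz Qz] _]. split; [assumption|]. simpl in Qz. fold A in Qz. lra. }
  set (arc := fun z => Int_part ((xc z - y) * (15 * A / c))).
  assert (Harc : forall z w, arc z = arc w -> Rabs (xc w - xc z) <= c / (15 * A)).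
  { intros z w E. unfold arc in E.
    pose proof (Int_part_bounds ((xc z - y) * (15 * A / c))) as b1.
    pose proof (Int_part_bounds ((xc w - y) * (15 * A / c))) as b2.
    rewrite E in b1. set (t := 15 * A / c) in *.
    assert (Ht : 0 < t) by (apply Rdiv_lt_0_compat; lra).
    replace (c / (15 * A)) with (/ t) by (unfold t; field; lra).
    apply Rmult_le_reg_r with t; [assumption|]. rewrite Rinv_l by lra.
    rewrite <- (Rabs_pos_eq t) at 1 by lra. rewrite <- Rabs_mult.
    apply Rabs_le_between. lra. }
  set (K1 := 1 + 4 * 2 ^ k).
  (* The tangency point of such a line is within [1] of a point of [[y, y + 1]], hence within
     [3 / 2] of the midpoint. *)
  set (line := fun l => near c fs l /\ IZR (pq l) * 2 ^ k < A /\
    Rabs (gs (xc l) - (y + 1 / 2)) <= 3 / 2).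
  apply atmost_union with (P1 := fun z => P z /\ atmost (fun w => P w /\ arc w = arc z) K1)
    (P2 := fun z => P z /\ exists l, line l /\ inc l z = 0%Z).
  - intros z Hz. fold (P z) in Hz.
    destruct (excluded_middle_informative (atmost (fun w => P w /\ arc w = arc z) K1))
      as [h|h]; [now left|right]. split; [assumption|].
    assert (exists l, NoDup l /\ (forall w, In w l -> P w /\ arc w = arc z) /\
      K1 < INR (length l)) as [L [HL1 [HL2 HL3]]].
    { apply NNPP. intros h'. apply h. intros l Hl Hx. apply Rnot_lt_le. intros h2.
      apply h'. exists l. auto. }
    destruct L as [|v1 [|v2 L]].
    { simpl in HL3. unfold K1 in HL3. lra. }
    { simpl in HL3. unfold K1 in HL3. lra. }
    assert (Hne : v1 <> v2).
    { inversion HL1 as [|? ? h1 _]; subst. intros ->. apply h1. now left. }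
    destruct (HL2 v1) as [P1 A1]; [simpl; auto|].
    destruct (HL2 v2) as [P2 A2]; [simpl; auto|].
    destruct (HP v1 P1) as [N1 Q1]. destruct (HP v2 P2) as [N2 Q2].
    destruct (near_dual c A f g fs gs v1 v2) as [l [m [Nl [Il [Hm [El Hw]]]]]]; auto; try lra.
    { apply Harc. congruence. }
    assert (Hl : (0 < pq l)%Z) by apply Nl. assert (Pl : prim l) by apply Nl.
    assert (Hinc : forall w, P w -> arc w = arc z -> inc l w = 0%Z).
    { intros w Pw Aw. destruct (HP w Pw) as [Nw Qw].
      assert (E : inc (cross v1 v2) w = 0%Z).
      { apply (near_collinear c A f g); auto; try lra; apply Harc; congruence. }
      rewrite El, inc_dil in E. apply Z.mul_eq_0 in E. tauto. }
    exists l. split; [|now apply Hinc].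
    split; [assumption|]. split.
    + assert (Hh : 1 <= IZR (pq l)) by (apply IZR_le; lia).
      set (h0 := IZR (pq l)) in *.
      assert (HK : INR (length (v1 :: v2 :: L)) <= c / (15 * A) / (h0 / (4 * A ^ 2)) + 1).
      { apply (atmost_spaced (fun w => P w /\ arc w = arc z) xc).
        - apply Rdiv_lt_0_compat; nra.
        - apply Rdiv_nonneg; lra.
        - intros w w' [Pw Aw] [Pw' Aw'] Hd. destruct (HP w Pw) as [Nw Qw].
          destruct (HP w' Pw') as [Nw' Qw']. split.
          + apply (near_spaced c A f); auto; lra.
          + rewrite Rabs_minus_sym. apply Harc. congruence.
        - assumption.
        - assumption. }
      replace (c / (15 * A) / (h0 / (4 * A ^ 2))) with (4 / 15 * c * A / h0) in HK by (field; lra).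
      assert (HK2 : 4 * 2 ^ k < 4 / 15 * c * A / h0) by (unfold K1 in HL3; lra).
      apply (Rmult_lt_compat_r h0) in HK2; [|lra].
      replace (4 / 15 * c * A / h0 * h0) with (4 / 15 * c * A) in HK2 by (field; lra).
      assert (c * A <= A) by nra. lra.
    + destruct P1 as [_ P1]. apply Rabs_le_between in Hw. apply Rabs_le_between. lra.
  - apply atmost_sub with (P' := fun z => P z /\ atmost (fun w => P w /\ arc w = arc z) K1)
      (n' := (15 * A / c + 1) * K1); [auto|lra|].
    assert (0 < 15 * A / c) by (apply Rdiv_lt_0_compat; lra).
    apply atmost_fiberZ with (phi := arc); [lra|unfold K1; lra| |].
    + intros z [[_ Hz] _]. unfold arc. split.
      * apply IZR_le, Int_part_le. apply Rmult_le_pos; lra.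
      * pose proof (Int_part_bounds ((xc z - y) * (15 * A / c))).
        assert ((xc z - y) * (15 * A / c) <= 1 * (15 * A / c)) by (apply Rmult_le_compat_r; lra).
        lra.
    + intros i l Hl Hx. destruct l as [|z0 l']; [simpl; unfold K1; lra|].
      destruct (Hx z0) as [[_ Hz] Hi]; [now left|].
      apply Hz; [assumption|]. intros w Hw. destruct (Hx w Hw) as [[Pw _] Ew].
      split; [assumption|congruence].
  - assert (Hw3 : 0 <= 3 / c) by (apply Rdiv_nonneg; lra).
    set (Pm := fun m z => P z /\ exists l, (line l /\ near_level c fs m l) /\ inc l z = 0%Z).
    apply atmost_sub with (P' := fun z => exists m, (m < n - k)%nat /\ Pm m z)
      (n' := 4 * (3 / c + 1) * M * A * ((r ^ (n - k) - 1) / (r - 1))); [|lra|].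
    + intros z [Pz [l [Hl Iz]]].
      assert (exists m, 2 ^ m <= IZR (pq l) < 2 ^ S m) as [m Hm].
      { exists (Z.to_nat (Z.log2 (pq l))). apply log2_bounds, Hl. }
      exists m. split.
      * destruct Hl as [_ [Hl _]].
        assert (2 ^ (m + k) < 2 ^ n).
        { rewrite pow_add. apply Rle_lt_trans with (2 := Hl). apply Rmult_le_compat_r; lra. }
        assert (m + k < n)%nat; [|lia].
        apply Nat.nle_gt. intros h. apply (Rle_pow 2) in h; lra.
      * split; [assumption|]. exists l. repeat split; try apply Hl; try apply Hm; assumption.
    + apply atmost_geom; [assumption| |].
      { apply Rmult_le_pos; [|lra]. apply Rmult_le_pos; [|lra]. lra. }
      intros m Hm. set (h := 2 ^ m). assert (Hh : 1 <= h) by apply pow2_ge_1.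
      replace (4 * (3 / c + 1) * M * A * r ^ m)
        with ((3 / c + 1) * (M * (2 * r) ^ m) * (4 * A / h))
        by (rewrite Rpow_mult_distr; fold h; field; lra).
      assert (HMr : 0 <= M * (2 * r) ^ m) by (apply Rmult_le_pos; [lra|apply pow_le; lra]).
      apply atmost_rel with (K := fun l => line l /\ near_level c fs m l)
        (rel := fun l z => inc l z = 0%Z).
      * intros z [_ [l [Hl Iz]]]. exists l. auto.
      (* Tangency points fill an interval of length [3], and [g] has Lipschitz constant [/ c], so
         the slopes fill a window of length [3 / c]. *)
      * apply atmost_sub with (P' := fun l => near_level c fs m l /\
          g (y - 1) <= xc l <= g (y - 1) + 3 / c) (n' := (3 / c + 1) * (M * (2 * r) ^ m));
          [|lra|].
        -- intros l [[_ [_ Hx]] Nl]. split; [assumption|].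
           destruct (HL (xc l)) as [E _]. rewrite <- E. apply Rabs_le_between in Hx.
           split; [apply (cvx_grad_mono c f g); [assumption|lra]|].
           pose proof (cvx_grad_abs c f g (y - 1) (gs (xc l)) H) as [_ h1].
           assert (Rabs (gs (xc l) - (y - 1)) <= 3) by (apply Rabs_le_between; lra).
           assert (/ c * Rabs (gs (xc l) - (y - 1)) <= / c * 3).
           { apply Rmult_le_compat_l; [left; apply Rinv_0_lt_compat; lra|assumption]. }
           pose proof (Rle_abs (g (gs (xc l)) - g (y - 1))). unfold Rdiv. lra.
        -- apply atmost_windows; auto. intros y'. apply IH. lia.
      * apply Rdiv_nonneg; lra.
      * intros l [[Nl [Hl _]] [_ Ql]].
        assert (Hl1 : 1 <= IZR (pq l)) by (destruct Nl as [Nl _]; apply IZR_le; lia).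
        apply atmost_sub with (P' := fun z => near c f z /\ A <= IZR (pq z) <= 2 * A /\
          inc l z = 0%Z) (n' := 4 * A / IZR (pq l)).
        -- intros z [[Pz _] Iz]. destruct (HP z Pz). auto.
        -- apply Rmult_le_compat_l; [lra|]. apply Rinv_le_contravar; [lra|apply Ql].
        -- apply (near_on_line c A f g); auto; [apply Nl|apply Nl|].
           apply Rle_trans with (IZR (pq l) * 2 ^ k); [|lra]. nra.
Qed.

Lemma pow_large (r b : R) : 1 < r -> exists k : nat, b <= r ^ k.
Proof.
  intros Hr. destruct (Pow_x_infinity r ltac:(rewrite Rabs_pos_eq; lra) b) as [N HN].
  exists N. specialize (HN N (le_n N)). rewrite Rabs_pos_eq in HN; [lra|apply pow_le; lra].
Qed.

(* Huxley's bound. *)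
Lemma near_count (c r : R) : 0 < c -> 1 < r -> exists M, 0 <= M /\
  forall n f g y, cvx c f g ->
    atmost (fun z => near_level c f n z /\ y <= xc z <= y + 1) (M * (2 * r) ^ n).
Proof.
  intros Hc Hr. set (D := 4 * (3 / c + 1)).
  assert (HD : 0 < D).
  { assert (0 < 3 / c) by (apply Rdiv_lt_0_compat; lra).
    unfold D; lra. }
  (* This [k] makes the contribution of the full arcs at most half of the claimed bound. It does not
     depend on [M], so [M] can afterwards be taken as [2 * C1], twice the constant of the other
     arcs. *)
  destruct (pow_large r (2 * D / (r - 1)) Hr) as [k Hk].
  set (C1 := (15 / c + 1) * (1 + 4 * 2 ^ k)).
  assert (HC1 : 0 <= C1).
  { apply Rmult_le_pos; [|pose proof (pow2_ge_1 k); lra].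
    assert (0 < 15 / c) by (apply Rdiv_lt_0_compat; lra). lra. }
  exists (2 * C1). split; [lra|].
  (* The function stays quantified: the hypothesis is applied to [fs], which is [cvx] with the same
     [c]. *)
  induction n as [n IH] using (well_founded_induction Wf_nat.lt_wf).
  intros f g y H. destruct (cvx_legendre c f g H) as [fs [gs [Hs HL]]].
  apply atmost_sub with (3 := near_arcs c r f g fs gs y (2 * C1) n k H Hs HL Hr
    ltac:(lra) (fun m y Hm => IH m Hm fs gs y Hs)); [auto|].
  fold D. set (A := 2 ^ n). assert (HA : 1 <= A) by apply pow2_ge_1.
  rewrite Rpow_mult_distr. fold A.
  assert (Hrn : 1 <= r ^ n) by (apply pow_R1_Rle; lra).
  assert (E1 : (15 * A / c + 1) * (1 + 4 * 2 ^ k) <= C1 * A).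
  { unfold C1. replace ((15 / c + 1) * (1 + 4 * 2 ^ k) * A)
      with ((15 * A / c + A) * (1 + 4 * 2 ^ k)) by (field; lra).
    apply Rmult_le_compat_r; [pose proof (pow2_ge_1 k); lra|]. lra. }
  assert (E2 : D * ((r ^ (n - k) - 1) / (r - 1)) <= r ^ n / 2).
  { apply Rmult_le_reg_r with (r - 1); [lra|].
    replace (D * ((r ^ (n - k) - 1) / (r - 1)) * (r - 1)) with (D * (r ^ (n - k) - 1))
      by (field; lra).
    destruct (Nat.le_gt_cases k n) as [h|h].
    - replace n with (k + (n - k))%nat at 2 by lia. rewrite pow_add.
      assert (1 <= r ^ (n - k)) by (apply pow_R1_Rle; lra).
      assert (2 * D <= r ^ k * (r - 1)).
      { apply (Rmult_le_compat_r (r - 1)) in Hk; [|lra].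
        replace (2 * D / (r - 1) * (r - 1)) with (2 * D) in Hk by (field; lra). assumption. }
      set (u := r ^ (n - k)) in *.
      assert (2 * D * u <= r ^ k * (r - 1) * u) by (apply Rmult_le_compat_r; lra). nra.
    - replace (n - k)%nat with 0%nat by lia. simpl. nra. }
  assert (E3 : D * (2 * C1) * A * ((r ^ (n - k) - 1) / (r - 1)) <= 2 * C1 * A * (r ^ n / 2)).
  { replace (D * (2 * C1) * A * ((r ^ (n - k) - 1) / (r - 1)))
      with (2 * C1 * A * (D * ((r ^ (n - k) - 1) / (r - 1)))) by ring.
    apply Rmult_le_compat_l; [|assumption]. apply Rmult_le_pos; lra. }
  assert (C1 * A <= C1 * A * r ^ n).
  { rewrite <- (Rmult_1_r (C1 * A)) at 1. apply Rmult_le_compat_l; [apply Rmult_le_pos; lra|assumption]. }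
  lra.
Qed.

Lemma lsum_app {A : Type} (F : A -> R) (l1 l2 : list A) :
  lsum F (l1 ++ l2) = lsum F l1 + lsum F l2.
Proof. induction l1 as [|x l IH]; simpl; lra. Qed.

Lemma lsum_geom (r : R) (n : nat) : 1 < r ->
  lsum (fun m => r ^ m) (seq 0 n) = (r ^ n - 1) / (r - 1).
Proof.
  intros Hr. induction n as [|n IH]; [simpl; field; lra|].
  rewrite seq_S, lsum_app, IH. simpl. field; lra.
Qed.

(** Denominators about [2 ^ m] contribute a constant times [r ^ m]; for [r = Rpower 2 eps] the
    geometric sum is of order [Rpower H eps]. *)
Lemma near_sum (c eps w : R) : 0 < c -> 0 < eps -> 0 <= w ->
  exists C, 0 <= C /\ forall f g y H l, cvx c f g -> 1 <= H -> NoDup l ->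
    (forall z, In z l -> near c f z /\ y <= xc z <= y + w /\ IZR (pq z) <= H) ->
    lsum (fun z => / IZR (pq z)) l <= C * Rpower H eps.
Proof.
  intros Hc He Hw. set (r := Rpower 2 eps).
  assert (Hr : 1 < r).
  { unfold r. rewrite <- (Rpower_O 2) by lra. apply Rpower_lt; lra. }
  destruct (near_count c r Hc Hr) as [M [HM Hux]].
  assert (HC : 0 <= (w + 1) * M * (r / (r - 1))).
  { apply Rmult_le_pos; [apply Rmult_le_pos; lra|].
    apply Rdiv_nonneg; lra. }
  exists ((w + 1) * M * (r / (r - 1))). split; [assumption|].
  intros f g y H l Hcv HH Hl Hx.
  set (lev := fun z => Z.to_nat (Z.log2 (pq z))).
  set (K := Z.to_nat (Z.log2 (Int_part H))).
  assert (HiH : (1 <= Int_part H)%Z) by (apply Int_part_le; lra).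
  rewrite (lsum_fibers lev _ l (seq 0 (S K))).
  - apply Rle_trans with (lsum (fun m => (w + 1) * M * r ^ m) (seq 0 (S K))).
    + apply lsum_le. intros m _.
      assert (Hm : 0 < 2 ^ m) by (apply pow_lt; lra).
      apply Rle_trans with (lsum (fun _ => / 2 ^ m) (sel (fun z => lev z = m) l)).
      * apply lsum_le. intros z Hz. apply sel_in in Hz. destruct Hz as [Hz <-].
        destruct (Hx z Hz) as [[Hq _] _]. apply Rinv_le_contravar; [assumption|].
        now apply log2_bounds.
      * rewrite lsum_const. apply Rmult_le_reg_l with (2 ^ m); [assumption|].
        rewrite <- Rmult_assoc, Rinv_r, Rmult_1_l by lra.
        replace (2 ^ m * ((w + 1) * M * r ^ m)) with ((w + 1) * (M * (2 * r) ^ m))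
          by (rewrite Rpow_mult_distr; ring).
        apply (atmost_windows (near_level c f m) (M * (2 * r) ^ m) y w); try assumption.
        -- apply Rmult_le_pos; [assumption|apply pow_le; lra].
        -- intros y'. now apply (Hux m f g).
        -- now apply sel_nodup.
        -- intros z Hz. apply sel_in in Hz. destruct Hz as [Hz <-].
           destruct (Hx z Hz) as [Nz [Xz _]]. split; [split; [assumption|]|assumption].
           apply log2_bounds, Nz.
    + rewrite (lsum_scal ((w + 1) * M) (fun m => r ^ m)), lsum_geom by assumption.
      assert (E : r ^ K <= Rpower H eps).
      { rewrite <- Rpower_pow by lra. unfold r. rewrite Rpower_mult, Rmult_comm, <- Rpower_mult.
        apply Rle_Rpower_l; [lra|]. rewrite Rpower_pow by lra.
        split; [apply pow_lt; lra|].
        destruct (log2_bounds (Int_part H)) as [h _]; [lia|]. fold K in h.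
        pose proof (Int_part_bounds H). lra. }
      apply Rle_trans with ((w + 1) * M * (r / (r - 1)) * r ^ K);
        [|now apply Rmult_le_compat_l].
      rewrite (Rmult_assoc ((w + 1) * M)). apply Rmult_le_compat_l; [apply Rmult_le_pos; lra|].
      replace (r / (r - 1) * r ^ K) with (r ^ S K / (r - 1)) by (simpl; field; lra).
      apply Rmult_le_compat_r; [left; apply Rinv_0_lt_compat; lra|lra].
  - apply seq_NoDup.
  - intros z Hz. apply in_seq. destruct (Hx z Hz) as [[Hq _] [_ HqH]].
    unfold lev, K. apply Int_part_le in HqH.
    pose proof (Z.log2_le_mono _ _ HqH). lia.
Qed.

(** * Transference *)

Record vec : Set := mkv { v1 : R; v2 : R; v3 : R }.
Definition vdot (x y : vec) : R := v1 x * v1 y + v2 x * v2 y + v3 x * v3 y.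
Definition vcross (x y : vec) : vec :=
  mkv (v2 x * v3 y - v3 x * v2 y) (v3 x * v1 y - v1 x * v3 y) (v1 x * v2 y - v2 x * v1 y).
Definition vsub (x y : vec) : vec := mkv (v1 x - v1 y) (v2 x - v2 y) (v3 x - v3 y).
Definition vscal (k : R) (x : vec) : vec := mkv (k * v1 x) (k * v2 x) (k * v3 x).

Ltac vring := unfold vdot, vcross, vsub, vscal; cbn [v1 v2 v3]; ring.

Lemma vdot_sub_l (x y z : vec) : vdot (vsub x y) z = vdot x z - vdot y z.
Proof. vring. Qed.
Lemma vdot_scal_l (k : R) (x z : vec) : vdot (vscal k x) z = k * vdot x z.
Proof. vring. Qed.
Lemma vdot_pos (x : vec) : 0 <= vdot x x.
Proof. unfold vdot. nra. Qed.
Lemma vcross_lagrange (x y : vec) :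
  vdot (vcross x y) (vcross x y) = vdot x x * vdot y y - vdot x y ^ 2.
Proof. vring. Qed.
(** Lagrange's identity for [vcross x y] and [vcross x z], whose vector product is the determinant
    times [x]. *)
Lemma vcross_cross (x y z : vec) :
  vdot (vcross x y) (vcross x y) * vdot (vcross x z) (vcross x z)
    - vdot (vcross x y) (vcross x z) ^ 2 = vdot x x * vdot (vcross x y) z ^ 2.
Proof. vring. Qed.
(** The squared determinant as a Gram determinant. For orthogonal [p] and [e] it expresses the
    length of [y] by its components along [p], [e] and [vcross p e]. *)
Lemma gram_det (y p e : vec) :
  vdot y (vcross p e) ^ 2 = vdot y y * vdot p p * vdot e e
    + 2 * (vdot y p * vdot p e * vdot e y)
    - vdot y y * vdot p e ^ 2 - vdot p p * vdot y e ^ 2 - vdot e e * vdot y p ^ 2.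
Proof. vring. Qed.

Lemma round_mult (x a : R) : 0 < a -> exists n : Z, Rabs (x - IZR n * a) <= a / 2.
Proof.
  intros Ha. exists (Int_part (x / a + 1 / 2)).
  pose proof (Int_part_bounds (x / a + 1 / 2)) as h.
  set (n := IZR (Int_part (x / a + 1 / 2))) in *.
  replace x with (x / a * a) at 1 by (field; lra).
  set (t := x / a) in *. apply Rabs_le_between. nra.
Qed.

(** Otherwise one could descend by the factor [3 / 4] again and again and fall below [m]. It avoids
    proving that a minimum is attained; [3 / 4] is the usual factor of lattice reduction. *)
Lemma almost_min (E : R -> Prop) (m : R) : (exists x, E x) -> 0 < m ->
  (forall x, E x -> m <= x) -> exists x, E x /\ forall y, E y -> 3 / 4 * x <= y.
Proof.
  intros [x0 Hx0] Hm H. apply NNPP. intros N.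
  assert (G : forall n : nat, exists x, E x /\ x <= (3 / 4) ^ n * x0).
  { induction n as [|n [x [Hx Hn]]]; [exists x0; simpl; split; [assumption|lra]|].
    assert (exists y, E y /\ y < 3 / 4 * x) as [y [Hy1 Hy2]].
    { apply NNPP. intros N'. apply N. exists x. split; [assumption|]. intros y Hy.
      apply Rnot_lt_le. intros h. apply N'. now exists y. }
    exists y. split; [assumption|]. simpl. lra. }
  assert (Hp : 0 < x0) by (specialize (H x0 Hx0); lra).
  destruct (pow_lt_1_zero (3 / 4) ltac:(rewrite Rabs_pos_eq; lra) (m / x0)) as [k Hk].
  { apply Rdiv_lt_0_compat; lra. }
  specialize (Hk k (le_n k)). rewrite Rabs_pos_eq in Hk by (apply pow_le; lra).
  destruct (G k) as [x [Hx Hle]]. specialize (H x Hx).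
  apply (Rmult_lt_compat_r x0) in Hk; [|assumption].
  replace (m / x0 * x0) with m in Hk by (field; lra). lra.
Qed.

(* Coordinates in which the plank around the line [y = al + be x], for [x] near [x0],
   becomes a box of size about 1, and the coordinates [dual] making [inc] the scalar
   product. *)
Definition frm (Q P d x0 al be q a b : R) : vec :=
  mkv (q / Q) ((a - x0 * q) / P) ((b - al * q - be * a) / d).
Definition fpt (Q P d x0 al be : R) (z : pt) : vec :=
  frm Q P d x0 al be (IZR (pq z)) (IZR (pa z)) (IZR (pb z)).
Definition dual (Q P d x0 al be : R) (l : pt) : vec :=
  mkv (Q * (IZR (pq l) * (al + be * x0) - IZR (pa l) * x0 + IZR (pb l)))
    (P * (IZR (pq l) * be - IZR (pa l))) (d * IZR (pq l)).

(** The covering radius of the lattice [fpt (Z^3)] is at most [t], for [0 <= t]. *)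
Definition covers (Q P d x0 al be t : R) : Prop :=
  forall y, exists z, let w := vsub y (fpt Q P d x0 al be z) in vdot w w <= t ^ 2.

Definition psub (z w : pt) : pt := mkpt (pq z - pq w) (pa z - pa w) (pb z - pb w).

Lemma fpt_sub (Q P d x0 al be : R) (z w : pt) (n : Z) :
  fpt Q P d x0 al be (psub z (dil n w)) =
  vsub (fpt Q P d x0 al be z) (vscal (IZR n) (fpt Q P d x0 al be w)).
Proof.
  unfold fpt, frm, vsub, vscal, psub, dil; cbn [pq pa pb v1 v2 v3].
  rewrite !minus_IZR, !mult_IZR. unfold Rdiv. f_equal; ring.
Qed.

Lemma inc_dual (Q P d x0 al be : R) (l z : pt) : 0 < Q -> 0 < P -> 0 < d ->
  IZR (inc l z) = vdot (dual Q P d x0 al be l) (fpt Q P d x0 al be z).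
Proof.
  intros. unfold inc, fpt, frm, vdot, dual; cbn [v1 v2 v3].
  rewrite plus_IZR, minus_IZR, !mult_IZR. field. lra.
Qed.

(** [/ (Q * P * d)] is the covolume: vector products of lattice vectors are dual vectors times the
    covolume. *)
Lemma fpt_cross (Q P d x0 al be : R) (z w : pt) : 0 < Q -> 0 < P -> 0 < d ->
  vcross (fpt Q P d x0 al be z) (fpt Q P d x0 al be w) =
  vscal (/ (Q * P * d)) (dual Q P d x0 al be (cross z w)).
Proof.
  intros. unfold vcross, vscal, fpt, frm, dual, cross; cbn [pq pa pb v1 v2 v3].
  rewrite !minus_IZR, !mult_IZR. f_equal; field; lra.
Qed.

Lemma IZR_sq_ge_1 (n : Z) : n <> 0%Z -> 1 <= IZR n ^ 2.
Proof. intros H. rewrite pow_IZR. apply IZR_le. simpl. nia. Qed.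

(** The map is triangular, so the first nonzero coordinate of [z] alone bounds the length from
    below. In [dual_lower] the order of the coordinates in the triangle is reversed. *)
Lemma fpt_lower (Q P d x0 al be : R) : 0 < Q -> 0 < P -> 0 < d ->
  exists m, 0 < m /\ forall z, z <> mkpt 0 0 0 ->
    m <= vdot (fpt Q P d x0 al be z) (fpt Q P d x0 al be z).
Proof.
  intros HQ HP Hd.
  assert (0 < / Q ^ 2) by (apply Rinv_0_lt_compat; nra).
  assert (0 < / P ^ 2) by (apply Rinv_0_lt_compat; nra).
  assert (0 < / d ^ 2) by (apply Rinv_0_lt_compat; nra).
  set (m := Rmin (/ Q ^ 2) (Rmin (/ P ^ 2) (/ d ^ 2))).
  assert (m <= / Q ^ 2) by apply Rmin_l.
  assert (m <= / P ^ 2) by (eapply Rle_trans; [apply Rmin_r|apply Rmin_l]).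
  assert (m <= / d ^ 2) by (eapply Rle_trans; [apply Rmin_r|apply Rmin_r]).
  exists m. split; [repeat apply Rmin_glb_lt; assumption|].
  intros [q a b] Hz. unfold fpt, frm, vdot; cbn [pq pa pb v1 v2 v3].
  set (t1 := IZR q / Q). set (t2 := (IZR a - x0 * IZR q) / P).
  set (t3 := (IZR b - al * IZR q - be * IZR a) / d).
  destruct (Z.eq_dec q 0) as [->|Hq]; [destruct (Z.eq_dec a 0) as [->|Ha];
    [destruct (Z.eq_dec b 0) as [->|Hb]|]|].
  - congruence.
  - assert (E : t3 * t3 = IZR b ^ 2 * / d ^ 2) by (unfold t3; field; lra).
    pose proof (IZR_sq_ge_1 b Hb). nra.
  - assert (E : t2 * t2 = IZR a ^ 2 * / P ^ 2) by (unfold t2; field; lra).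
    pose proof (IZR_sq_ge_1 a Ha). nra.
  - assert (E : t1 * t1 = IZR q ^ 2 * / Q ^ 2) by (unfold t1; field; lra).
    pose proof (IZR_sq_ge_1 q Hq). nra.
Qed.

Lemma dual_lower (Q P d x0 al be : R) : 0 < Q -> 0 < P -> 0 < d ->
  exists m, 0 < m /\ forall l, l <> mkpt 0 0 0 ->
    m <= vdot (dual Q P d x0 al be l) (dual Q P d x0 al be l).
Proof.
  intros HQ HP Hd.
  assert (0 < Q ^ 2) by nra. assert (0 < P ^ 2) by nra. assert (0 < d ^ 2) by nra.
  set (m := Rmin (Q ^ 2) (Rmin (P ^ 2) (d ^ 2))).
  assert (m <= Q ^ 2) by apply Rmin_l.
  assert (m <= P ^ 2) by (eapply Rle_trans; [apply Rmin_r|apply Rmin_l]).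
  assert (m <= d ^ 2) by (eapply Rle_trans; [apply Rmin_r|apply Rmin_r]).
  exists m. split; [repeat apply Rmin_glb_lt; assumption|].
  intros [h j k] Hz. unfold dual, vdot; cbn [pq pa pb v1 v2 v3].
  set (t1 := Q * (IZR h * (al + be * x0) - IZR j * x0 + IZR k)).
  set (t2 := P * (IZR h * be - IZR j)). set (t3 := d * IZR h).
  destruct (Z.eq_dec h 0) as [->|Hh]; [destruct (Z.eq_dec j 0) as [->|Hj];
    [destruct (Z.eq_dec k 0) as [->|Hk]|]|].
  - congruence.
  - assert (E : t1 * t1 = IZR k ^ 2 * Q ^ 2) by (unfold t1; ring).
    pose proof (IZR_sq_ge_1 k Hk). nra.
  - assert (E : t2 * t2 = IZR j ^ 2 * P ^ 2) by (unfold t2; ring).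
    pose proof (IZR_sq_ge_1 j Hj). nra.
  - assert (E : t3 * t3 = IZR h ^ 2 * d ^ 2) by (unfold t3; ring).
    pose proof (IZR_sq_ge_1 h Hh). nra.
Qed.

(* Transference: a basis of [Z^3] that almost minimizes the LLL potential is reduced, so
   the dual vector [l] orthogonal to its first two vectors controls the covering radius. *)
Lemma transference (Q P d x0 al be : R) : 0 < Q -> 0 < P -> 0 < d ->
  exists l, prim l /\ forall y, exists z,
    let w := vsub y (fpt Q P d x0 al be z) in
    vdot w w * vdot (dual Q P d x0 al be l) (dual Q P d x0 al be l) <= 4.
Proof.
  intros HQ HP Hd.
  set (u := fpt Q P d x0 al be). set (ds := dual Q P d x0 al be).
  set (k := / (Q * P * d)).
  assert (Hk : 0 < k) by (apply Rinv_0_lt_compat; repeat apply Rmult_lt_0_compat; lra).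
  (* Squared length of the first vector times squared area of the first two; [unim] says that the
     pair extends to a basis. *)
  set (pot := fun z w => vdot (u z) (u z) * vdot (vcross (u z) (u w)) (vcross (u z) (u w))).
  set (unim := fun x y z => inc (cross x y) z = 1%Z \/ inc (cross x y) z = (-1)%Z).
  assert (Hsub : forall z w n, u (psub z (dil n w)) = vsub (u z) (vscal (IZR n) (u w)))
    by (intros; apply fpt_sub).
  assert (Hcr : forall z w, vcross (u z) (u w) = vscal k (ds (cross z w)))
    by (intros; now apply fpt_cross).
  destruct (fpt_lower Q P d x0 al be HQ HP Hd) as [m1 [Hm1 L1]].
  destruct (dual_lower Q P d x0 al be HQ HP Hd) as [m2 [Hm2 L2]].
  assert (Hcr0 : forall z w s, unim z w s -> cross z w <> mkpt 0 0 0).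
  { intros z w s H E. unfold unim in H. rewrite E in H. unfold inc in H. simpl in H. lia. }
  assert (Hcrp : forall z w s, unim z w s ->
    k ^ 2 * m2 <= vdot (vcross (u z) (u w)) (vcross (u z) (u w))).
  { intros z w s H. rewrite Hcr.
    replace (vdot (vscal k (ds (cross z w))) (vscal k (ds (cross z w))))
      with (k ^ 2 * vdot (ds (cross z w)) (ds (cross z w))) by vring.
    apply Rmult_le_compat_l; [nra|]. apply L2. now apply (Hcr0 z w s). }
  assert (Hk2 : 0 < k ^ 2 * m2) by (apply Rmult_lt_0_compat; nra).
  assert (Hz0 : forall z w s, unim z w s -> m1 <= vdot (u z) (u z)).
  { intros z w s H. apply L1. intros ->. unfold unim, inc, cross in H. simpl in H. lia. }
  destruct (almost_min (fun x => exists z w s, unim z w s /\ x = pot z w) (m1 * (k ^ 2 * m2)))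
    as [x [[b1 [b2 [b3 [Hb ->]]]] Hmin]].
  - exists (pot (mkpt 1 0 0) (mkpt 0 1 0)), (mkpt 1 0 0), (mkpt 0 1 0), (mkpt 0 0 1).
    split; [left; reflexivity|reflexivity].
  - now apply Rmult_lt_0_compat.
  - intros x [z [w [s [H ->]]]]. unfold pot.
    apply Rmult_le_compat; [lra|lra|now apply (Hz0 z w s)|now apply (Hcrp z w s)].
  - assert (Hmin' : forall z w s, unim z w s -> 3 / 4 * pot b1 b2 <= pot z w).
    { intros z w s H. apply Hmin. now exists z, w, s. }
    clear Hmin. set (a := vdot (u b1) (u b1)).
    assert (Ha : 0 < a) by (pose proof (Hz0 _ _ _ Hb); unfold a; lra).
    destruct (round_mult (vdot (u b2) (u b1)) a Ha) as [n2 Hn2].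
    set (c2 := psub b2 (dil n2 b1)).
    assert (E2 : u c2 = vsub (u b2) (vscal (IZR n2) (u b1))) by apply Hsub.
    assert (Hc2 : Rabs (vdot (u b1) (u c2)) <= a / 2).
    { rewrite E2. replace (vdot (u b1) (vsub (u b2) (vscal (IZR n2) (u b1))))
        with (vdot (u b2) (u b1) - IZR n2 * a) by (unfold a; vring). assumption. }
    assert (Ep : vcross (u b1) (u c2) = vcross (u b1) (u b2)).
    { rewrite E2. unfold vcross, vsub, vscal; cbn [v1 v2 v3]. f_equal; ring. }
    set (p := vcross (u b1) (u c2)) in *. set (pp := vdot p p).
    assert (Hpp : 0 < pp).
    { unfold pp. rewrite Ep. pose proof (Hcrp _ _ _ Hb). lra. }
    assert (Hpot : pot b1 b2 = a * pp) by (unfold pot; rewrite <- Ep; reflexivity).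
    (* Exchanging the first two vectors cannot lower the potential by more than [3 / 4], so the
       second has squared length at least [3 / 4 * a]; removing its component along the first, at
       most half that vector, leaves [1 / 2]. *)
    assert (R1 : 1 / 2 * a ^ 2 <= pp).
    { assert (U : unim c2 b1 b3).
      { unfold unim in *. replace (inc (cross c2 b1) b3) with (- inc (cross b1 b2) b3)%Z; [lia|].
        unfold c2, psub, dil, cross, inc; cbn [pq pa pb]. ring. }
      pose proof (Hmin' _ _ _ U) as h. rewrite Hpot in h. unfold pot in h.
      replace (vdot (vcross (u c2) (u b1)) (vcross (u c2) (u b1))) with pp in h
        by (unfold pp, p; vring).
      assert (h' : 3 / 4 * a <= vdot (u c2) (u c2)).
      { apply Rmult_le_reg_r with pp; [assumption|]. lra. }
      unfold pp, p. rewrite vcross_lagrange. fold a. rewrite <- (pow2_abs (vdot (u b1) (u c2))).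
      assert (Rabs (vdot (u b1) (u c2)) ^ 2 <= (a / 2) ^ 2)
        by (apply pow_incr; split; [apply Rabs_pos|assumption]).
      nra. }
    destruct (round_mult (vdot (vcross (u b1) (u b3)) p) pp Hpp) as [n3 Hn3].
    set (c3 := psub b3 (dil n3 c2)).
    assert (E3 : u c3 = vsub (u b3) (vscal (IZR n3) (u c2))) by apply Hsub.
    set (r := vcross (u b1) (u c3)).
    assert (Hr : Rabs (vdot p r) <= pp / 2).
    { unfold r. rewrite E3.
      replace (vdot p (vcross (u b1) (vsub (u b3) (vscal (IZR n3) (u c2)))))
        with (vdot (vcross (u b1) (u b3)) p - IZR n3 * pp) by (unfold pp, p; vring).
      assumption. }
    assert (Hdet : vdot p (u c3) ^ 2 = k ^ 2).
    { assert (E : vdot p (u c3) = k * IZR (inc (cross b1 b2) b3)).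
      { rewrite E3.
        replace (vdot p (vsub (u b3) (vscal (IZR n3) (u c2)))) with (vdot p (u b3))
          by (unfold p; vring).
        rewrite Ep, Hcr, vdot_scal_l. unfold ds, u. rewrite <- inc_dual by assumption.
        reflexivity. }
      rewrite E. destruct Hb as [-> | ->]; ring. }
    (* The same argument one dimension higher, exchanging the second and third vectors, with
       [vcross_cross] in place of [vcross_lagrange]. *)
    assert (R2 : 1 / 2 * pp ^ 2 <= a * k ^ 2).
    { assert (U : unim b1 c3 c2).
      { unfold unim in *. replace (inc (cross b1 c3) c2) with (- inc (cross b1 b2) b3)%Z; [lia|].
        unfold c3, c2, psub, dil, cross, inc; cbn [pq pa pb]. ring. }
      pose proof (Hmin' _ _ _ U) as h. rewrite Hpot in h. unfold pot in h. fold a r in h.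
      assert (h' : 3 / 4 * pp <= vdot r r).
      { apply Rmult_le_reg_l with a; [assumption|]. lra. }
      pose proof (vcross_cross (u b1) (u c2) (u c3)) as VC. fold a p r pp in VC.
      rewrite <- (pow2_abs (vdot p r)), Hdet in VC.
      assert (Rabs (vdot p r) ^ 2 <= (pp / 2) ^ 2)
        by (apply pow_incr; split; [apply Rabs_pos|assumption]).
      nra. }
    exists (cross b1 b2). split.
    { destruct Hb as [Hb|Hb]; unfold inc in Hb.
      - exists (pb b3), (- pa b3)%Z, (pq b3). lia.
      - exists (- pb b3)%Z, (pa b3), (- pq b3)%Z. lia. }
    intros y.
    assert (Hkd : 0 < Rabs (vdot p (u c3))).
    { apply Rabs_pos_lt. intros E. rewrite E in Hdet. nra. }
    (* Babai's nearest plane: multiples of the third, second and first basis vector are subtracted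
       in this order, each rounding one orthogonal component and leaving the earlier ones
       unchanged. *)
    assert (R3 : exists n, Rabs (vdot (vsub y (vscal (IZR n) (u c3))) p) <= k / 2).
    { assert (Hx : vdot p (u c3) = k \/ vdot p (u c3) = - k).
      { assert ((vdot p (u c3) - k) * (vdot p (u c3) + k) = 0) by nra.
        apply Rmult_integral in H. destruct H; [left|right]; lra. }
      destruct (round_mult (vdot y p) k Hk) as [n Hn].
      destruct Hx as [Hx|Hx]; [exists n|exists (- n)%Z];
        replace (vdot (vsub y (vscal (IZR _) (u c3))) p)
          with (vdot y p - IZR n * k); try assumption; rewrite vdot_sub_l, vdot_scal_l;
        replace (vdot (u c3) p) with (vdot p (u c3)) by vring; rewrite Hx;
        rewrite ?opp_IZR; ring. }
    destruct R3 as [n3' Hn3']. set (y3 := vsub y (vscal (IZR n3') (u c3))) in *.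
    destruct (round_mult (vdot y3 (vcross p (u b1))) pp Hpp) as [n2' Hn2'].
    set (y2 := vsub y3 (vscal (IZR n2') (u c2))) in *.
    destruct (round_mult (vdot y2 (u b1)) a Ha) as [n1' Hn1'].
    set (y1 := vsub y2 (vscal (IZR n1') (u b1))) in *.
    exists (psub (mkpt 0 0 0) (dil (- 1) (mkpt (n3' * pq c3 + n2' * pq c2 + n1' * pq b1)
      (n3' * pa c3 + n2' * pa c2 + n1' * pa b1) (n3' * pb c3 + n2' * pb c2 + n1' * pb b1)))).
    replace (vsub y _) with y1; cycle 1.
    { unfold y1, y2, y3, u, fpt, frm, vsub, vscal, psub, dil; cbn [pq pa pb v1 v2 v3].
      rewrite ?minus_IZR, ?mult_IZR, ?plus_IZR, ?mult_IZR. unfold Rdiv. f_equal; ring. }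
    cbv zeta.
    assert (T1 : Rabs (vdot y1 (u b1)) <= a / 2).
    { unfold y1. rewrite vdot_sub_l, vdot_scal_l. assumption. }
    assert (T2 : Rabs (vdot y1 (vcross p (u b1))) <= pp / 2).
    { replace (vdot y1 (vcross p (u b1))) with (vdot y3 (vcross p (u b1)) - IZR n2' * pp);
        [assumption|]. unfold y1, y2, pp, p. vring. }
    assert (T3 : Rabs (vdot y1 p) <= k / 2).
    { replace (vdot y1 p) with (vdot y3 p); [assumption|]. unfold y1, y2, p. vring. }
    assert (Hpe : vdot p (u b1) = 0) by (unfold p; vring).
    pose proof (gram_det y1 p (u b1)) as Gr. rewrite Hpe in Gr. fold a pp in Gr.
    set (n := vdot y1 y1) in *.
    assert (S1 : vdot y1 (u b1) ^ 2 <= (a / 2) ^ 2).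
    { now apply sq_le_of_Rabs. }
    assert (S2 : vdot y1 (vcross p (u b1)) ^ 2 <= (pp / 2) ^ 2).
    { now apply sq_le_of_Rabs. }
    assert (S3 : vdot y1 p ^ 2 <= (k / 2) ^ 2).
    { now apply sq_le_of_Rabs. }
    assert (Eds : pp = k ^ 2 * vdot (ds (cross b1 b2)) (ds (cross b1 b2))).
    { unfold pp. rewrite Ep, Hcr. vring. }
    set (N := vdot (ds (cross b1 b2)) (ds (cross b1 b2))) in *.
    (* Pythagoras in the orthogonal frame [p], [u b1], [vcross p (u b1)]. By [R1] and [R2] the last
       two terms are at most a multiple of the first, the one governed by the dual vector. *)
    assert (B : n * (pp * a) <= a * k ^ 2 / 4 + pp * a ^ 2 / 4 + pp ^ 2 / 4).
    { assert (a * vdot y1 p ^ 2 <= a * (k / 2) ^ 2) by (apply Rmult_le_compat_l; lra).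
      assert (pp * vdot y1 (u b1) ^ 2 <= pp * (a / 2) ^ 2) by (apply Rmult_le_compat_l; lra).
      nra. }
    assert (B2 : n * (pp * a) <= 7 / 4 * (a * k ^ 2)).
    { assert (pp * a ^ 2 <= 2 * pp ^ 2) by nra. lra. }
    apply Rmult_le_reg_r with (a * k ^ 2); [apply Rmult_lt_0_compat; nra|].
    replace (n * N * (a * k ^ 2)) with (n * (pp * a)) by (rewrite Eds; ring).
    assert (0 < a * k ^ 2) by (apply Rmult_lt_0_compat; nra). lra.
Qed.

(** * Lattice points in planks *)

Lemma length_flat_map_lsum {A B : Type} (F : A -> list B) (l : list A) :
  INR (length (flat_map F l)) = lsum (fun x => INR (length (F x))) l.
Proof.
  induction l as [|x l IH]; [reflexivity|].
  cbn [flat_map lsum]. rewrite length_app, plus_INR, IH. reflexivity.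
Qed.

Lemma nodup_flat_map {A B : Type} (F : A -> list B) (l : list A) : NoDup l ->
  (forall x, NoDup (F x)) -> (forall x y z, In z (F x) -> In z (F y) -> x = y) ->
  NoDup (flat_map F l).
Proof.
  intros Hl HF Hd. induction Hl as [|x l Hx Hl IH]; simpl; [constructor|].
  apply NoDup_app; auto. intros z Hz Hz'.
  apply in_flat_map in Hz'. destruct Hz' as [y [Hy Hzy]].
  apply Hx. now rewrite (Hd x y z).
Qed.

Definition triples (sq : list Z) (sa : Z -> list Z) (sb : Z -> Z -> list Z) : list pt :=
  flat_map (fun q => flat_map (fun a => map (mkpt q a) (sb q a)) (sa q)) sq.

Lemma triples_in sq sa sb (z : pt) : In z (triples sq sa sb) <->
  In (pq z) sq /\ In (pa z) (sa (pq z)) /\ In (pb z) (sb (pq z) (pa z)).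
Proof.
  unfold triples. rewrite in_flat_map. split.
  - intros [q [Hq H]]. apply in_flat_map in H. destruct H as [a [Ha H]].
    apply in_map_iff in H. destruct H as [b [<- Hb]]. auto.
  - intros [Hq [Ha Hb]]. exists (pq z). split; [assumption|]. apply in_flat_map.
    exists (pa z). split; [assumption|]. apply in_map_iff. exists (pb z).
    split; [now destruct z|assumption].
Qed.

Lemma triples_nodup sq sa sb : NoDup sq -> (forall q, NoDup (sa q)) ->
  (forall q a, NoDup (sb q a)) -> NoDup (triples sq sa sb).
Proof.
  intros Hq Ha Hb. apply nodup_flat_map; [assumption| |].
  - intros q. apply nodup_flat_map; [apply Ha| |].
    + intros a. apply nodup_map_inj; [apply Hb|]. intros b b' _ _ E. congruence.
    + intros a a' z H H'. apply in_map_iff in H, H'.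
      destruct H as [b [<- _]], H' as [b' [E _]]. congruence.
  - intros q q' z H H'. apply in_flat_map in H, H'.
    destruct H as [a [_ H]], H' as [a' [_ H']]. apply in_map_iff in H, H'.
    destruct H as [b [<- _]], H' as [b' [E _]]. congruence.
Qed.

Definition box (x0 al be u v L e1 e2 rho : R) : list pt :=
  triples (zint u v) (fun q => zint (x0 * IZR q + e1) (x0 * IZR q + (L * IZR q + e2)))
    (fun q a => zint (al * IZR q + be * IZR a - rho) (al * IZR q + be * IZR a + rho)).

Lemma box_in (x0 al be u v L e1 e2 rho : R) (z : pt) :
  In z (box x0 al be u v L e1 e2 rho) <->
  u < IZR (pq z) <= v /\
  e1 < IZR (pa z) - x0 * IZR (pq z) <= L * IZR (pq z) + e2 /\
  - rho < IZR (pb z) - al * IZR (pq z) - be * IZR (pa z) <= rho.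
Proof. unfold box. rewrite triples_in, !zint_in. split; intros; lra. Qed.

Lemma box_nodup (x0 al be u v L e1 e2 rho : R) : NoDup (box x0 al be u v L e1 e2 rho).
Proof. apply triples_nodup; intros; apply zint_nodup. Qed.

Lemma box_up (x0 al be u v L e1 e2 rho : R) : u <= v -> 0 <= u + v + 1 -> 0 <= L ->
  0 <= L * u + e2 - e1 -> 0 <= e2 - e1 -> 0 <= rho ->
  INR (length (box x0 al be u v L e1 e2 rho)) <=
    (2 * rho + 1) * ((v - u + 1) * (L * (u + v + 1) / 2 + (e2 - e1 + 1))).
Proof.
  intros Huv Huv1 HL Hpos He Hrho. unfold box, triples. rewrite length_flat_map_lsum.
  apply Rle_trans with (lsum (fun q => (2 * rho + 1) * (L * IZR q + (e2 - e1 + 1))) (zint u v)).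
  - apply lsum_le. intros q Hq. apply zint_in in Hq. rewrite length_flat_map_lsum.
    apply Rle_trans with (lsum (fun _ => 2 * rho + 1)
      (zint (x0 * IZR q + e1) (x0 * IZR q + (L * IZR q + e2)))).
    + apply lsum_le. intros a _. rewrite length_map.
      eapply Rle_trans; [apply zint_len_up; lra|lra].
    + rewrite lsum_const. apply Rmult_le_compat_l; [lra|].
      assert (L * u <= L * IZR q) by (apply Rmult_le_compat_l; lra).
      eapply Rle_trans; [apply zint_len_up; lra|lra].
  - rewrite lsum_scal. apply Rmult_le_compat_l; [lra|].
    rewrite lsum_plus, lsum_scal, lsum_const.
    pose proof (zint_sum_up u v Huv Huv1). pose proof (zint_len_up u v ltac:(lra)).
    assert (L * lsum IZR (zint u v) <= L * ((v - u + 1) * (u + v + 1) / 2))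
      by (apply Rmult_le_compat_l; assumption).
    assert ((e2 - e1 + 1) * INR (length (zint u v)) <= (e2 - e1 + 1) * (v - u + 1))
      by (apply Rmult_le_compat_l; lra).
    lra.
Qed.

Lemma box_low (x0 al be u v L e1 e2 rho : R) : u <= v -> 1 <= u + v -> 0 <= L ->
  e2 - e1 <= 1 -> 1 <= 2 * rho ->
  (2 * rho - 1) * (L * ((v - u - 1) * (u + v - 1) / 2) - (e1 - e2 + 1) * (v - u + 1)) <=
  INR (length (box x0 al be u v L e1 e2 rho)).
Proof.
  intros Huv Huv1 HL He Hrho. unfold box, triples. rewrite length_flat_map_lsum.
  apply Rle_trans with (lsum (fun q => (2 * rho - 1) * (L * IZR q + (e2 - e1 - 1))) (zint u v)).
  - rewrite lsum_scal. apply Rmult_le_compat_l; [lra|].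
    rewrite lsum_plus, lsum_scal, lsum_const.
    pose proof (zint_sum_low u v Huv Huv1). pose proof (zint_len_up u v ltac:(lra)).
    assert (L * ((v - u - 1) * (u + v - 1) / 2) <= L * lsum IZR (zint u v))
      by (apply Rmult_le_compat_l; assumption).
    assert ((e1 - e2 + 1) * INR (length (zint u v)) <= (e1 - e2 + 1) * (v - u + 1))
      by (apply Rmult_le_compat_l; lra).
    lra.
  - apply lsum_le. intros q Hq. rewrite length_flat_map_lsum.
    apply Rle_trans with (lsum (fun _ => 2 * rho - 1)
      (zint (x0 * IZR q + e1) (x0 * IZR q + (L * IZR q + e2)))).
    + rewrite lsum_const. apply Rmult_le_compat_l; [lra|].
      eapply Rle_trans; [|apply zint_len_low]. lra.
    + apply lsum_le. intros a _. rewrite length_map.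
      eapply Rle_trans; [|apply zint_len_low]. lra.
Qed.

(** * Comparison of the lattice with a finer one *)

Definition red (M : Z) (z : pt) : pt := mkpt (pq z mod M) (pa z mod M) (pb z mod M).
Definition quo (M : Z) (z : pt) : pt := mkpt (pq z / M) (pa z / M) (pb z / M).
Definition padd (z w : pt) : pt := mkpt (pq z + pq w) (pa z + pa w) (pb z + pb w).

Definition residues (M : nat) : list pt :=
  let s := map Z.of_nat (seq 0 M) in triples s (fun _ => s) (fun _ _ => s).

Lemma residues_in (M : nat) (z : pt) : In z (residues M) <->
  (0 <= pq z < Z.of_nat M /\ 0 <= pa z < Z.of_nat M /\ 0 <= pb z < Z.of_nat M)%Z.
Proof.
  assert (S : forall n, In n (map Z.of_nat (seq 0 M)) <-> (0 <= n < Z.of_nat M)%Z).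
  { intros n. rewrite in_map_iff. split.
    - intros [i [<- Hi]]. apply in_seq in Hi. lia.
    - intros Hn. exists (Z.to_nat n). split; [lia|]. apply in_seq. lia. }
  unfold residues. now rewrite triples_in, !S.
Qed.

Lemma residues_nodup (M : nat) : NoDup (residues M).
Proof.
  apply triples_nodup; intros; (apply nodup_map_inj; [apply seq_NoDup|intros; lia]).
Qed.

Lemma residues_length (M : nat) : INR (length (residues M)) = INR M ^ 3.
Proof.
  unfold residues, triples. set (s := map Z.of_nat (seq 0 M)).
  assert (Es : INR (length s) = INR M) by (unfold s; rewrite length_map, length_seq; reflexivity).
  rewrite length_flat_map_lsum.
  rewrite (lsum_ext _ (fun _ => INR M * INR M)).
  - rewrite lsum_const, Es. ring.
  - intros q _. rewrite length_flat_map_lsum, (lsum_ext _ (fun _ => INR M)).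
    + rewrite lsum_const, Es. ring.
    + intros a _. now rewrite length_map.
Qed.

Lemma red_quo (M : Z) (w : pt) : (0 < M)%Z -> w = padd (red M w) (dil M (quo M w)).
Proof.
  intros H. unfold padd, red, dil, quo; cbn [pq pa pb]. destruct w as [q a b]; cbn [pq pa pb].
  pose proof (Z.div_mod q M ltac:(lia)). pose proof (Z.div_mod a M ltac:(lia)).
  pose proof (Z.div_mod b M ltac:(lia)). f_equal; lia.
Qed.

(* Volumes are replaced by counting points of [(1/M) Z^3], one class modulo [Z^3] at a
   time. *)
Lemma coset_reps (Q P d x0 al be t : R) (M : nat) : 0 < Q -> 0 < P -> 0 < d -> 0 <= t ->
  (0 < M)%nat ->
  covers Q P d x0 al be t ->
  exists s : pt -> pt, forall r,
    Rabs (IZR (pq r - Z.of_nat M * pq (s r))) <= t * Q * INR M /\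
    Rabs (IZR (pa r - Z.of_nat M * pa (s r)) - x0 * IZR (pq r - Z.of_nat M * pq (s r)))
      <= t * P * INR M /\
    Rabs (IZR (pb r - Z.of_nat M * pb (s r)) - al * IZR (pq r - Z.of_nat M * pq (s r))
      - be * IZR (pa r - Z.of_nat M * pa (s r))) <= t * d * INR M.
Proof.
  intros HQ HP Hd Ht HM H.
  assert (Hm : 0 < INR M) by (now apply lt_0_INR).
  set (y := fun r => frm Q P d x0 al be (IZR (pq r) / INR M) (IZR (pa r) / INR M) (IZR (pb r) / INR M)).
  set (s := fun r => epsilon (inhabits (mkpt 0 0 0))
    (fun z => let w := vsub (y r) (fpt Q P d x0 al be z) in vdot w w <= t ^ 2)).
  exists s. intros r.
  assert (Hs : let w := vsub (y r) (fpt Q P d x0 al be (s r)) in vdot w w <= t ^ 2).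
  { unfold s. apply epsilon_spec. apply H. }
  cbv zeta in Hs. set (w := vsub (y r) (fpt Q P d x0 al be (s r))) in *.
  assert (Hv : forall x, x * x <= vdot w w -> Rabs x <= t).
  { intros x Hx. apply Rabs_le_of_sq; nra. }
  assert (W1 : Rabs (v1 w) <= t) by (apply Hv; unfold vdot; nra).
  assert (W2 : Rabs (v2 w) <= t) by (apply Hv; unfold vdot; nra).
  assert (W3 : Rabs (v3 w) <= t) by (apply Hv; unfold vdot; nra).
  rewrite !minus_IZR, !mult_IZR, <- INR_IZR_INZ.
  assert (G : forall x v k, 0 < k -> Rabs v <= t -> x = v * (k * INR M) -> Rabs x <= t * k * INR M).
  { intros x v k Hk Hx ->. rewrite Rabs_mult, (Rabs_pos_eq (k * INR M)) by nra.
    rewrite Rmult_assoc. apply Rmult_le_compat_r; [nra|assumption]. }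
  split; [|split].
  - apply (G _ (v1 w) Q HQ W1). unfold w, y, fpt, frm, vsub; cbn [v1 v2 v3]. field. lra.
  - apply (G _ (v2 w) P HP W2). unfold w, y, fpt, frm, vsub; cbn [v1 v2 v3]. field. lra.
  - apply (G _ (v3 w) d Hd W3). unfold w, y, fpt, frm, vsub; cbn [v1 v2 v3]. field. lra.
Qed.

Definition plank (Q L x0 al be rho : R) (z : pt) : Prop :=
  Q < IZR (pq z) <= 2 * Q /\ 0 < IZR (pa z) - x0 * IZR (pq z) <= L * IZR (pq z) /\
  Rabs (IZR (pb z) - al * IZR (pq z) - be * IZR (pa z)) < rho.

Lemma scale_exists (x y z : R) : 0 < x -> 0 < y -> 0 < z ->
  exists M : nat, (0 < M)%nat /\ 1 <= x * INR M /\ 1 <= y * INR M /\ 1 <= z * INR M.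
Proof.
  intros Hx Hy Hz.
  destruct (INR_archimed 1 (/ x + / y + / z + 1) Rlt_0_1) as [M HM].
  pose proof (Rinv_0_lt_compat x Hx). pose proof (Rinv_0_lt_compat y Hy).
  pose proof (Rinv_0_lt_compat z Hz).
  exists M. split; [apply INR_lt; simpl; lra|].
  assert (G : forall k, 0 < k -> / k <= INR M -> 1 <= k * INR M).
  { intros k Hk h. rewrite <- (Rinv_r k) by lra. apply Rmult_le_compat_l; lra. }
  repeat split; apply G; lra.
Qed.

(** Each point of the plank spawns [M ^ 3] points of [(1/M) Z^3], one per residue class, within
    distance [t] in the coordinates of [frm]. They are distinct and lie in a slightly larger box,
    where counting is elementary. *)
Lemma plank_up (Q L d x0 al be t rho : R) : 0 < Q -> 0 < L -> 0 < d -> 0 < t -> 0 <= rho ->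
  covers Q (Q * L) d x0 al be t ->
  atmost (plank Q L x0 al be rho)
    (Q * (Q * L) * (1 + 3 * t) * (3 / 2 + 5 * t) * (2 * rho + 3 * t * d)).
Proof.
  intros HQ HL Hd Ht Hrho H l Hl Hx.
  set (P := Q * L) in *. assert (HP : 0 < P) by (now apply Rmult_lt_0_compat).
  (* For such [M] the rounding terms [+ 1] in [box_up] are at most [t * Q * M], [t * P * M] and
     [t * d * M], hence absorbed by the margins. *)
  destruct (scale_exists (t * Q) (t * P) (t * d)) as [M [HM [M1 [M2 M3]]]];
    try (now apply Rmult_lt_0_compat).
  destruct (coset_reps Q P d x0 al be t M HQ HP Hd ltac:(lra) HM H) as [s Hs].
  set (m := INR M) in *. set (MZ := Z.of_nat M) in *.
  assert (EM : IZR MZ = m) by (unfold MZ, m; now rewrite INR_IZR_INZ).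
  assert (Hm : 0 < m) by (unfold m; now apply lt_0_INR).
  assert (HMZ : (0 < MZ)%Z) by (unfold MZ; lia).
  set (fine := box x0 al be ((1 - t) * Q * m) ((2 + t) * Q * m) L (- t * P * m)
    (2 * t * P * m) ((rho + t * d) * m)).
  (* Scaled by [M]: the point [M * z] is shifted by the vector [r - M * s r], which [coset_reps]
     makes short in the class of [r]. *)
  set (wrap := fun z => map (fun r => padd r (dil MZ (psub z (dil 1 (s r))))) (residues M)).
  assert (Hred : forall r z, In r (residues M) ->
    red MZ (padd r (dil MZ (psub z (dil 1 (s r))))) = r).
  { intros r z Hr. apply residues_in in Hr. fold MZ in Hr. destruct r as [q a b].
    unfold red, padd, dil, psub; cbn [pq pa pb] in *.
    f_equal; rewrite Z.mul_comm, Z.mod_add by lia; apply Z.mod_small; lia. }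
  assert (Hinj : forall r z z', padd r (dil MZ (psub z (dil 1 (s r)))) =
    padd r (dil MZ (psub z' (dil 1 (s r)))) -> z = z').
  { intros r z z' E. unfold padd, dil, psub in E; cbn [pq pa pb] in E.
    injection E as E1 E2 E3. apply pt_eq; nia. }
  assert (Hlen : INR (length l) * m ^ 3 <= INR (length fine)).
  { replace (INR (length l) * m ^ 3) with (INR (length (flat_map wrap l))).
    - apply le_INR, NoDup_incl_length.
      + apply nodup_flat_map; [assumption| |].
        * intros z. apply nodup_map_inj; [apply residues_nodup|].
          intros r r' Hr Hr' E. rewrite <- (Hred r z Hr), E. now apply Hred.
        * intros z z' w Hz Hz'. unfold wrap in *. apply in_map_iff in Hz, Hz'.
          destruct Hz as [r [E Hr]], Hz' as [r' [E' Hr']].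
          assert (r = r') by (rewrite <- (Hred r z Hr), <- (Hred r' z' Hr'), E, E'; reflexivity).
          subst r'. apply (Hinj r). congruence.
      + intros w Hw. apply in_flat_map in Hw. destruct Hw as [z [Hz Hw]].
        unfold wrap in Hw. apply in_map_iff in Hw. destruct Hw as [r [<- Hr]].
        destruct (Hx z Hz) as [D1 [D2 D3]]. destruct (Hs r) as [S1 [S2 S3]].
        apply box_in. unfold padd, dil, psub; cbn [pq pa pb].
        replace (pq r + MZ * (pq z - 1 * pq (s r)))%Z with ((pq r - MZ * pq (s r)) + MZ * pq z)%Z by ring.
        replace (pa r + MZ * (pa z - 1 * pa (s r)))%Z with ((pa r - MZ * pa (s r)) + MZ * pa z)%Z by ring.
        replace (pb r + MZ * (pb z - 1 * pb (s r)))%Z with ((pb r - MZ * pb (s r)) + MZ * pb z)%Z by ring.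
        rewrite !plus_IZR, !mult_IZR, EM.
        set (q1 := IZR (pq r - MZ * pq (s r))) in *. set (a1 := IZR (pa r - MZ * pa (s r))) in *.
        set (b1 := IZR (pb r - MZ * pb (s r))) in *.
        set (q := IZR (pq z)) in *. set (a := IZR (pa z)) in *. set (b := IZR (pb z)) in *.
        apply Rabs_le_between in S1, S2, S3. apply Rabs_lt_between in D3.
        assert (m * Q < m * q) by (apply Rmult_lt_compat_l; lra).
        assert (m * q <= m * (2 * Q)) by (apply Rmult_le_compat_l; lra).
        assert (0 < m * (a - x0 * q)) by (apply Rmult_lt_0_compat; lra).
        assert (m * (a - x0 * q) <= m * (L * q)) by (apply Rmult_le_compat_l; lra).
        assert (m * (- rho) < m * (b - al * q - be * a)) by (apply Rmult_lt_compat_l; lra).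
        assert (m * (b - al * q - be * a) < m * rho) by (apply Rmult_lt_compat_l; lra).
        assert (L * (- (t * Q * m)) <= L * q1) by (apply Rmult_le_compat_l; lra).
        assert (EP : t * P * m = L * (t * Q * m)) by (unfold P; ring).
        repeat split; lra.
    - rewrite length_flat_map_lsum. rewrite (lsum_ext _ (fun _ => m ^ 3)).
      + rewrite lsum_const. ring.
      + intros z _. unfold wrap. rewrite length_map, residues_length. reflexivity. }
  assert (Hbox : INR (length fine) <= (2 * ((rho + t * d) * m) + 1) *
    (((2 + t) * Q * m - (1 - t) * Q * m + 1) *
     (L * ((1 - t) * Q * m + (2 + t) * Q * m + 1) / 2 + (2 * t * P * m - - t * P * m + 1)))).
  { assert (0 < Q * m) by (now apply Rmult_lt_0_compat).
    assert (0 < t * (Q * m)) by (now apply Rmult_lt_0_compat).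
    assert (0 < P * m) by (now apply Rmult_lt_0_compat).
    assert (0 < t * (P * m)) by (now apply Rmult_lt_0_compat).
    assert (L * (Q * m) = P * m) by (unfold P; ring).
    apply box_up; try lra; try nra.
    }
  apply Rmult_le_reg_r with (m ^ 3); [apply pow_lt; assumption|].
  apply Rle_trans with (1 := Hlen). apply Rle_trans with (1 := Hbox).
  assert (0 < Q * m) by (now apply Rmult_lt_0_compat).
  assert (0 < P * m) by (now apply Rmult_lt_0_compat).
  assert (HLm : L <= t * P * m).
  { replace (t * P * m) with (L * (t * Q * m)) by (unfold P; ring). nra. }
  replace (Q * P * (1 + 3 * t) * (3 / 2 + 5 * t) * (2 * rho + 3 * t * d) * m ^ 3)
    with ((2 * rho + 3 * t * d) * m * ((1 + 3 * t) * (Q * m) * ((3 / 2 + 5 * t) * (P * m)))) by ring.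
  assert (0 <= rho * m) by (apply Rmult_le_pos; lra).
  assert (0 < t * (P * m)) by (now apply Rmult_lt_0_compat).
  assert (0 < t * (Q * m)) by (now apply Rmult_lt_0_compat).
  assert (0 < t * (d * m)) by (apply Rmult_lt_0_compat; [assumption|now apply Rmult_lt_0_compat]).
  assert (EL : L * (Q * m) = P * m) by (unfold P; ring).
  apply Rmult_le_compat; try lra.
  - apply Rmult_le_pos; [lra|]. assert (0 <= L * ((1 - t) * Q * m + (2 + t) * Q * m + 1)) by (apply Rmult_le_pos; lra). lra.
  - apply Rmult_le_compat; try lra.
Qed.

(** The converse of [plank_up]: a point of [(1/M) Z^3] in a slightly smaller box is moved to a
    lattice point of the plank, and each lattice point is reached at most once from every residue
    class. *)
Lemma plank_low (Q L d x0 al be t rho n : R) : 0 < Q -> 0 < L -> 0 < d -> 0 < t <= / 20 ->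
  5 * t * d <= 2 * rho ->
  covers Q (Q * L) d x0 al be t ->
  atmost (plank Q L x0 al be rho) n ->
  Q * (Q * L) * (3 / 2 - 9 * t) * (2 * rho - 5 * t * d) <= n.
Proof.
  intros HQ HL Hd Ht Hrho H Hn.
  set (P := Q * L) in *. assert (HP : 0 < P) by (now apply Rmult_lt_0_compat).
  destruct (scale_exists (t * Q) (t * P) (t * d)) as [M [HM [M1 [M2 M3]]]];
    try (now apply Rmult_lt_0_compat).
  destruct (coset_reps Q P d x0 al be t M HQ HP Hd ltac:(lra) HM H) as [s Hs].
  set (m := INR M) in *. set (MZ := Z.of_nat M) in *.
  assert (EM : IZR MZ = m) by (unfold MZ, m; now rewrite INR_IZR_INZ).
  assert (Hm : 0 < m) by (unfold m; now apply lt_0_INR).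
  assert (HMZ : (0 < MZ)%Z) by (unfold MZ; lia).
  (* The thickness is reduced by [2 * t * d], although points move by [t * d] only, to reach the
     strict inequality of [plank]. The upper limit for [a] drops by [2 * t * P * m] since moving [q]
     also moves the endpoint [L * q]. *)
  set (fine := box x0 al be ((1 + t) * Q * m) ((2 - t) * Q * m) L (t * P * m)
    (- 2 * t * P * m) ((rho - 2 * t * d) * m)).
  assert (Hlen : INR (length fine) <= n * m ^ 3).
  { assert (Hat : atmost (fun w => In w fine) (n * m ^ 3)).
    { apply atmost_rel with (K := plank Q L x0 al be rho)
        (rel := fun z w => padd (quo MZ w) (s (red MZ w)) = z).
      - intros w Hw. eexists. split; [|reflexivity].
        apply box_in in Hw. destruct (Hs (red MZ w)) as [S1 [S2 S3]].
        pose proof (red_quo MZ w HMZ) as Ew.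
        set (r := red MZ w) in *. set (k := quo MZ w) in *. clearbody r k. subst w.
        unfold padd, dil in Hw; cbn [pq pa pb] in Hw. unfold plank, padd; cbn [pq pa pb].
        replace (pq r + MZ * pq k)%Z with ((pq r - MZ * pq (s r)) + MZ * (pq k + pq (s r)))%Z in Hw by ring.
        replace (pa r + MZ * pa k)%Z with ((pa r - MZ * pa (s r)) + MZ * (pa k + pa (s r)))%Z in Hw by ring.
        replace (pb r + MZ * pb k)%Z with ((pb r - MZ * pb (s r)) + MZ * (pb k + pb (s r)))%Z in Hw by ring.
        set (zq := (pq k + pq (s r))%Z) in *. set (za := (pa k + pa (s r))%Z) in *.
        set (zb := (pb k + pb (s r))%Z) in *.
        set (rq := (pq r - MZ * pq (s r))%Z) in *. set (ra := (pa r - MZ * pa (s r))%Z) in *.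
        set (rb := (pb r - MZ * pb (s r))%Z) in *.
        rewrite !plus_IZR, !mult_IZR, EM in Hw.
        destruct Hw as [W1 [W2 W3]]. apply Rabs_le_between in S1, S2, S3.
        set (q1 := IZR rq) in *. set (a1 := IZR ra) in *. set (b1 := IZR rb) in *.
        set (q := IZR zq) in *. set (a := IZR za) in *. set (b := IZR zb) in *.
        assert (Ltq : L * q1 <= L * (t * Q * m)) by (apply Rmult_le_compat_l; lra).
        assert (EP : t * P * m = L * (t * Q * m)) by (unfold P; ring).
        assert (0 < t * d * m) by (apply Rmult_lt_0_compat; [apply Rmult_lt_0_compat; lra|lra]).
        split; [split|split; [split|]].
        + apply Rmult_lt_reg_l with m; [assumption|]. lra.
        + apply Rmult_le_reg_l with m; [assumption|]. lra.
        + apply Rmult_lt_reg_l with m; [assumption|]. lra.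
        + apply Rmult_le_reg_l with m; [assumption|]. lra.
        + apply Rabs_lt_between. split; apply Rmult_lt_reg_l with m; try assumption; lra.
      - assumption.
      - apply pow_le. lra.
      - intros z _ l Hl Hx. unfold m. rewrite <- residues_length.
        apply (atmost_inj (red MZ) (fun r => In r (residues M))); auto.
        + intros w w' Hw Hw' E. destruct (Hx w Hw) as [_ E1]. destruct (Hx w' Hw') as [_ E2].
          rewrite (red_quo MZ w HMZ), (red_quo MZ w' HMZ), E.
          rewrite <- E2, E in E1. unfold padd in E1. injection E1 as F1 F2 F3.
          assert (quo MZ w = quo MZ w') as ->; [|reflexivity].
          apply pt_eq; unfold quo; cbn [pq pa pb]; lia.
        + intros w _. apply residues_in. unfold red; cbn [pq pa pb].
          repeat split; apply Z.mod_pos_bound; assumption.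
        + intros l' Hl' Hx'. apply le_INR. now apply NoDup_incl_length. }
    apply Hat; [apply box_nodup|auto]. }
  assert (0 < Q * m) by (now apply Rmult_lt_0_compat).
  assert (0 < P * m) by (now apply Rmult_lt_0_compat).
  assert (0 < t * (P * m)) by (now apply Rmult_lt_0_compat).
  assert (0 < t * (Q * m)) by (now apply Rmult_lt_0_compat).
  assert (0 < t * (d * m)) by (apply Rmult_lt_0_compat; [lra|now apply Rmult_lt_0_compat]).
  assert (EL : L * (Q * m) = P * m) by (unfold P; ring).
  assert (0 <= (2 * rho - 5 * t * d) * m) by (apply Rmult_le_pos; lra).
  assert (HtQ : t * (Q * m) <= / 20 * (Q * m)) by (apply Rmult_le_compat_r; lra).
  assert (Hbox : (2 * ((rho - 2 * t * d) * m) - 1) *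
    (L * (((2 - t) * Q * m - (1 + t) * Q * m - 1) * ((1 + t) * Q * m + (2 - t) * Q * m - 1) / 2)
     - (t * P * m - - 2 * t * P * m + 1) * ((2 - t) * Q * m - (1 + t) * Q * m + 1))
    <= INR (length fine)).
  { apply box_low; lra. }
  apply Rmult_le_reg_r with (m ^ 3); [apply pow_lt; assumption|].
  apply Rle_trans with (2 := Hlen). apply Rle_trans with (2 := Hbox).
  replace (Q * P * (3 / 2 - 9 * t) * (2 * rho - 5 * t * d) * m ^ 3)
    with ((2 * rho - 5 * t * d) * m * ((3 / 2 - 9 * t) * ((Q * m) * (P * m)))) by ring.
  set (X := Q * m) in *. set (Y := P * m) in *.
  assert (HXY : 0 < X * Y) by (now apply Rmult_lt_0_compat).
  apply Rmult_le_compat; try lra.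
  - apply Rmult_le_pos; lra.
  - assert (E1 : L * (X * X) = X * Y) by (rewrite <- EL; ring).
    assert (E2 : L * ((1 - 3 * t) * X * ((3 - t) * X)) <=
      L * (((2 - t) * Q * m - (1 + t) * Q * m - 1) * ((1 + t) * Q * m + (2 - t) * Q * m - 1))).
    { apply Rmult_le_compat_l; [lra|]. unfold X in *.
      apply Rmult_le_compat; try lra; apply Rmult_le_pos; lra. }
    assert (E3 : (t * P * m - - 2 * t * P * m + 1) * ((2 - t) * Q * m - (1 + t) * Q * m + 1)
      <= (4 * t * Y) * (1 * X)).
    { unfold X, Y in *. apply Rmult_le_compat; lra. }
    assert (E4 : L * ((1 - 3 * t) * X * ((3 - t) * X)) = (1 - 3 * t) * (3 - t) * (X * Y))
      by (rewrite <- E1; ring).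
    assert (0 <= t * t * (X * Y)) by (apply Rmult_le_pos; nra).
    nra.
Qed.

(** * Arcs and nearly tangent lines *)

Definition sector (Q x0 L : R) (z : pt) : Prop :=
  Q < IZR (pq z) <= 2 * Q /\ 0 < IZR (pa z) - x0 * IZR (pq z) <= L * IZR (pq z).

Lemma sector_xc (Q x0 L : R) (z : pt) : 0 < Q -> sector Q x0 L z ->
  (0 < pq z)%Z /\ x0 < xc z <= x0 + L.
Proof.
  intros HQ [Hq Ha]. assert (Hz : (0 < pq z)%Z) by (apply lt_IZR; lra).
  split; [assumption|]. rewrite pa_xc in Ha by assumption. nra.
Qed.

(* The points are sorted according to their cross product with a fixed primitive vector. *)
Lemma sector_line (Q x0 L : R) (l : pt) (P : pt -> Prop) (z1 : pt) : 0 < Q -> 0 <= L ->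
  prim l -> (0 < pq l)%Z -> (forall z, P z -> sector Q x0 L z /\ inc l z = 0%Z) -> P z1 ->
  (exists v d, (0 < d)%Z /\ prim v /\ (0 < pq v)%Z /\ z1 = dil d v /\
     atmost P (3 * Q / IZR (pq v))) \/
  atmost P (24 * Q ^ 2 * L / IZR (pq l)).
Proof.
  intros HQ HL Pl Hl H HP1.
  assert (Hh : 1 <= IZR (pq l)) by (apply IZR_le; lia). set (h := IZR (pq l)) in *.
  destruct (H z1 HP1) as [S1 I1]. destruct (sector_xc Q x0 L z1 HQ S1) as [Q1 X1].
  destruct (prim_part z1) as [d [v [Hd [Pv Ev]]]].
  { intros E. rewrite E in Q1. simpl in Q1. lia. }
  assert (Hv : (0 < pq v)%Z) by (rewrite Ev in Q1; cbn [pq dil] in Q1; nia).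
  assert (Hxv : xc v = xc z1).
  { rewrite Ev. unfold xc, dil; cbn [pq pa]. rewrite !mult_IZR.
    apply IZR_lt in Hv, Hd. field. lra. }
  assert (Iv : inc l v = 0%Z).
  { rewrite Ev in I1. replace (inc l (dil d v)) with (d * inc l v)%Z in I1
      by (unfold inc, dil; cbn [pq pa pb]; ring).
    apply Z.mul_eq_0 in I1. lia. }
  assert (Hq0 : 1 <= IZR (pq v)) by (apply IZR_le; lia).
  assert (Hq0Q : IZR (pq v) <= 2 * Q).
  { destruct S1 as [[_ S1] _]. apply Rle_trans with (2 := S1). rewrite Ev. cbn [pq dil].
    apply IZR_le. nia. }
  set (q0 := IZR (pq v)) in *.
  assert (Hn : forall z, P z -> exists n, cross v z = dil n l).
  { intros z Hz. destruct (H z Hz) as [_ Iz]. now apply (cross_on_line l v z). }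
  set (ind := fun z => epsilon (inhabits 0%Z) (fun n => cross v z = dil n l)).
  assert (Hi : forall z, P z -> cross v z = dil (ind z) l).
  { intros z Hz. unfold ind. apply epsilon_spec. auto. }
  (* Points with equal index differ by multiples of [v], so their denominators are spaced by
     [q0]. *)
  assert (Hfib : forall n, atmost (fun z => P z /\ ind z = n) (3 * Q / q0)).
  { intros n. apply atmost_sub with (P' := fun z => P z /\ ind z = n) (n' := Q / q0 + 1);
      [auto| |].
    - assert (1 <= 2 * Q / q0).
      { apply Rmult_le_reg_r with q0; [lra|].
        replace (2 * Q / q0 * q0) with (2 * Q) by (field; lra). lra. }
      replace (3 * Q / q0) with (Q / q0 + 2 * Q / q0) by (field; lra). lra.
    - apply atmost_spaced with (phi := fun z => IZR (pq z)); [lra|lra|].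
      intros z w [Hz Ez] [Hw Ew] Hne.
      destruct (H z Hz) as [[Qz _] _]. destruct (H w Hw) as [[Qw _] _]. split.
      + destruct (prim_parallel v (psub z w) Pv) as [m Em].
        { pose proof (Hi z Hz) as C1. pose proof (Hi w Hw) as C2. rewrite Ez in C1.
          rewrite Ew, <- C1 in C2. unfold cross in C2. injection C2 as C3 C4 C5.
          unfold cross, psub; cbn [pq pa pb]. f_equal; lia. }
        assert (Hm : m <> 0%Z).
        { intros ->. apply Hne. unfold psub, dil in Em. injection Em as M1 M2 M3.
          apply pt_eq; lia. }
        rewrite <- minus_IZR. replace (pq z - pq w)%Z with (m * pq v)%Z
          by (change (pq z - pq w)%Z with (pq (psub z w)); rewrite Em; reflexivity).
        rewrite mult_IZR, Rabs_mult, (Rabs_pos_eq (IZR (pq v))) by (unfold q0 in *; lra).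
        assert (1 <= Rabs (IZR m)) by (rewrite <- abs_IZR; apply IZR_le; lia).
        fold q0. nra.
      + apply Rabs_le_between. lra. }
  (* A nonzero index forces [1 <= B], so the [2 * B + 2] possible indices are at most [4 * B]. If
     all indices vanish, the points are multiples of [v] and only the fiber bound remains. *)
  destruct (excluded_middle_informative (exists z, P z /\ ind z <> 0%Z)) as [[z2 [Hz2 Hn2]]|Hall].
  - right. set (B := 2 * Q * q0 * L / h).
    assert (HB : forall z, P z -> Rabs (IZR (ind z)) <= B).
    { intros z Hz. destruct (H z Hz) as [Sz Iz].
      destruct (sector_xc Q x0 L z HQ Sz) as [Qz Xz].
      pose proof (f_equal (fun p => Rabs (IZR (pq p))) (Hi z Hz)) as E. cbv beta in E.
      rewrite cross_h in E by assumption. cbn [pq dil] in E. rewrite mult_IZR in E.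
      rewrite !Rabs_mult in E. fold h q0 in E. destruct Sz as [Sz _].
      rewrite (Rabs_pos_eq h), (Rabs_pos_eq q0), (Rabs_pos_eq (IZR (pq z))) in E by lra.
      apply Rmult_le_reg_r with h; [lra|]. rewrite <- E.
      unfold B. replace (2 * Q * q0 * L / h * h) with (q0 * (2 * Q) * L) by (field; lra).
      apply Rmult_le_compat; [nra|apply Rabs_pos|nra|]. apply Rabs_le_between. lra. }
    assert (HB1 : 1 <= B).
    { apply Rle_trans with (2 := HB z2 Hz2). rewrite <- abs_IZR. apply IZR_le. lia. }
    assert (H3 : 0 <= 3 * Q / q0).
    { apply Rdiv_nonneg; lra. }
    apply atmost_sub with (P' := P) (n' := (B - (- B - 1) + 1) * (3 * Q / q0)); [auto| |].
    + replace (24 * Q ^ 2 * L / h) with (4 * B * (3 * Q / q0))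
        by (unfold B; field; lra).
      apply Rmult_le_compat_r; [assumption|].
      lra.
    + apply atmost_rel with (K := fun n => - B - 1 < IZR n <= B) (rel := fun n z => ind z = n).
      * intros z Hz. exists (ind z). split; [|reflexivity].
        pose proof (HB z Hz) as b. apply Rabs_le_between in b. lra.
      * apply atmost_zint. lra.
      * assumption.
      * intros n _. apply Hfib.
  - left. exists v, d. repeat split; auto. fold q0.
    apply atmost_sub with (3 := Hfib 0%Z); [|lra].
    intros z Hz. split; [assumption|]. apply NNPP. intros h'. apply Hall. now exists z.
Qed.

(** By [cvx_sublevel], on each side of the minimizer the set [Rabs (F x) <= e] fits in an interval
    of length [2 * sqrt e / c], using [c <= 1]; this gives [w + 2] arcs per side. *)
Lemma arcs_near (c e eta L : R) (F G : R -> R) : cvx c F G -> 0 < L -> 0 <= e ->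
  atmost (fun i : nat => exists x, eta + INR i * L <= x <= eta + (INR i + 1) * L /\
    Rabs (F x) <= e) (4 * sqrt e / (c * L) + 4).
Proof.
  intros H HL He. pose proof (cvx_pos c F G H) as Hc.
  destruct (cvx_grad_surj c F G 0 H) as [x0 Hx0].
  set (w := 2 * sqrt e / (c * L)).
  assert (Hw : 0 <= w).
  { apply Rmult_le_pos; [pose proof (sqrt_pos e); lra|].
    left. apply Rinv_0_lt_compat. nra. }
  assert (Hone : forall s, s = 1 \/ s = -1 -> atmost (fun i : nat =>
    exists x, 0 <= s * (x - x0) /\ eta + INR i * L <= x <= eta + (INR i + 1) * L /\
      Rabs (F x) <= e) ((w + 1) / 1 + 1)).
  { intros s Hs. apply atmost_spaced with (phi := INR); [lra|lra|].
    intros i j [x [Sx [Ix Fx]]] [y [Sy [Jy Fy]]] Hne. split.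
    - rewrite !INR_IZR_INZ, <- minus_IZR, <- abs_IZR. apply IZR_le. lia.
    - assert (Hxy : 0 <= (x - x0) * (y - x0)) by (destruct Hs; subst s; nra).
      pose proof (cvx_sublevel c F G x0 x y e H Hx0 Hxy Fx Fy) as K.
      assert (K2 : Rabs (y - x) <= w * L).
      { apply Rabs_le_of_sq; [nra|]. unfold w.
        replace ((2 * sqrt e / (c * L) * L) ^ 2) with (4 * (sqrt e * sqrt e) / (c * c))
          by (field; lra).
        rewrite sqrt_sqrt by assumption.
        apply Rmult_le_reg_l with (c * c); [nra|].
        replace (c * c * (4 * e / (c * c))) with (4 * e) by (field; lra).
        pose proof (pow2_ge_0 (y - x)). nra. }
      apply Rabs_le_between in K2. apply Rabs_le_between.
      split; apply Rmult_le_reg_r with L; try assumption; lra. }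
  apply atmost_sub with (P' := fun i : nat => exists x,
    eta + INR i * L <= x <= eta + (INR i + 1) * L /\ Rabs (F x) <= e)
    (n' := ((w + 1) / 1 + 1) + ((w + 1) / 1 + 1)); [auto| |].
  - unfold w. right. field. lra.
  - apply atmost_union with (2 := Hone 1 (or_introl eq_refl))
      (3 := Hone (-1) (or_intror eq_refl)).
    intros i [x Hx]. destruct (Rle_dec 0 (x - x0)); [left|right]; exists x; split;
      try assumption; lra.
Qed.

(** The layer between [4 ^ s] and [4 ^ S s] contributes at most [2 * B / 2 ^ s], so the sum
    converges: the number of elements grows only like the square root of [y]. *)
Lemma dyadic_sum {A : Type} (y : A -> R) (B : R) (l : list A) : NoDup l -> 
  (forall x, In x l -> 1 <= y x) ->
  (forall s : nat, atmost (fun x => In x l /\ y x <= 4 ^ s) (B * 2 ^ s)) ->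
  lsum (fun x => / y x) l <= 5 * B.
Proof.
  intros Hl Hy H.
  assert (HB : 0 <= B).
  { pose proof (atmost_nonneg _ _ (H 0%nat)) as h. simpl in h. lra. }
  assert (G : forall s : nat, lsum (fun x => / y x) (sel (fun x => y x <= 4 ^ s) l)
    <= B * (5 - 4 * / 2 ^ s)).
  { induction s as [|s IH].
    - apply Rle_trans with (lsum (fun _ => 1) (sel (fun x => y x <= 4 ^ 0) l)).
      + apply lsum_le. intros x Hx. apply sel_in in Hx. destruct Hx as [Hx _].
        rewrite <- Rinv_1. apply Rinv_le_contravar; [lra|auto].
      + rewrite <- length_lsum. simpl. rewrite Rinv_1.
        pose proof (H 0%nat (sel (fun x => y x <= 4 ^ 0) l)) as h. simpl in h.
        replace (B * (5 - 4 * 1)) with (B * 1) by ring. apply h.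
        * now apply sel_nodup.
        * intros x Hx. now apply sel_in in Hx.
    - assert (H2 : 0 < 2 ^ s) by (apply pow_lt; lra).
      assert (E4 : 4 ^ s = 2 ^ s * 2 ^ s) by (rewrite <- Rpow_mult_distr; f_equal; lra).
      apply Rle_trans with (lsum (fun x => / y x) (sel (fun x => y x <= 4 ^ s) l) +
        lsum (fun _ => / 4 ^ s) (sel (fun x => y x <= 4 ^ S s) l)).
      + rewrite !lsum_sel, <- lsum_plus. apply lsum_le. intros x Hx.
        pose proof (Hy x Hx). assert (H4 : 0 < 4 ^ s) by (apply pow_lt; lra).
        assert (0 < / 4 ^ s) by (now apply Rinv_0_lt_compat).
        unfold cdec. simpl. repeat destruct excluded_middle_informative; try lra.
        assert (/ y x <= / 4 ^ s) by (apply Rinv_le_contravar; lra). lra.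
      + rewrite lsum_const.
        assert (INR (length (sel (fun x => y x <= 4 ^ S s) l)) <= B * 2 ^ S s).
        { apply (H (S s)); [now apply sel_nodup|]. intros x Hx. now apply sel_in in Hx. }
        assert (/ 4 ^ s * INR (length (sel (fun x => y x <= 4 ^ S s) l)) <=
          / 4 ^ s * (B * 2 ^ S s)).
        { apply Rmult_le_compat_l; [|assumption]. left. apply Rinv_0_lt_compat, pow_lt. lra. }
        replace (/ 4 ^ s * (B * 2 ^ S s)) with (2 * B * / 2 ^ s) in H1
          by (rewrite E4; simpl; field; lra).
        replace (/ 2 ^ S s) with (/ 2 * / 2 ^ s) by (simpl; field; lra).
        set (t := / 2 ^ s) in *. lra. }
  assert (exists s : nat, forall x, In x l -> y x <= 4 ^ s) as [s Hs].
  { clear - l. induction l as [|x l [s IH]]; [exists 0%nat; intros x []|].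
    destruct (pow_large 4 (y x) ltac:(lra)) as [k Hk]. exists (k + s)%nat.
    rewrite pow_add.
    assert (1 <= 4 ^ k) by (apply pow_R1_Rle; lra). assert (1 <= 4 ^ s) by (apply pow_R1_Rle; lra).
    intros x' [<-|Hx]; [nra|]. specialize (IH x' Hx). nra. }
  apply Rle_trans with (B * (5 - 4 * / 2 ^ s)).
  - apply Rle_trans with (2 := G s). rewrite lsum_sel. apply lsum_le. intros x Hx.
    replace (cdec (y x <= 4 ^ s)) with true by (symmetry; apply <- cdec_true; auto). lra.
  - assert (0 < / 2 ^ s) by (apply Rinv_0_lt_compat, pow_lt; lra). nra.
Qed.

Lemma group_le {A B : Type} (key : A -> B) (F : A -> R) (W : B -> R) (l : list A) :
  (forall x, In x l -> lsum F (sel (fun x' => key x' = key x) l) <= W (key x)) ->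
  lsum F l <= lsum W (nodup ceq (map key l)).
Proof.
  intros H. rewrite (lsum_fibers key F l (nodup ceq (map key l))).
  - apply lsum_le. intros k Hk. apply nodup_In, in_map_iff in Hk.
    destruct Hk as [x [<- Hx]]. auto.
  - apply NoDup_nodup.
  - intros x Hx. apply nodup_In. now apply in_map.
Qed.

(* The constant 9600 in the normalization [R0 ^ 3 * (9600 / c ^ 2) = d * Q] is chosen so
   that the lines obtained satisfy [near]. *)
Lemma dual_near (c Q L d R0 x0 m : R) (f g fs gs : R -> R) (l : pt) : cvx c f g ->
  legendre f g fs gs ->
  1 <= R0 -> 0 < L -> 0 < d < 1 / 2 -> 0 < Q -> R0 ^ 3 * (9600 / c ^ 2) = d * Q ->
  d <= 4 * L ^ 2 * Q * R0 -> prim l -> (0 <= pq l)%Z -> 0 < m < 2 * R0 ->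
  (let v := dual Q (Q * L) d x0 (f x0 - g x0 * x0) (g x0) l in vdot v v = m ^ 2) ->
  near c fs l /\ Rabs (gs (xc l) - x0) <= 1 /\ IZR (pq l) <= Q /\ IZR (pq l) * d <= m /\
  IZR (pq l) * (Q * Rabs (f x0 - (xc l * x0 - yc l))) <= m.
Proof.
  intros H HLg HR HL Hd HQ HR3 HLd Pl Hl Hm Hdual. cbv zeta in Hdual.
  pose proof (cvx_pos c f g H) as Hc.
  unfold dual, vdot in Hdual; cbn [v1 v2 v3] in Hdual.
  replace (f x0 - g x0 * x0 + g x0 * x0) with (f x0) in Hdual by ring.
  set (h := IZR (pq l)) in *. set (j := IZR (pa l)) in *. set (k := IZR (pb l)) in *.
  set (t1 := Q * (h * f x0 - j * x0 + k)) in *.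
  set (t2 := Q * L * (h * g x0 - j)) in *. set (t3 := d * h) in *.
  assert (HC0 : 9600 <= 9600 / c ^ 2).
  { apply Rmult_le_reg_r with (c ^ 2); [nra|].
    replace (9600 / c ^ 2 * c ^ 2) with 9600 by (field; lra). nra. }
  set (C0 := 9600 / c ^ 2) in *.
  assert (HR23 : R0 <= R0 ^ 3) by nra.
  assert (T : forall t, t * t <= m ^ 2 -> Rabs t <= m).
  { intros t Ht. apply Rabs_le_of_sq; nra. }
  assert (T1 : Rabs t1 <= m) by (apply T; nra).
  assert (T2 : Rabs t2 <= m) by (apply T; nra).
  assert (T3 : Rabs t3 <= m) by (apply T; nra).
  assert (HQR : 2 * R0 < Q).
  { assert (9600 * R0 ^ 3 <= R0 ^ 3 * C0) by nra. nra. }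
  assert (HdQ : 2 * R0 <= d * Q) by nra.
  (* The hypotheses give [C0 * R0 ^ 2 <= 4 * (Q * L) ^ 2], so the second coordinate, below [2 * R0],
     leaves [e ^ 2 <= 16 / C0], less than [(c / 24) ^ 2]. *)
  assert (HG : Rabs (h * g x0 - j) <= c / 24).
  { apply Rabs_le_of_sq; [lra|].
    set (e := h * g x0 - j) in *.
    assert (HP : C0 * R0 ^ 2 <= 4 * (Q * L) ^ 2).
    { apply Rmult_le_reg_r with R0; [lra|].
      replace (C0 * R0 ^ 2 * R0) with (R0 ^ 3 * C0) by ring. rewrite HR3.
      assert (d * Q <= 4 * L ^ 2 * Q * R0 * Q) by (apply Rmult_le_compat_r; lra). nra. }
    assert (t2 * t2 <= 4 * R0 ^ 2) by nra.
    replace (t2 * t2) with ((Q * L) ^ 2 * e ^ 2) in H0 by (unfold t2, e; ring).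
    assert (C0 * R0 ^ 2 * e ^ 2 <= 4 * (Q * L) ^ 2 * e ^ 2)
      by (apply Rmult_le_compat_r; [apply pow2_ge_0|assumption]).
    assert (C0 * e ^ 2 <= 16).
    { apply Rmult_le_reg_r with (R0 ^ 2); [nra|]. nra. }
    apply Rmult_le_reg_l with C0; [lra|]. apply Rle_trans with (1 := H2).
    unfold C0. replace (9600 / c ^ 2 * (c / 24) ^ 2) with (50 / 3) by (field; lra). lra. }
  (* With [h = 0] the integers [j] and [k] would be less than [1] in absolute value, and [l] would
     be zero. *)
  assert (Hl1 : (0 < pq l)%Z).
  { destruct (Z.eq_dec (pq l) 0) as [E|]; [exfalso|lia].
    assert (Eh : h = 0) by (unfold h; now rewrite E).
    assert (Ej : pa l = 0%Z).
    { apply Rabs_IZR_lt_1. fold j. rewrite Eh in HG.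
      replace (0 * g x0 - j) with (- j) in HG by ring. rewrite Rabs_Ropp in HG. lra. }
    assert (Ek : pb l = 0%Z).
    { apply Rabs_IZR_lt_1. fold k. unfold t1 in T1. rewrite Eh in T1. unfold j in T1.
      rewrite Ej in T1. replace (Q * (0 * f x0 - 0 * x0 + k)) with (Q * k) in T1 by ring.
      rewrite Rabs_mult, (Rabs_pos_eq Q) in T1 by lra.
      apply Rmult_lt_reg_l with Q; lra. }
    destruct Pl as [s1 [s2 [s3 Hs]]]. rewrite E, Ej, Ek in Hs. lia. }
  assert (Hh : 1 <= h) by (apply IZR_le; lia).
  assert (T3' : h * d <= m).
  { unfold t3 in T3. rewrite Rabs_pos_eq in T3 by nra. lra. }
  set (F := fun x => f x - (xc l * x - yc l)). set (G := fun x => g x - xc l).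
  assert (Ej : j = h * xc l) by (now apply pa_xc).
  assert (Ek : k = h * yc l) by (now apply pb_yc).
  assert (EF : t1 = h * (Q * F x0)) by (unfold t1, F; rewrite Ej, Ek; ring).
  assert (T1' : h * (Q * Rabs (F x0)) <= m).
  { rewrite EF, !Rabs_mult, (Rabs_pos_eq h), (Rabs_pos_eq Q) in T1 by lra. exact T1. }
  assert (HGx : Rabs (G x0) <= c / (24 * h)).
  { apply Rmult_le_reg_l with h; [lra|].
    replace (h * (c / (24 * h))) with (c / 24) by (field; lra).
    rewrite <- (Rabs_pos_eq h) at 1 by lra. rewrite <- Rabs_mult.
    replace (h * G x0) with (h * g x0 - j) by (unfold G; rewrite Ej; ring). exact HG. }
  assert (HhQ : h <= Q) by (apply Rmult_le_reg_r with d; lra).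
  (* Multiplying [h * Q * Rabs (F x0) <= m] by [h * d <= m] produces [d * Q], which is
     [R0 ^ 3 * C0], against [m ^ 2 <= 4 * R0 ^ 2]. *)
  assert (E2 : Rabs (F x0) <= c / (2400 * h ^ 2)).
  { apply Rmult_le_reg_l with (h * (Q * (h * d))).
    { repeat apply Rmult_lt_0_compat; lra. }
    apply Rle_trans with (m * m).
    - replace (h * (Q * (h * d)) * Rabs (F x0)) with (h * (Q * Rabs (F x0)) * (h * d)) by ring.
      apply Rmult_le_compat; try assumption; [|nra].
      apply Rmult_le_pos; [lra|]. apply Rmult_le_pos; [lra|apply Rabs_pos].
    - replace (h * (Q * (h * d)) * (c / (2400 * h ^ 2))) with (c / 2400 * (d * Q))
        by (field; lra).
      rewrite <- HR3. unfold C0.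
      replace (c / 2400 * (R0 ^ 3 * (9600 / c ^ 2))) with (4 * R0 ^ 3 * / c) by (field; lra).
      assert (1 <= / c) by (rewrite <- Rinv_1; apply Rinv_le_contravar; lra).
      assert (m * m <= 4 * R0 ^ 2) by nra.
      assert (4 * R0 ^ 2 <= 4 * R0 ^ 3) by nra.
      assert (4 * R0 ^ 3 * 1 <= 4 * R0 ^ 3 * / c) by (apply Rmult_le_compat_l; nra). lra. }
  destruct (tangent_near c x0 f g fs gs l H HLg Pl Hl1) as [Nl Xl]; [| |auto]; fold h.
  - apply Rle_trans with (1 := E2). apply Rmult_le_compat_l; [lra|].
    apply Rinv_le_contravar; nra.
  - apply Rle_trans with (1 := HGx). apply Rmult_le_compat_l; [lra|].
    apply Rinv_le_contravar; lra.
Qed.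

Definition arc (Q x0 L d : R) (f : R -> R) (z : pt) : Prop :=
  sector Q x0 L z /\ Rabs (IZR (pq z) * f (xc z) - IZR (pb z)) < d.

(** On the arc the curve rises above its tangent at [x0] by at most [L ^ 2 / (2 * c)], and the
    denominator is at most [2 * Q]. *)
Lemma sector_tangent (c Q x0 L d R0 : R) (f g : R -> R) (z : pt) : cvx c f g ->
  0 < Q -> 0 < L -> 0 < R0 -> L ^ 2 * Q * R0 <= d -> sector Q x0 L z ->
  0 <= IZR (pq z) * f (xc z) - (f x0 - g x0 * x0) * IZR (pq z) - g x0 * IZR (pa z)
    <= d / (c * R0).
Proof.
  intros H HQ HL HR Hd Hs. pose proof (cvx_pos c f g H) as Hc.
  destruct (sector_xc Q x0 L z HQ Hs) as [Hz Hx]. destruct Hs as [Hq _].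
  rewrite pa_xc by assumption.
  set (q := IZR (pq z)) in *. set (x := xc z) in *.
  replace (q * f x - (f x0 - g x0 * x0) * q - g x0 * (q * x))
    with (q * (f x - f x0 - g x0 * (x - x0))) by ring.
  destruct H as [_ H]. destruct (H x0 x) as [h1 h2].
  assert (0 <= c / 2 * (x - x0) ^ 2) by (apply Rmult_sq_nonneg; lra).
  split; [apply Rmult_le_pos; lra|].
  apply Rle_trans with (2 * Q * (/ (2 * c) * L ^ 2)).
  - apply Rmult_le_compat; try lra. apply Rle_trans with (1 := h2).
    apply Rmult_le_compat_l; [left; apply Rinv_0_lt_compat; lra|]. apply pow_incr. lra.
  - apply Rmult_le_reg_r with (c * R0); [nra|].
    replace (2 * Q * (/ (2 * c) * L ^ 2) * (c * R0)) with (L ^ 2 * Q * R0) by (field; lra).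
    replace (d / (c * R0) * (c * R0)) with d by (field; lra). assumption.
Qed.

(** The arc is squeezed between the planks of half thickness [d * (1 - s)] and [d * (1 + s)] around
    the tangent. The bound [t <= 8] allows the polynomials in [t] to be replaced by linear ones. *)
Lemma arc_count (c Q x0 L d R0 t : R) (f g : R -> R) (l : list pt) : cvx c f g ->
  0 < Q -> 0 < L -> 0 < d -> / c <= R0 -> L ^ 2 * Q * R0 <= d -> 0 < t <= 8 ->
  covers Q (Q * L) d x0 (f x0 - g x0 * x0) (g x0) t ->
  NoDup l -> (forall z, In z l <-> arc Q x0 L d f z) ->
  Rabs (INR (length l) - 3 * L * d * Q ^ 2) <= 3 * L * d * Q ^ 2 * (/ (c * R0) + 1400 * t).
Proof.
  intros H HQ HL Hd HR Hd2 Ht Hcov Hl Hin. pose proof (cvx_pos c f g H) as Hc.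
  pose proof (Rinv_ge_1 c Hc) as Hic.
  set (s := / (c * R0)).
  assert (HcR : 1 <= c * R0) by (apply Rinv_le_mult; lra).
  assert (Hs : 0 < s <= 1).
  { split; [apply Rinv_0_lt_compat; lra|]. unfold s. rewrite <- Rinv_1.
    apply Rinv_le_contravar; lra. }
  assert (Htan : forall z, sector Q x0 L z ->
    0 <= IZR (pq z) * f (xc z) - (f x0 - g x0 * x0) * IZR (pq z) - g x0 * IZR (pa z) <= d * s).
  { intros z Hz. apply (sector_tangent c Q x0 L d R0 f g); auto; lra. }
  set (W := Q * (Q * L)). assert (HW : 0 < W) by (repeat apply Rmult_lt_0_compat; lra).
  assert (HWd : 0 < W * d) by (now apply Rmult_lt_0_compat).
  replace (3 * L * d * Q ^ 2) with (3 * (W * d)) by (unfold W; ring).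
  assert (U : INR (length l) <= W * d * (3 + 3 * s + 4200 * t)).
  { apply Rle_trans with (W * (1 + 3 * t) * (3 / 2 + 5 * t) * (2 * (d * (1 + s)) + 3 * t * d)).
    - apply (plank_up Q L d x0 (f x0 - g x0 * x0) (g x0) t (d * (1 + s))); auto; try lra; try nra.
      intros z Hz. apply Hin in Hz. destruct Hz as [Sz Fz]. pose proof (Htan z Sz) as Tz.
      destruct Sz as [S1 S2]. split; [assumption|]. split; [assumption|].
      apply Rabs_lt_between in Fz. apply Rabs_lt_between. lra.
    - replace (W * (1 + 3 * t) * (3 / 2 + 5 * t) * (2 * (d * (1 + s)) + 3 * t * d))
        with (W * d * ((1 + 3 * t) * (3 / 2 + 5 * t) * (2 + 2 * s + 3 * t))) by ring.
      apply Rmult_le_compat_l; [lra|].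
      assert (E1 : (1 + 3 * t) * (3 / 2 + 5 * t) <= 3 / 2 + 130 * t) by nra.
      apply Rle_trans with ((3 / 2 + 130 * t) * (2 + 2 * s + 3 * t)).
      + apply Rmult_le_compat_r; lra.
      + assert (t * s <= t) by nra. assert (t * t <= 8 * t) by nra. nra. }
  assert (D : W * d * (3 - 3 * s - 90 * t) <= INR (length l)).
  (* In the remaining case [90 * t < 3], which gives the smallness of [t] required by
     [plank_low]. *)
  { destruct (Rle_dec (3 - 3 * s - 90 * t) 0) as [h|h].
    - apply Rle_trans with 0; [|apply pos_INR]. nra.
    - apply Rle_trans with (W * (3 / 2 - 9 * t) * (2 * (d * (1 - s)) - 5 * t * d)).
      + replace (W * (3 / 2 - 9 * t) * (2 * (d * (1 - s)) - 5 * t * d))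
          with (W * d * ((3 / 2 - 9 * t) * (2 - 2 * s - 5 * t))) by ring.
        apply Rmult_le_compat_l; [lra|]. nra.
      + apply (plank_low Q L d x0 (f x0 - g x0 * x0) (g x0) t (d * (1 - s))); auto; try lra; try nra.
        intros l' Hl' Hx'. apply le_INR. apply NoDup_incl_length; [assumption|].
        intros z Hz. apply Hin. destruct (Hx' z Hz) as [S1 [S2 S3]].
        assert (Sz : sector Q x0 L z) by (split; assumption).
        split; [assumption|]. pose proof (Htan z Sz) as Tz.
        apply Rabs_lt_between in S3. apply Rabs_lt_between. lra. }
  apply Rabs_le_between. split; nra.
Qed.

(** The integer [inc l z] is a scalar product, bounded by Cauchy-Schwarz by [m * sqrt 12 < 1]. This
    replaces [arc_count] when the covering radius is too large. *)
Lemma arc_on_plane (c Q x0 L d R0 m : R) (f g : R -> R) (l z : pt) : cvx c f g ->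
  0 < Q -> 0 < L -> 0 < d -> / c <= R0 -> L ^ 2 * Q * R0 <= d -> 0 < m < / 4 ->
  (let v := dual Q (Q * L) d x0 (f x0 - g x0 * x0) (g x0) l in vdot v v = m ^ 2) ->
  arc Q x0 L d f z -> inc l z = 0%Z.
Proof.
  intros H HQ HL Hd HR Hd2 Hm Hv [Sz Fz]. cbv zeta in Hv. pose proof (cvx_pos c f g H) as Hc.
  pose proof (Rinv_ge_1 c Hc) as Hic.
  assert (HcR : 1 <= c * R0) by (apply Rinv_le_mult; lra).
  pose proof (sector_tangent c Q x0 L d R0 f g z H HQ HL ltac:(lra) Hd2 Sz) as Tz.
  assert (d / (c * R0) <= d).
  { unfold Rdiv. rewrite <- (Rmult_1_r d) at 2. apply Rmult_le_compat_l; [lra|].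
    rewrite <- Rinv_1. apply Rinv_le_contravar; lra. }
  set (al := f x0 - g x0 * x0) in *. set (be := g x0) in *.
  assert (HP : 0 < Q * L) by (now apply Rmult_lt_0_compat).
  set (u := fpt Q (Q * L) d x0 al be z). set (v := dual Q (Q * L) d x0 al be l) in *.
  assert (G : forall x k b, 0 < k -> Rabs x <= b * k -> (x / k) * (x / k) <= b * b).
  { intros x k b Hk Hx. replace (x / k * (x / k)) with (Rabs x / k * (Rabs x / k)).
    - assert (0 <= Rabs x / k) by (apply Rmult_le_pos; [apply Rabs_pos|left; now apply Rinv_0_lt_compat]).
      assert (Rabs x / k <= b).
      { apply Rmult_le_reg_r with k; [assumption|]. unfold Rdiv.
        rewrite Rmult_assoc, Rinv_l by lra. lra. }
      apply Rmult_le_compat; lra.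
    - replace (Rabs x / k * (Rabs x / k)) with (Rabs x ^ 2 / k ^ 2) by (field; lra).
      rewrite pow2_abs. field. lra. }
  assert (Hu : vdot u u <= 12).
  { destruct Sz as [S1 S2]. unfold u, vdot, fpt, frm; cbn [v1 v2 v3].
    assert (U1 : Rabs (IZR (pq z)) <= 2 * Q) by (rewrite Rabs_pos_eq; lra).
    assert (U2 : Rabs (IZR (pa z) - x0 * IZR (pq z)) <= 2 * (Q * L))
      by (rewrite Rabs_pos_eq; nra).
    assert (U3 : Rabs (IZR (pb z) - al * IZR (pq z) - be * IZR (pa z)) <= 2 * d).
    { apply Rabs_lt_between in Fz. apply Rabs_le_between. lra. }
    apply G in U1; [|assumption]. apply G in U2; [|assumption]. apply G in U3; [|assumption].
    lra. }
  apply Rabs_IZR_lt_1. rewrite (inc_dual Q (Q * L) d x0 al be) by assumption. fold u v.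
  rewrite <- (Rabs_pos_eq 1) by lra. apply Rsqr_lt_abs_0. rewrite !Rsqr_pow2.
  pose proof (vdot_pos (vcross v u)) as CS. rewrite vcross_lagrange, Hv in CS.
  assert (m ^ 2 <= / 16) by nra.
  assert (m ^ 2 * vdot u u <= / 16 * 12).
  { apply Rmult_le_compat; [nra|apply vdot_pos|assumption|assumption]. }
  lra.
Qed.

(** For an arc whose points are collinear. In the second case [v] is a rational point close to the
    curve itself, with a different [v] on each arc; in the third the line comes within [d / Q] of
    the curve, which happens on few arcs. *)
Lemma arc_cases (Q x0 L d : R) (f : R -> R) (l : pt) (la : list pt) : 0 < Q -> 0 < L ->
  0 < d -> prim l -> (0 < pq l)%Z -> NoDup la -> (forall z, In z la <-> arc Q x0 L d f z) ->
  (forall z, arc Q x0 L d f z -> inc l z = 0%Z) ->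
  la = nil \/
  (exists v, prim v /\ (0 < pq v)%Z /\ x0 < xc v <= x0 + L /\ IZR (pq v) <= 2 * Q /\
     Rabs (IZR (pq v) * f (xc v) - IZR (pb v)) <= d * IZR (pq v) / Q /\
     INR (length la) <= 3 * Q / IZR (pq v)) \/
  (INR (length la) <= 24 * Q ^ 2 * L / IZR (pq l) /\
   exists x, x0 <= x <= x0 + L /\ Rabs (f x - (xc l * x - yc l)) <= d / Q).
Proof.
  intros HQ HL Hd Pl Hl Hla Hin Hinc. destruct la as [|z1 la']; [now left|right].
  remember (z1 :: la') as la.
  assert (A1 : arc Q x0 L d f z1) by (apply Hin; subst; now left).
  assert (S1 : sector Q x0 L z1) by apply A1.
  destruct (sector_xc Q x0 L z1 HQ S1) as [Q1 X1].
  destruct (sector_line Q x0 L l (arc Q x0 L d f) z1) as [[v [k [Hk [Pv [Hv [Ev Hat]]]]]]|Hat];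
    auto; [lra|intros z Hz; split; [apply Hz|auto]| |].
  - left. exists v.
    assert (Hxv : xc v = xc z1).
    { rewrite Ev. unfold xc, dil; cbn [pq pa]. rewrite !mult_IZR.
      apply IZR_lt in Hv, Hk. field. lra. }
    assert (Eq : IZR (pq z1) = IZR k * IZR (pq v)) by (rewrite Ev; cbn [pq dil]; apply mult_IZR).
    assert (Eb : IZR (pb z1) = IZR k * IZR (pb v)) by (rewrite Ev; cbn [pb dil]; apply mult_IZR).
    assert (Hk1 : 1 <= IZR k) by (apply IZR_le; lia).
    assert (Hv1 : 1 <= IZR (pq v)) by (apply IZR_le; lia).
    destruct S1 as [[S1 S1'] _]. rewrite Eq in S1, S1'.
    repeat split; try assumption; try (rewrite Hxv; apply X1).
    + nra.
    + destruct A1 as [_ A1]. rewrite Eq, Eb, <- Hxv in A1.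
      replace (IZR k * IZR (pq v) * f (xc v) - IZR k * IZR (pb v))
        with (IZR k * (IZR (pq v) * f (xc v) - IZR (pb v))) in A1 by ring.
      rewrite Rabs_mult, (Rabs_pos_eq (IZR k)) in A1 by lra.
      set (r := Rabs (IZR (pq v) * f (xc v) - IZR (pb v))) in *.
      assert (Hr : 0 <= r) by apply Rabs_pos.
      apply Rmult_le_reg_r with Q; [assumption|].
      replace (d * IZR (pq v) / Q * Q) with (d * IZR (pq v)) by (field; lra).
      assert (r * Q <= r * (IZR k * IZR (pq v))) by (apply Rmult_le_compat_l; lra).
      assert (IZR k * r * IZR (pq v) <= d * IZR (pq v)) by (apply Rmult_le_compat_r; lra).
      lra.
    + apply Hat; [assumption|]. intros z Hz. now apply Hin.
  - right. split; [apply Hat; [assumption|intros z Hz; now apply Hin]|].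
    exists (xc z1). split; [lra|]. rewrite <- inc_yc by auto.
    destruct A1 as [[[B1 _] _] A1]. rewrite pb_yc in A1 by assumption.
    set (q := IZR (pq z1)) in *.
    replace (q * f (xc z1) - q * yc z1) with (q * (f (xc z1) - yc z1)) in A1 by ring.
    rewrite Rabs_mult, (Rabs_pos_eq q) in A1 by lra.
    set (r := Rabs (f (xc z1) - yc z1)) in *. assert (0 <= r) by apply Rabs_pos.
    apply Rmult_le_reg_r with Q; [assumption|].
    replace (d / Q * Q) with d by (field; lra). nra.
Qed.

(** [l] and [m] form one pair so that [fun_choice] selects them for all arcs at once. Replacing [l]
    by its negative does not change the length and makes [pq l] nonnegative. *)
Lemma arc_dual (Q x0 L d al be : R) : 0 < Q -> 0 < L -> 0 < d ->
  exists lm : pt * R, let (l, m) := lm in prim l /\ (0 <= pq l)%Z /\ 0 < m /\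
    (let v := dual Q (Q * L) d x0 al be l in vdot v v = m ^ 2) /\
    covers Q (Q * L) d x0 al be (2 / m).
Proof.
  intros HQ HL Hd. assert (HP : 0 < Q * L) by (now apply Rmult_lt_0_compat).
  destruct (transference Q (Q * L) d x0 al be HQ HP Hd) as [l0 [Pl0 Hcov0]].
  assert (exists l, prim l /\ (0 <= pq l)%Z /\
    vdot (dual Q (Q * L) d x0 al be l) (dual Q (Q * L) d x0 al be l) =
    vdot (dual Q (Q * L) d x0 al be l0) (dual Q (Q * L) d x0 al be l0)) as [l [Pl [Hl El]]].
  { destruct (Z_le_gt_dec 0 (pq l0)) as [h|h]; [now exists l0|].
    exists (dil (-1) l0). split; [|split].
    - destruct Pl0 as [s1 [s2 [s3 Hs]]]. exists (- s1)%Z, (- s2)%Z, (- s3)%Z.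
      cbn [pq pa pb dil]. lia.
    - cbn [pq dil]. lia.
    - unfold dual, vdot, dil; cbn [v1 v2 v3 pq pa pb]. rewrite !mult_IZR. ring. }
  rewrite <- El in Hcov0. set (v := dual Q (Q * L) d x0 al be l) in *.
  assert (Hv : 0 < vdot v v).
  { destruct (dual_lower Q (Q * L) d x0 al be HQ HP Hd) as [k [Hk Hlow]].
    apply Rlt_le_trans with k; [assumption|]. apply Hlow. intros E. rewrite E in Pl.
    destruct Pl as [s1 [s2 [s3 Hs]]]. simpl in Hs. lia. }
  exists (l, sqrt (vdot v v)). cbv zeta. split; [assumption|]. split; [assumption|].
  split; [now apply sqrt_lt_R0|]. split; [rewrite pow2_sqrt; [reflexivity|lra]|].
  intros y. destruct (Hcov0 y) as [z Hz]. cbv zeta in Hz. exists z.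
  set (w := vsub y (fpt Q (Q * L) d x0 al be z)) in *.
  apply Rmult_le_reg_r with (vdot v v); [assumption|].
  apply Rle_trans with (1 := Hz). right.
  replace ((2 / sqrt (vdot v v)) ^ 2 * vdot v v)
    with (4 * vdot v v / (sqrt (vdot v v) * sqrt (vdot v v))).
  - rewrite sqrt_sqrt by lra. field. lra.
  - field. apply Rgt_not_eq. now apply sqrt_lt_R0.
Qed.

Lemma fun_choice {A B : Type} (P : A -> B -> Prop) :
  (forall x, exists y, P x y) -> exists F, forall x, P x (F x).
Proof.
  intros H. exists (fun x => proj1_sig (constructive_indefinite_description _ (H x))).
  intros x. exact (proj2_sig (constructive_indefinite_description _ (H x))).
Qed.

Lemma lsum_map {A B : Type} (phi : A -> B) (F : B -> R) (l : list A) :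
  lsum F (map phi l) = lsum (fun x => F (phi x)) l.
Proof. induction l as [|x l IH]; simpl; [reflexivity|now rewrite IH]. Qed.

(** * Summation over the arcs *)

Definition near_set (eta xi Q d : R) (f : R -> R) (z : pt) : Prop :=
  Q < IZR (pq z) <= 2 * Q /\ eta * IZR (pq z) < IZR (pa z) <= xi * IZR (pq z) /\
  Rabs (IZR (pq z) * f (xc z) - IZR (pb z)) < d.

Lemma arcs_partition (eta xi Q d L : R) (f : R -> R) (n : nat) (l : list pt) : 0 < Q ->
  0 < L -> eta + INR n * L = xi -> NoDup l ->
  (forall z, In z l <-> near_set eta xi Q d f z) ->
  exists la : nat -> list pt,
    (forall i, (i < n)%nat -> NoDup (la i) /\
       forall z, In z (la i) <-> arc Q (eta + INR i * L) L d f z) /\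
    INR (length l) = lsum (fun i => INR (length (la i))) (seq 0 n).
Proof.
  intros HQ HL En Hl Hin.
  (* [- Int_part (- y)] is the ceiling of [y]: the arcs are open on the left and closed on the
     right. *)
  set (idx := fun z => Z.to_nat (- Int_part (- ((xc z - eta) / L)) - 1)).
  assert (Hq : forall z, Q < IZR (pq z) -> (0 < pq z)%Z) by (intros; apply lt_IZR; lra).
  assert (Hidx : forall z (i : nat), INR i < (xc z - eta) / L <= INR i + 1 -> idx z = i).
  { intros z i Hi. unfold idx. set (y := (xc z - eta) / L) in *.
    pose proof (Int_part_bounds (- y)) as b. rewrite INR_IZR_INZ in Hi.
    assert (IZR (- Z.of_nat i - 1) <= - y) by (rewrite minus_IZR, opp_IZR; lra).
    apply Int_part_le in H.
    assert (IZR (Int_part (- y)) < IZR (- Z.of_nat i)) by (rewrite opp_IZR; lra).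
    apply lt_IZR in H0. lia. }
  assert (Hex : forall z, near_set eta xi Q d f z ->
    exists i, (i < n)%nat /\ INR i < (xc z - eta) / L <= INR i + 1).
  { intros z [Qz [Az _]]. rewrite pa_xc in Az by (apply Hq; lra).
    assert (Hx : eta < xc z <= xi) by nra.
    set (y := (xc z - eta) / L).
    assert (Hy : 0 < y <= INR n).
    { unfold y. split.
      - apply Rdiv_lt_0_compat; lra.
      - apply Rmult_le_reg_r with L; [assumption|].
        replace ((xc z - eta) / L * L) with (xc z - eta) by (field; lra). lra. }
    pose proof (Int_part_bounds (- y)) as b.
    assert (HI : (Int_part (- y) < 0)%Z) by (apply lt_IZR; lra).
    exists (Z.to_nat (- Int_part (- y) - 1)).
    assert (E : INR (Z.to_nat (- Int_part (- y) - 1)) = - IZR (Int_part (- y)) - 1).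
    { rewrite INR_IZR_INZ, Z2Nat.id by lia. rewrite minus_IZR, opp_IZR. ring. }
    split; [|rewrite E; lra].
    apply INR_lt. rewrite E. lra. }
  exists (fun i => sel (fun z => idx z = i) l). split.
  - intros i Hi. split; [now apply sel_nodup|]. intros z. rewrite sel_in, Hin.
    assert (EL : forall u v, u < (xc z - eta) / L <= v <->
      eta + u * L < xc z <= eta + v * L).
    { intros u v. set (y := (xc z - eta) / L).
      replace (xc z) with (eta + y * L) by (unfold y; field; lra).
      split; intros [h1 h2]; split; nra. }
    split.
    + intros [Hz Ei]. destruct (Hex z Hz) as [i' [Hi' Hy]].
      rewrite (Hidx z i' Hy) in Ei. subst i'.
      destruct Hz as [Qz [Az Fz]]. split; [|assumption]. split; [assumption|].
      apply EL in Hy. rewrite pa_xc by (apply Hq; lra). split; nra.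
    + intros [Sz Fz]. destruct (sector_xc Q _ L z HQ Sz) as [Qz Xz].
      assert (Hy : INR i < (xc z - eta) / L <= INR i + 1) by (apply EL; lra).
      split; [|now apply Hidx]. destruct Sz as [Bz _]. split; [assumption|].
      split; [|assumption]. rewrite pa_xc by assumption.
      assert (INR i + 1 <= INR n) by (rewrite <- S_INR; apply le_INR; lia).
      assert (0 <= INR i) by apply pos_INR.
      assert (xc z <= xi) by nra. assert (eta < xc z) by nra. split; nra.
  - rewrite length_lsum, (lsum_fibers idx _ l (seq 0 n)).
    + apply lsum_ext. intros i _. symmetry. apply length_lsum.
    + apply seq_NoDup.
    + intros z Hz. apply Hin in Hz. destruct (Hex z Hz) as [i [Hi Hy]].
      rewrite (Hidx z i Hy). apply in_seq. lia.
Qed.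

Lemma sqrt_le_of_sq (x y : R) : 0 <= y -> x <= y ^ 2 -> sqrt x <= y.
Proof.
  intros Hy H. rewrite <- (sqrt_pow2 y) by assumption. now apply sqrt_le_1_alt.
Qed.

(** The term [Q * R0 ^ 2] collects the tangent error, the arcs with [m >= 2 * R0] and the rays of
    large denominator; [Q * R0 * S0 * Gs] the arcs with [m < 2 * R0] and the points on lines;
    [Q * Gs] the rays of small denominator. *)
Lemma count_bound (c Q d R0 S0 Gs eta xi L : R) (f g fs gs : R -> R) (n : nat)
  (l1 : list pt) : cvx c f g ->
  legendre f g fs gs ->
  0 < L -> eta + INR n * L = xi -> / c <= R0 -> 0 <= S0 -> S0 ^ 2 = R0 ->
  0 < d < 1 / 2 -> 0 < Q ->
  R0 ^ 3 * (9600 / c ^ 2) = d * Q -> L ^ 2 * Q * R0 <= d <= 4 * L ^ 2 * Q * R0 ->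
  (forall l, NoDup l -> (forall z, In z l -> near c fs z /\
      g (eta - 1) <= xc z <= g (xi + 1) /\ IZR (pq z) <= Q) ->
      lsum (fun z => / IZR (pq z)) l <= Gs) ->
  (forall l, NoDup l -> (forall z, In z l -> near c f z /\
      eta <= xc z <= xi /\ IZR (pq z) <= 2 * Q) ->
      lsum (fun z => / IZR (pq z)) l <= Gs) ->
  NoDup l1 -> (forall z, In z l1 <-> near_set eta xi Q d f z) ->
  Rabs (INR (length l1) - 3 * (xi - eta) * d * Q ^ 2) <=
    (xi - eta) * (5 * 10 ^ 7 / c ^ 3) * (Q * R0 ^ 2) +
    (10 ^ 8 / c ^ 2) * (Q * R0 * S0 * Gs) + 3 * (Q * Gs).
Proof.
  intros H HLg HL En HR HS0 ES Hd HQ HR3 HLd HG1 HG2 Hl1 Hin.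
  pose proof (cvx_pos c f g H) as Hc.
  pose proof (Rinv_ge_1 c Hc) as Hic.
  assert (HR1 : 1 <= R0) by lra.
  assert (HS1 : 1 <= S0) by nra.
  assert (HG0 : 0 <= Gs) by (apply (HG1 nil); [constructor|intros z []]).
  assert (HcR : 1 <= c * R0) by (apply Rinv_le_mult; lra).
  destruct (arcs_partition eta xi Q d L f n l1 HQ HL En Hl1 Hin) as [la [Hla Hsum]].
  set (x := fun i => eta + INR i * L).
  assert (Hxi : forall i, (i < n)%nat -> eta <= x i /\ x i + L <= xi).
  { intros i Hi. unfold x. assert (0 <= INR i) by apply pos_INR.
    assert (INR i + 1 <= INR n) by (rewrite <- S_INR; apply le_INR; lia).
    split; nra. }
  destruct (fun_choice _ (fun i => arc_dual Q (x i) L d (f (x i) - g (x i) * x i) (g (x i))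
    HQ HL (proj1 Hd))) as [lm Hlm].
  set (l := fun i => fst (lm i)). set (m := fun i => snd (lm i)).
  assert (Hlm' : forall i, prim (l i) /\ (0 <= pq (l i))%Z /\ 0 < m i /\
    (let v := dual Q (Q * L) d (x i) (f (x i) - g (x i) * x i) (g (x i)) (l i)
     in vdot v v = m i ^ 2) /\
    covers Q (Q * L) d (x i) (f (x i) - g (x i) * x i) (g (x i)) (2 / m i)).
  { intros i. specialize (Hlm i). unfold l, m. destruct (lm i) as [l' m']. exact Hlm. }
  clear Hlm. set (N := fun i => INR (length (la i))) in *.
  set (V := 3 * L * d * Q ^ 2).
  assert (HV : 0 < V).
  { unfold V. apply Rmult_lt_0_compat; [|nra]. apply Rmult_lt_0_compat; lra. }
  set (F := fun p y => f y - (xc p * y - yc p)).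
  assert (Hdual : forall i, m i < 2 * R0 -> near c fs (l i) /\
    Rabs (gs (xc (l i)) - x i) <= 1 /\ IZR (pq (l i)) <= Q /\ IZR (pq (l i)) * d <= m i /\
    IZR (pq (l i)) * (Q * Rabs (F (l i) (x i))) <= m i).
  { intros i Hi. destruct (Hlm' i) as [Pl [Hl [Hm [Hv _]]]].
    apply (dual_near c Q L d R0 (x i) (m i) f g fs gs (l i)); auto; lra. }
  set (ray := fun i v => prim v /\ (0 < pq v)%Z /\ x i < xc v <= x i + L /\
    IZR (pq v) <= 2 * Q /\ Rabs (IZR (pq v) * f (xc v) - IZR (pb v)) <= d * IZR (pq v) / Q /\
    N i <= 3 * Q / IZR (pq v)).
  set (line := fun i => m i < / 4 /\ N i <= 24 * Q ^ 2 * L / IZR (pq (l i)) /\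
    exists y, x i <= y <= x i + L /\ Rabs (F (l i) y) <= d / Q).
  destruct (fun_choice (fun i v => (exists v, ray i v) -> ray i v)) as [v Hv].
  { intros i. destruct (excluded_middle_informative (exists v, ray i v)) as [[v h]|h];
      [now exists v|exists (mkpt 0 0 0); contradiction]. }
  set (isray := fun i => m i < / 4 /\ ray i (v i)).
  (* [2800] is [1400 * 2], from [arc_count] at [t = 2 / m i]. For [m i < / 4] this term exceeds the
     main term [V] itself, and the actual points are left to [eB] and [eD]. *)
  set (eA := fun i => if cdec (m i < 2 * R0) then 2800 * V * / m i else 0).
  set (eB := fun i => if cdec (line i) then 24 * Q ^ 2 * L / IZR (pq (l i)) else 0).
  set (eD := fun i => if cdec (isray i) then 3 * Q * / IZR (pq (v i)) else 0).
  assert (Hpt : forall i, In i (seq 0 n) ->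
    Rabs (N i - V) <= 1401 * V * / (c * R0) + (eA i + (eB i + eD i))).
  { intros i Hi. apply in_seq in Hi. destruct (Hla i ltac:(lia)) as [Hnd Hiff].
    destruct (Hlm' i) as [Pl [Hl [Hm [Hv' Hcov]]]].
    assert (HiR : 0 < / (c * R0)) by (apply Rinv_0_lt_compat; lra).
    assert (HVR : 0 < V * / (c * R0)) by (now apply Rmult_lt_0_compat).
    assert (Him : 0 < / m i) by (now apply Rinv_0_lt_compat).
    assert (HeA : 0 <= eA i).
    { unfold eA. destruct (cdec _); [|lra]. apply Rmult_le_pos; lra. }
    assert (HeB : 0 <= eB i).
    { unfold eB. destruct (cdec (line i)) eqn:E; [|lra]. apply -> cdec_true in E.
      destruct E as [_ [E _]]. apply Rle_trans with (2 := E). apply pos_INR. }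
    assert (HeD : 0 <= eD i).
    { unfold eD. destruct (cdec (isray i)) eqn:E; [|lra]. apply -> cdec_true in E.
      destruct E as [_ [_ [_ [_ [_ [_ E]]]]]]. apply Rle_trans with (2 := E). apply pos_INR. }
    destruct (Rlt_le_dec (m i) (/ 4)) as [h4|h4].
    - assert (hR : m i < 2 * R0) by lra. destruct (Hdual i hR) as [Nl _].
      assert (EA : eA i = 2800 * V * / m i).
      { unfold eA. now apply cdec_if. }
      assert (HVm : V <= eA i).
      { rewrite EA. assert (4 <= / m i).
        { rewrite <- (Rinv_inv 4). apply Rinv_le_contravar; lra. }
        nra. }
      assert (HN : N i <= eB i + eD i).
      { destruct (arc_cases Q (x i) L d f (l i) (la i)) as [E|[E|E]]; auto; try lra.
        - apply Nl.
        - intros z Hz. apply (arc_on_plane c Q (x i) L d R0 (m i) f g (l i) z); auto; lra.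
        - unfold N. rewrite E. simpl. lra.
        - assert (Er : isray i) by (split; [assumption|]; now apply Hv).
          assert (ED : eD i = 3 * Q * / IZR (pq (v i))).
          { unfold eD. now apply cdec_if. }
          rewrite ED. destruct Er as [_ [_ [_ [_ [_ [_ Er]]]]]]. unfold Rdiv in Er. lra.
        - assert (El : line i) by (split; assumption).
          assert (EB : eB i = 24 * Q ^ 2 * L / IZR (pq (l i))).
          { unfold eB. now apply cdec_if. }
          rewrite EB. unfold N. destruct E as [E _]. lra. }
      assert (0 <= N i) by apply pos_INR.
      apply Rabs_le_between. lra.
    - assert (Ht : 0 < 2 / m i <= 8).
      { split; [apply Rmult_lt_0_compat; lra|]. apply Rmult_le_reg_r with (m i); [assumption|].
        replace (2 / m i * m i) with 2 by (field; lra). lra. }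
      pose proof (arc_count c Q (x i) L d R0 (2 / m i) f g (la i) H HQ HL (proj1 Hd) HR
        (proj1 HLd) Ht Hcov Hnd Hiff) as K. fold V in K. fold (N i) in K.
      apply Rle_trans with (1 := K).
      destruct (Rlt_le_dec (m i) (2 * R0)) as [hR|hR].
      + assert (EA : eA i = 2800 * V * / m i).
        { unfold eA. now apply cdec_if. }
        rewrite EA. unfold Rdiv. nra.
      + assert (2 / m i <= / (c * R0)).
        { apply Rle_trans with (/ R0).
          - apply Rmult_le_reg_r with (m i * R0); [nra|].
            replace (2 / m i * (m i * R0)) with (2 * R0) by (field; lra).
            replace (/ R0 * (m i * R0)) with (m i) by (field; lra). assumption.
          - apply Rinv_le_contravar; [|]; nra. }
        assert (V * (1400 * (2 / m i)) <= V * (1400 * / (c * R0))) by (apply Rmult_le_compat_l; lra).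
        lra. }
  assert (Hn : INR n * L = xi - eta) by lra.
  assert (HnV : lsum (fun _ => V) (seq 0 n) = 3 * (xi - eta) * d * Q ^ 2).
  { rewrite lsum_const, length_seq, <- Hn. unfold V. ring. }
  assert (Hdiff : INR (length l1) - 3 * (xi - eta) * d * Q ^ 2 =
    lsum (fun i => N i - V) (seq 0 n)).
  { rewrite Hsum, <- HnV. fold N.
    rewrite (lsum_ext (fun i => N i - V) (fun i => N i + -1 * V)) by (intros; ring).
    rewrite lsum_plus, (lsum_scal (-1) (fun _ => V)). ring. }
  rewrite Hdiff. apply Rle_trans with (1 := lsum_abs _ _).
  apply Rle_trans with (1 := lsum_le _ _ _ Hpt).
  rewrite lsum_plus, lsum_plus, lsum_plus.
  (* [98 ^ 2 = 9604] just exceeds the [9600] of the normalization of [R0]. *)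
  assert (HLQ : L * Q <= 98 * R0 / c).
  { apply Rle_trans with (1 := Rle_abs _). apply Rabs_le_of_sq; [apply Rdiv_nonneg; lra|].
    apply Rmult_le_reg_r with R0; [lra|].
    apply Rle_trans with (d * Q).
    - replace ((L * Q) ^ 2 * R0) with (L ^ 2 * Q * R0 * Q) by ring.
      apply Rmult_le_compat_r; lra.
    - rewrite <- HR3. replace ((98 * R0 / c) ^ 2 * R0) with (R0 ^ 3 * (9604 / c ^ 2)) by (field; lra).
      apply Rmult_le_compat_l; [nra|]. apply Rmult_le_compat_r; [|lra].
      left. apply Rinv_0_lt_compat. nra. }
  assert (Hsq : sqrt (d / Q) <= 2 * L * S0).
  { apply sqrt_le_of_sq; [nra|]. apply Rmult_le_reg_r with Q; [assumption|].
    replace (d / Q * Q) with d by (field; lra). rewrite Rpow_mult_distr, ES. nra. }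
  set (B := 12 * S0 / c).
  assert (HB1 : 0 <= B) by (apply Rdiv_nonneg; lra).
  assert (Harcs : forall p (s : nat), atmost (fun i : nat => exists y,
    eta + INR i * L <= y <= eta + (INR i + 1) * L /\ Rabs (F p y) <= 4 ^ s * (d / Q)) (B * 2 ^ s)).
  { intros p s. assert (H2 : 1 <= 2 ^ s) by apply pow2_ge_1.
    assert (E4 : 4 ^ s = 2 ^ s * 2 ^ s) by (rewrite <- Rpow_mult_distr; f_equal; lra).
    assert (HdQ : 0 <= d / Q) by (apply Rdiv_nonneg; lra).
    apply atmost_sub with (3 := arcs_near c (4 ^ s * (d / Q)) eta L (F p)
      (fun y => g y - xc p) (cvx_affine c f g (xc p) (yc p) H) HL
      ltac:(apply Rmult_le_pos; [apply pow_le; lra|assumption])); [auto|].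
    rewrite sqrt_mult_alt by (apply pow_le; lra).
    rewrite E4, sqrt_square by lra.
    assert (Hic2 : 0 < / c) by lra.
    apply Rle_trans with (4 * (2 ^ s * (2 * L * S0)) / (c * L) + 4 * (2 ^ s * S0 * / c)).
    - apply Rplus_le_compat.
      + apply Rmult_le_compat_r; [left; apply Rinv_0_lt_compat; nra|].
        apply Rmult_le_compat_l; [lra|]. apply Rmult_le_compat_l; lra.
      + assert (1 <= 2 ^ s * S0) by nra. nra.
    - unfold B. right. field. lra. }
  (* Arcs are grouped by their dual point. Distinct dual points are near [fs], with slopes between
     [g (eta - 1)] and [g (xi + 1)], so the hypothesis on [Gs] sums their inverse heights. *)
  assert (HkG : forall S k, NoDup S -> 0 <= k ->
    (forall i, In i S -> (i < n)%nat /\ m i < 2 * R0) ->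
    lsum (fun p => k * / IZR (pq p)) (nodup ceq (map l S)) <= k * Gs).
  { intros S k HS Hk Hi. rewrite lsum_scal. apply Rmult_le_compat_l; [assumption|].
    apply HG1; [apply NoDup_nodup|]. intros p Hp.
    apply nodup_In, in_map_iff in Hp. destruct Hp as [i [<- Hp]].
    destruct (Hi i Hp) as [Hin' Him]. destruct (Hdual i Him) as [D1 [D2 [D3 _]]].
    destruct (Hxi i Hin') as [X1 X2]. split; [assumption|]. split; [|assumption].
    destruct (HLg (xc (l i))) as [<- _]. apply Rabs_le_between in D2.
    split; apply (cvx_grad_mono c f g); auto; lra. }
  assert (TA : lsum eA (seq 0 n) <= 2800 * V * (5 * B / d) * Gs).
  { unfold eA. rewrite <- lsum_sel. set (S := sel _ _).
    assert (HS : forall i, In i S -> (i < n)%nat /\ m i < 2 * R0).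
    { intros i Hi. apply sel_in in Hi. destruct Hi as [Hi h]. apply in_seq in Hi. split; [lia|exact h]. }
    assert (HSn : NoDup S) by (apply sel_nodup, seq_NoDup).
    assert (Hk : 0 <= 2800 * V * (5 * B / d)).
    { apply Rmult_le_pos; [lra|]. apply Rdiv_nonneg; lra. }
    apply Rle_trans with (2 := HkG S (2800 * V * (5 * B / d)) HSn Hk HS).
    apply group_le with (W := fun p => 2800 * V * (5 * B / d) * / IZR (pq p)).
    intros i Hi. destruct (HS i Hi) as [Hin' Him].
    assert (Hh : 0 < IZR (pq (l i))) by (apply IZR_lt, (Hdual i Him)).
    set (h := IZR (pq (l i))) in *. rewrite lsum_scal.
    replace (2800 * V * (5 * B / d) * / h) with (2800 * V * (/ (h * d) * (5 * B))) by (field; lra).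
    apply Rmult_le_compat_l; [lra|].
    (* For one dual point of height [h] the last two bounds of [dual_near] combine to
       [m >= h * d * y]. The arcs with [y <= 4 ^ s] number at most [B * 2 ^ s], so [dyadic_sum]
       applies to [/ y]. *)
    set (S' := sel _ S). set (y := fun i' => Rmax 1 (Rabs (F (l i) (x i')) * Q / d)).
    apply Rle_trans with (lsum (fun i' => / (h * d) * / y i') S').
    - apply lsum_le. intros i' Hi'. apply sel_in in Hi'. destruct Hi' as [Hi' El].
      destruct (HS i' Hi') as [_ Him']. destruct (Hdual i' Him') as [_ [_ [_ [D4 D5]]]].
      rewrite El in D4, D5. fold h in D4, D5. rewrite <- Rinv_mult.
      assert (Hy1 : 1 <= y i') by apply Rmax_l.
      apply Rinv_le_contravar; [apply Rmult_lt_0_compat; nra|].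
      unfold y, Rmax. destruct Rle_dec as [_|_]; [|lra].
      replace (h * d * (Rabs (F (l i) (x i')) * Q / d))
        with (h * (Q * Rabs (F (l i) (x i')))) by (field; lra). assumption.
    - rewrite lsum_scal. apply Rmult_le_compat_l; [left; apply Rinv_0_lt_compat; nra|].
      apply dyadic_sum; [now apply sel_nodup|intros; apply Rmax_l|].
      intros s. apply atmost_sub with (3 := Harcs (l i) s); [|lra].
      intros i' [_ Hy]. exists (x i'). split; [unfold x; lra|].
      assert (h1 : Rabs (F (l i) (x i')) * Q / d <= 4 ^ s) by (apply Rle_trans with (2 := Hy), Rmax_r).
      apply Rmult_le_reg_r with (Q / d).
      { apply Rdiv_lt_0_compat; lra. }
      replace (4 ^ s * (d / Q) * (Q / d)) with (4 ^ s) by (field; lra). unfold Rdiv in *. lra. }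
  assert (TB : lsum eB (seq 0 n) <= 24 * Q ^ 2 * L * B * Gs).
  { unfold eB. rewrite <- (lsum_sel line (fun i => 24 * Q ^ 2 * L / IZR (pq (l i)))).
    set (S := sel _ _).
    assert (HS : forall i, In i S -> (i < n)%nat /\ m i < 2 * R0).
    { intros i Hi. apply sel_in in Hi. destruct Hi as [Hi [h _]]. apply in_seq in Hi. split; [lia|lra]. }
    assert (HSn : NoDup S) by (apply sel_nodup, seq_NoDup).
    assert (Hk : 0 <= 24 * Q ^ 2 * L * B).
    { apply Rmult_le_pos; [|assumption]. apply Rmult_le_pos; [nra|lra]. }
    apply Rle_trans with (2 := HkG S (24 * Q ^ 2 * L * B) HSn Hk HS).
    apply group_le with (W := fun p => 24 * Q ^ 2 * L * B * / IZR (pq p)).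
    intros i Hi. destruct (HS i Hi) as [Hin' Him].
    assert (Hh : 0 < IZR (pq (l i))) by (apply IZR_lt, (Hdual i Him)).
    set (h := IZR (pq (l i))) in *. set (S' := sel _ S).
    apply Rle_trans with (lsum (fun _ => 24 * Q ^ 2 * L / h) S').
    - apply lsum_le. intros i' Hi'. apply sel_in in Hi'. destruct Hi' as [_ El].
      rewrite El. fold h. lra.
    - rewrite lsum_const. replace (24 * Q ^ 2 * L * B * / h) with (24 * Q ^ 2 * L / h * B) by (field; lra).
      apply Rmult_le_compat_l.
      { apply Rmult_le_pos; [|left; now apply Rinv_0_lt_compat]. apply Rmult_le_pos; [nra|lra]. }
      replace B with (B * 2 ^ 0) by (simpl; ring). apply (Harcs (l i) 0%nat); [now apply sel_nodup|].
      intros i' Hi'. apply sel_in in Hi'. destruct Hi' as [Hi' El].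
      apply sel_in in Hi'. destruct Hi' as [_ [_ [_ [y [Hy1 Hy2]]]]]. rewrite El in Hy2.
      exists y. split; [unfold x in Hy1; lra|]. simpl. lra. }
  assert (TD : lsum eD (seq 0 n) <= 3 * Q * Gs + 87 * (xi - eta) / c * (Q * S0)).
  { unfold eD. rewrite <- (lsum_sel isray (fun i => 3 * Q * / IZR (pq (v i)))).
    set (S := sel _ _).
    assert (HSn : NoDup S) by (apply sel_nodup, seq_NoDup).
    assert (HS : forall i, In i S -> (i < n)%nat /\ ray i (v i)).
    { intros i Hi. apply sel_in in Hi. destruct Hi as [Hi [_ h]]. apply in_seq in Hi. split; [lia|exact h]. }
    (* Exactly the range in which the bound [d * q0 / Q] of a ray implies the bound [c / 200 / q0]
       of [near]. Outside it [/ q0 <= 29 * L * S0 / c], as [29 ^ 2 = 841] exceeds [4 * 200], and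
       this sums trivially over the arcs. *)
    set (small := fun i => IZR (pq (v i)) ^ 2 <= c * Q / (200 * d)).
    assert (Hix : 0 < / c) by lra.
    apply Rle_trans with (3 * Q * lsum (fun i => / IZR (pq (v i))) (sel small S) +
      lsum (fun _ => 3 * Q * (29 * L * S0 / c)) (seq 0 n)).
    - rewrite <- lsum_scal.
      assert (E : lsum (fun i => 3 * Q * / IZR (pq (v i))) S <=
        lsum (fun i => (if cdec (small i) then 3 * Q * / IZR (pq (v i)) else 0) +
          3 * Q * (29 * L * S0 / c)) S).
      { apply lsum_le. intros i Hi. destruct (HS i Hi) as [_ [_ [Hvi _]]].
        assert (Hv1 : 1 <= IZR (pq (v i))) by (apply IZR_le; lia).
        assert (0 <= 29 * L * S0 / c).
        { apply Rmult_le_pos; [|lra]. nra. }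
        unfold cdec. destruct excluded_middle_informative as [_|Hns]; [nra|].
        unfold small in Hns. apply Rnot_le_lt in Hns. set (q0 := IZR (pq (v i))) in *.
        rewrite Rplus_0_l. apply Rmult_le_compat_l; [lra|].
        apply Rle_trans with (1 := Rle_abs _). apply Rabs_le_of_sq; [assumption|].
        apply Rmult_le_reg_r with (q0 ^ 2); [nra|].
        replace ((/ q0) ^ 2 * q0 ^ 2) with 1 by (field; lra).
        apply Rle_trans with ((29 * L * S0 / c) ^ 2 * (c * Q / (200 * d))).
        - replace ((29 * L * S0 / c) ^ 2 * (c * Q / (200 * d)))
            with (841 * (L ^ 2 * Q * S0 ^ 2) * / (200 * d) * / c) by (field; lra).
          rewrite ES. rewrite <- (Rmult_1_r 1). apply Rmult_le_compat; try lra.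
          apply Rmult_le_reg_r with (200 * d); [lra|]. rewrite Rmult_assoc, Rinv_l by lra. lra.
        - apply Rmult_le_compat_l; [apply pow2_ge_0|lra]. }
      apply Rle_trans with (1 := E). rewrite lsum_plus. apply Rplus_le_compat.
      + rewrite (lsum_sel small). lra.
      + rewrite !lsum_const. apply Rmult_le_compat_l.
        { apply Rmult_le_pos; [lra|]. apply Rmult_le_pos; [nra|lra]. }
        apply le_INR, NoDup_incl_length; [assumption|]. intros i Hi. apply sel_in in Hi. apply Hi.
    - apply Rplus_le_compat.
      + apply Rmult_le_compat_l; [lra|].
        rewrite <- (lsum_map v (fun z => / IZR (pq z))). apply HG2.
        * apply nodup_map_inj; [now apply sel_nodup|].
          intros i j Hi Hj E. apply sel_in in Hi, Hj. destruct Hi as [Hi _], Hj as [Hj _].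
          destruct (HS i Hi) as [_ [_ [_ [Xi _]]]]. destruct (HS j Hj) as [_ [_ [_ [Xj _]]]].
          rewrite E in Xi. unfold x in Xi, Xj.
          assert (INR i < INR j + 1) by nra. assert (INR j < INR i + 1) by nra.
          rewrite <- S_INR in *. apply INR_lt in H0, H1. lia.
        * intros z Hz. apply in_map_iff in Hz. destruct Hz as [i [<- Hi]].
          apply sel_in in Hi. destruct Hi as [Hi Hsm].
          destruct (HS i Hi) as [Hin' [R1 [R2 [R3 [R4 [R5 _]]]]]].
          destruct (Hxi i Hin') as [X1 X2].
          split; [|split; [lra|assumption]]. split; [assumption|]. split; [assumption|].
          apply Rle_trans with (1 := R5). unfold small in Hsm.
          assert (Hv1 : 1 <= IZR (pq (v i))) by (apply IZR_le; lia).
          set (q0 := IZR (pq (v i))) in *.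
          apply Rmult_le_reg_r with (q0 * Q / d).
          { apply Rdiv_lt_0_compat; nra. }
          replace (d * q0 / Q * (q0 * Q / d)) with (q0 ^ 2) by (field; lra).
          replace (c / 200 / q0 * (q0 * Q / d)) with (c * Q / (200 * d)) by (field; lra).
          assumption.
      + rewrite lsum_const, length_seq. rewrite <- Hn. right. field. lra. }
  rewrite lsum_const, length_seq.
  assert (EV : 1401 * V * / (c * R0) * INR n <= (xi - eta) * (41 * 10 ^ 6 / c ^ 3) * (Q * R0 ^ 2)).
  { assert (Hxe : 0 <= xi - eta) by (rewrite <- Hn; apply Rmult_le_pos; [apply pos_INR|lra]).
    replace (1401 * V * / (c * R0) * INR n) with ((xi - eta) * (4203 * (d * Q) * Q * / (c * R0)))
      by (rewrite <- Hn; unfold V; field; lra).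
    rewrite <- HR3.
    replace ((xi - eta) * (4203 * (R0 ^ 3 * (9600 / c ^ 2)) * Q * / (c * R0)))
      with ((xi - eta) * (40348800 / c ^ 3) * (Q * R0 ^ 2)) by (field; lra).
    apply Rmult_le_compat_r; [nra|]. apply Rmult_le_compat_l; [assumption|].
    apply Rmult_le_compat_r; [|lra]. left. apply Rinv_0_lt_compat, pow_lt. lra. }
  assert (HQRG : 0 <= Q * R0 * S0 * Gs) by (repeat apply Rmult_le_pos; lra).
  assert (Hc2 : 0 < / c ^ 2) by (apply Rinv_0_lt_compat; nra).
  assert (EAB : 2800 * V * (5 * B / d) * Gs + 24 * Q ^ 2 * L * B * Gs <=
    10 ^ 8 / c ^ 2 * (Q * R0 * S0 * Gs)).
  { replace (2800 * V * (5 * B / d) * Gs + 24 * Q ^ 2 * L * B * Gs)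
      with (504288 * / c * (Q * S0 * Gs) * (L * Q)) by (unfold V, B; field; lra).
    apply Rle_trans with (504288 * / c * (Q * S0 * Gs) * (98 * R0 / c)).
    - apply Rmult_le_compat_l; [|assumption].
      apply Rmult_le_pos; [lra|]. repeat apply Rmult_le_pos; lra.
    - replace (504288 * / c * (Q * S0 * Gs) * (98 * R0 / c))
        with (49420224 * / c ^ 2 * (Q * R0 * S0 * Gs)) by (field; lra).
      apply Rmult_le_compat_r; [assumption|]. unfold Rdiv. apply Rmult_le_compat_r; lra. }
  assert (ED2 : 87 * (xi - eta) / c * (Q * S0) <= (xi - eta) * (9 * 10 ^ 6 / c ^ 3) * (Q * R0 ^ 2)).
  { assert (Hxe : 0 <= xi - eta) by (rewrite <- Hn; apply Rmult_le_pos; [apply pos_INR|lra]).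
    replace (87 * (xi - eta) / c) with ((xi - eta) * (87 * / c)) by (field; lra).
    apply Rmult_le_compat.
    - apply Rmult_le_pos; [assumption|lra].
    - nra.
    - apply Rmult_le_compat_l; [assumption|].
      assert (/ c <= / c ^ 3) by (apply Rinv_le_contravar; [apply pow_lt; lra|]; nra).
      unfold Rdiv. lra.
    - apply Rmult_le_compat_l; [lra|]. rewrite <- ES.
      assert (1 <= S0 ^ 3) by (apply pow_R1_Rle; assumption). nra. }
  replace ((xi - eta) * (5 * 10 ^ 7 / c ^ 3) * (Q * R0 ^ 2)) with
    ((xi - eta) * (41 * 10 ^ 6 / c ^ 3) * (Q * R0 ^ 2) +
     (xi - eta) * (9 * 10 ^ 6 / c ^ 3) * (Q * R0 ^ 2)) by (field; lra).
  lra.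
Qed.

(** * Extension to the line *)

Definition clamp (a b x : R) : R := Rmax a (Rmin b x).

Lemma clamp_in (a b x : R) : a <= b -> Icc a b (clamp a b x).
Proof. intros H. unfold clamp, Icc, Rmax, Rmin. repeat destruct Rle_dec; lra. Qed.

Lemma clamp_id (a b x : R) : Icc a b x -> clamp a b x = x.
Proof. unfold clamp, Icc, Rmax, Rmin. intros H. repeat destruct Rle_dec; lra. Qed.

Lemma clamp_lip (a b x y : R) : Rabs (clamp a b x - clamp a b y) <= Rabs (x - y).
Proof.
  unfold clamp, Rmax, Rmin, Rabs. repeat destruct Rle_dec; repeat destruct Rcase_abs; lra.
Qed.

Lemma continue_in_clamp (a b : R) (h : R -> R) : a <= b ->
  (forall x, Icc a b x -> continue_in h (Icc a b) x) ->
  continuity (fun x => h (clamp a b x)).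
Proof.
  intros Hab H x e He.
  destruct (H (clamp a b x) (clamp_in a b x Hab) e He) as [d [Hd Hlim]].
  exists d. split; [assumption|]. intros y [_ Hy]. simpl in *. unfold R_dist in *.
  destruct (Req_dec (clamp a b y) (clamp a b x)) as [->|Hne].
  - rewrite Rminus_diag, Rabs_R0. assumption.
  - apply Hlim. split.
    + split; [now apply clamp_in|]. auto.
    + apply Rle_lt_trans with (2 := Hy). apply clamp_lip.
Qed.

Lemma D_in_clamp (a b x : R) (h h1 : R -> R) : a < x < b -> D_in h h1 (Icc a b) x ->
  is_derive (fun x => h (clamp a b x)) x (h1 x).
Proof.
  intros Hx H. apply is_derive_Reals. intros e He.
  destruct (H e He) as [d [Hd Hlim]].
  assert (Hm : 0 < Rmin d (Rmin (x - a) (b - x))) by (repeat apply Rmin_glb_lt; lra).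
  exists (mkposreal _ Hm). intros k Hk Hkd. cbn [pos] in Hkd.
  assert (K1 : Rabs k < d) by (apply Rlt_le_trans with (1 := Hkd), Rmin_l).
  assert (K2 : Rabs k < x - a).
  { apply Rlt_le_trans with (1 := Hkd). eapply Rle_trans; [apply Rmin_r|apply Rmin_l]. }
  assert (K3 : Rabs k < b - x).
  { apply Rlt_le_trans with (1 := Hkd). eapply Rle_trans; [apply Rmin_r|apply Rmin_r]. }
  apply Rabs_lt_between in K2, K3.
  rewrite !clamp_id by (unfold Icc; lra).
  specialize (Hlim (x + k)). simpl in Hlim. unfold R_dist in Hlim.
  replace (x + k - x) with k in Hlim by ring. apply Hlim.
  split; [|assumption]. split; [unfold Icc; lra|lra].
Qed.

(** Composition with [clamp] turns derivatives relative to the interval into ordinary ones in the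
    interior, with continuity at the endpoints. The extra summand [P] lets the same statement yield
    second order Taylor bounds. *)
Lemma D_in_MVT (a b x y : R) (h h1 : R -> R) (P P1 : R -> R) : 
  (forall x, Icc a b x -> D_in h h1 (Icc a b) x) -> (forall x, is_derive P x (P1 x)) ->
  Icc a b x -> Icc a b y -> x <> y ->
  exists z, Rmin x y <= z <= Rmax x y /\ 
    (h y + P y) - (h x + P x) = (h1 z + P1 z) * (y - x) /\ Icc a b z.
Proof.
  intros H HP Hx Hy Hne.
  assert (Hab : a <= b) by (unfold Icc in Hx; lra).
  destruct (MVT_gen (fun t => h (clamp a b t) + P t) x y (fun t => h1 t + P1 t))
    as [z [Hz E]].
  - intros t Ht. apply (is_derive_plus (fun t => h (clamp a b t)) P); [|apply HP].
    apply D_in_clamp; [|apply H];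
      unfold Icc, Rmin, Rmax in *; repeat destruct Rle_dec; lra.
  - intros t _. apply continuity_pt_plus.
    + apply continue_in_clamp; [assumption|]. intros u Hu. apply (cont_deriv h h1). auto.
    + apply derivable_continuous_pt. exists (P1 t). apply is_derive_Reals. apply HP.
  - rewrite !clamp_id in E by assumption. exists z. split; [assumption|].
    split; [exact E|]. unfold Icc, Rmin, Rmax in *; repeat destruct Rle_dec; lra.
Qed.

(** The two orders together control the difference of the gradients, which is what makes the
    relation chain through an intermediate point. *)
Definition cvx_pair (c : R) (f g : R -> R) (x y : R) : Prop :=
  c / 2 * (y - x) ^ 2 <= f y - f x - g x * (y - x) <= / (2 * c) * (y - x) ^ 2 /\
  c / 2 * (x - y) ^ 2 <= f x - f y - g y * (x - y) <= / (2 * c) * (x - y) ^ 2.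

Lemma cvx_pair_chain (c : R) (f g : R -> R) (x m y : R) : 0 < c -> x <= m <= y ->
  cvx_pair c f g x m -> cvx_pair c f g m y -> cvx_pair c f g x y.
Proof.
  intros Hc Hm [[A1 A2] [A3 A4]] [[B1 B2] [B3 B4]].
  assert (Hk : 0 < / (2 * c)) by (apply Rinv_0_lt_compat; lra).
  set (k := / (2 * c)) in *.
  set (u := m - x) in *. set (v := y - m) in *.
  replace (x - m) with (- u) in A3, A4 by (unfold u; ring).
  replace (m - y) with (- v) in B3, B4 by (unfold v; ring).
  assert (Hu : 0 <= u) by (unfold u; lra). assert (Hv : 0 <= v) by (unfold v; lra).
  assert (Gu : c * u <= g m - g x <= 2 * k * u).
  { destruct (Req_dec u 0) as [E|E].
    - assert (m = x) by (unfold u in E; lra). subst m. rewrite E. lra.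
    - split; apply Rmult_le_reg_r with u; lra || nra. }
  assert (Gv : c * v <= g y - g m <= 2 * k * v).
  { destruct (Req_dec v 0) as [E|E].
    - assert (y = m) by (unfold v in E; lra). subst y. rewrite E. lra.
    - split; apply Rmult_le_reg_r with v; lra || nra. }
  unfold cvx_pair. fold k. replace (y - x) with (u + v) by (unfold u, v; ring).
  replace (x - y) with (- (u + v)) by (unfold u, v; ring).
  assert (c * u * v <= (g m - g x) * v <= 2 * k * u * v) by (split; apply Rmult_le_compat_r; lra).
  assert (c * v * u <= (g y - g m) * u <= 2 * k * v * u) by (split; apply Rmult_le_compat_r; lra).
  repeat split; nra.
Qed.

Lemma cvx_pair_glue (c m : R) (f g : R -> R) (P : R -> Prop) : 0 < c ->
  P m -> (forall x y, P x -> P y -> x <= m -> y <= m -> cvx_pair c f g x y) ->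
  (forall x y, P x -> P y -> m <= x -> m <= y -> cvx_pair c f g x y) ->
  forall x y, P x -> P y -> cvx_pair c f g x y.
Proof.
  intros Hc Pm HL HR.
  assert (G : forall x y, P x -> P y -> x <= y -> cvx_pair c f g x y).
  { intros x y Px Py Hxy. destruct (Rle_dec y m); [apply HL; auto; lra|].
    destruct (Rle_dec m x); [apply HR; auto; lra|].
    apply cvx_pair_chain with m; [assumption|lra|apply HL; auto; lra|apply HR; auto; lra]. }
  intros x y Px Py. destruct (Rle_dec x y); [now apply G|].
  destruct (G y x Py Px) as [h1 h2]; [lra|]. now split.
Qed.

(** Outside the interval [f] continues as the quadratic with the value and slope of the endpoint and
    second derivative [1]. As [c <= 1], this lies between [c] and [/ c], and pairs on different
    sides of an endpoint are joined by [cvx_pair_glue]. *)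
Lemma cvx_extend (eta xi : R) (f f1 f2 : R -> R) : eta < xi ->
  (forall x, Icc eta xi x -> D_in f f1 (Icc eta xi) x) ->
  (forall x, Icc eta xi x -> D_in f1 f2 (Icc eta xi) x) ->
  (forall x, Icc eta xi x -> continue_in f2 (Icc eta xi) x) ->
  (exists c, 0 < c /\ forall x, Icc eta xi x -> c <= f2 x) ->
  exists c F G, cvx c F G /\ forall x, Icc eta xi x -> F x = f x.
Proof.
  intros Hex Hf1 Hf2 Hcont [c0 [Hc0 Hpos]].
  pose proof (continue_in_clamp eta xi f2 ltac:(lra) Hcont) as Hc2.
  destruct (continuity_ab_maj (fun x => f2 (clamp eta xi x)) eta xi ltac:(lra)
    (fun x _ => Hc2 x)) as [xm [Hmax Hxm]].
  rewrite (clamp_id _ _ xm) in Hmax by exact Hxm. set (M := f2 xm) in *.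
  assert (HM : 0 < M) by (pose proof (Hpos xm Hxm); unfold M; lra).
  assert (HiM : 0 < / M) by (now apply Rinv_0_lt_compat).
  set (c := Rmin 1 (Rmin c0 (/ M))).
  assert (Hc1 : c <= 1) by apply Rmin_l.
  assert (Hcc0 : c <= c0) by (eapply Rle_trans; [apply Rmin_r|apply Rmin_l]).
  assert (HcM : c <= / M) by (eapply Rle_trans; [apply Rmin_r|apply Rmin_r]).
  assert (Hc : 0 < c) by (repeat apply Rmin_glb_lt; lra).
  assert (HMc : M <= / c) by (rewrite <- (Rinv_inv M); apply Rinv_le_contravar; lra).
  assert (Hb2 : forall x, Icc eta xi x -> c <= f2 x <= / c).
  { intros x Hx. pose proof (Hpos x Hx). pose proof (Hmax x Hx) as h. cbv beta in h.
    rewrite clamp_id in h by assumption. lra. }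
  assert (Hg : forall x y, Icc eta xi x -> Icc eta xi y ->
    c * (y - x) ^ 2 <= (f1 y - f1 x) * (y - x) <= / c * (y - x) ^ 2).
  { intros x y Hx Hy. destruct (Req_dec x y) as [->|Hne].
    { replace ((y - y) ^ 2) with 0 by ring. lra. }
    destruct (D_in_MVT eta xi x y f1 f2 (fun _ => 0) (fun _ => 0) Hf2
      (fun x => is_derive_const 0 x) Hx Hy Hne) as [z [_ [E Hz]]].
    replace (f1 y - f1 x) with (f2 z * (y - x)) by lra.
    destruct (Hb2 z Hz). pose proof (pow2_ge_0 (y - x)).
    replace (f2 z * (y - x) * (y - x)) with (f2 z * (y - x) ^ 2) by ring.
    split; apply Rmult_le_compat_r; assumption. }
  assert (Htay : forall k x y, Icc eta xi x -> Icc eta xi y -> x <> y ->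
    exists z, Icc eta xi z /\ f y - f x - f1 x * (y - x) - k / 2 * (y - x) ^ 2 =
      (f1 z - f1 x - k * (z - x)) * (y - x) /\ Rmin x y <= z <= Rmax x y).
  { intros k x y Hx Hy Hne.
    destruct (D_in_MVT eta xi x y f f1 (fun t => - f1 x * (t - x) - k / 2 * (t - x) ^ 2)
      (fun t => - f1 x - k * (t - x)) Hf1) as [z [Hz [E Iz]]]; try assumption.
    - intros t. auto_derive; [exact I|]. field.
    - exists z. split; [assumption|]. split; [|assumption].
      replace (f1 z - f1 x - k * (z - x)) with (f1 z + (- f1 x - k * (z - x))) by ring.
      rewrite <- E. ring. }
  assert (Hhalf : / 2 <= / (2 * c)) by (apply Rinv_le_contravar; lra).
  assert (Hmid : forall x y, Icc eta xi x -> Icc eta xi y ->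
    c / 2 * (y - x) ^ 2 <= f y - f x - f1 x * (y - x) <= / (2 * c) * (y - x) ^ 2).
  { intros x y Hx Hy. destruct (Req_dec x y) as [->|Hne].
    { replace ((y - y) ^ 2) with 0 by ring. lra. }
    (* An intermediate [z] lies on the same side of [x] as [y] does, so a sign known against [z - x]
       holds against [y - x]. *)
    assert (S : forall z w, Rmin x y <= z <= Rmax x y -> (z = x -> w = 0) ->
      0 <= w * (z - x) -> 0 <= w * (y - x)).
    { intros z w Hz Hzx Hw. destruct (Req_dec z x) as [E|E]; [rewrite (Hzx E); lra|].
      assert (0 <= w * (y - x) * (z - x) ^ 2).
      { replace (w * (y - x) * (z - x) ^ 2) with (w * (z - x) * ((y - x) * (z - x))) by ring.
        apply Rmult_le_pos; [assumption|]. unfold Rmin, Rmax in Hz. destruct Rle_dec; nra. }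
      assert (0 < (z - x) ^ 2) by (apply pow2_gt_0; lra). nra. }
    split.
    - destruct (Htay c x y Hx Hy Hne) as [z [Iz [E Hz]]].
      assert (0 <= (f1 z - f1 x - c * (z - x)) * (y - x)); [|lra].
      apply (S z); [assumption|intros ->; ring|].
      destruct (Hg x z Hx Iz) as [h _]. lra.
    - destruct (Htay (/ c) x y Hx Hy Hne) as [z [Iz [E Hz]]].
      assert (0 <= - (f1 z - f1 x - / c * (z - x)) * (y - x)).
      { apply (S z); [assumption|intros ->; ring|].
        destruct (Hg x z Hx Iz) as [_ h]. lra. }
      replace (/ (2 * c)) with (/ c / 2) by (field; lra). lra. }
  set (G := fun x => f1 (clamp eta xi x) + (x - clamp eta xi x)).
  set (F := fun x => f (clamp eta xi x) + f1 (clamp eta xi x) * (x - clamp eta xi x) +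
    / 2 * (x - clamp eta xi x) ^ 2).
  assert (Hout : forall p, (forall x y, clamp eta xi x = p -> clamp eta xi y = p ->
    cvx_pair c F G x y)).
  { intros p x y Hx Hy. unfold cvx_pair, F, G. rewrite Hx, Hy.
    pose proof (pow2_ge_0 (x - y)). pose proof (pow2_ge_0 (y - x)).
    replace (f p + f1 p * (y - p) + / 2 * (y - p) ^ 2 -
      (f p + f1 p * (x - p) + / 2 * (x - p) ^ 2) - (f1 p + (x - p)) * (y - x))
      with (/ 2 * (y - x) ^ 2) by field.
    replace (f p + f1 p * (x - p) + / 2 * (x - p) ^ 2 -
      (f p + f1 p * (y - p) + / 2 * (y - p) ^ 2) - (f1 p + (y - p)) * (x - y))
      with (/ 2 * (x - y) ^ 2) by field.
    repeat split; apply Rmult_le_compat_r; lra. }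
  assert (HF : forall x, Icc eta xi x -> F x = f x /\ G x = f1 x).
  { intros x Hx. unfold F, G. rewrite clamp_id by assumption. split; ring. }
  assert (Hleft : forall x y, x <= xi -> y <= xi -> cvx_pair c F G x y).
  { apply (cvx_pair_glue c eta F G (fun x => x <= xi)); [assumption|lra| |].
    - intros x y _ _ Hx Hy. apply (Hout eta); unfold clamp, Rmax, Rmin; repeat destruct Rle_dec; lra.
    - intros x y Hx Hy Hx' Hy'. unfold cvx_pair.
      destruct (HF x) as [-> ->]; [split; assumption|].
      destruct (HF y) as [-> ->]; [split; assumption|].
      split; apply Hmid; split; assumption. }
  exists c, F, G. split; [|intros x Hx; now apply HF].
  split; [assumption|]. intros x y.
  apply (cvx_pair_glue c xi F G (fun _ => True)); auto.
  intros x' y' _ _ Hx Hy. apply (Hout xi); unfold clamp, Rmax, Rmin; repeat destruct Rle_dec; lra.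
Qed.

(** By the intermediate value theorem [f2] has constant sign. Passing to [- f] is harmless because
    the distance to the nearest integer is even, as [Ntilde_list] uses. *)
Lemma cvx_extend_signed (eta xi : R) (f f1 f2 : R -> R) : eta < xi ->
  (forall x, Icc eta xi x -> D_in f f1 (Icc eta xi) x) ->
  (forall x, Icc eta xi x -> D_in f1 f2 (Icc eta xi) x) ->
  (forall x, Icc eta xi x -> continue_in f2 (Icc eta xi) x) ->
  (exists c, 0 < c /\ forall x, Icc eta xi x -> c <= Rabs (f2 x)) ->
  exists c F G, cvx c F G /\
    ((forall x, Icc eta xi x -> F x = f x) \/ (forall x, Icc eta xi x -> F x = - f x)).
Proof.
  intros Hex Hf1 Hf2 Hcont [c [Hc Hab]].
  pose proof (continue_in_clamp eta xi f2 ltac:(lra) Hcont) as Hc2.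
  assert (Hsign : forall x y, Icc eta xi x -> Icc eta xi y -> 0 < f2 x -> f2 y < 0 -> False).
  { intros x y Hx Hy Px Py.
    destruct (IVT_gen (fun t => f2 (clamp eta xi t)) x y 0 Hc2) as [z [_ Hz]].
    - rewrite !clamp_id by assumption. unfold Rmin, Rmax. repeat destruct Rle_dec; lra.
    - pose proof (Hab _ (clamp_in eta xi z ltac:(lra))) as h.
      cbv beta in Hz. rewrite Hz, Rabs_R0 in h. lra. }
  assert (He : Icc eta xi eta) by (unfold Icc; lra).
  destruct (Rlt_le_dec 0 (f2 eta)) as [h|h].
  - destruct (cvx_extend eta xi f f1 f2 Hex Hf1 Hf2 Hcont) as [c' [F [G [HF E]]]].
    + exists c. split; [assumption|]. intros x Hx. specialize (Hab x Hx).
      unfold Rabs in Hab. destruct Rcase_abs as [h'|h'] in Hab; [|assumption].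
      destruct (Hsign eta x He Hx h h').
    + exists c', F, G. auto.
  - destruct (cvx_extend eta xi (fun x => - f x) (fun x => - f1 x) (fun x => - f2 x) Hex)
      as [c' [F [G [HF E]]]].
    + intros x Hx. apply Dopp. auto.
    + intros x Hx. apply Dopp. auto.
    + intros x Hx. apply (limit_Ropp f2). now apply Hcont.
    + exists c. split; [assumption|]. intros x Hx. pose proof (Hab x Hx) as hx.
      pose proof (Hab eta He) as he.
      unfold Rabs in hx, he. destruct Rcase_abs as [h'|h'] in hx; [assumption|].
      destruct Rcase_abs as [h2|h2] in he; [|lra].
      destruct (Hsign x eta Hx He); lra.
    + exists c', F, G. auto.
Qed.

(** * The asymptotic formula *)

Lemma cardinal_list {U : Type} (E : Ensemble U) (n : nat) : cardinal U E n ->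
  exists l, NoDup l /\ length l = n /\ forall x, List.In x l <-> E x.
Proof.
  induction 1 as [|E n Hc [l [Hl [Hn Hin]]] x Hx].
  - exists nil. split; [constructor|]. split; [reflexivity|]. intros x. split; intros [].
  - exists (x :: l). split; [|split].
    + constructor; [|assumption]. intros h. apply Hx. now apply Hin.
    + simpl. now rewrite Hn.
    + intros y. split.
      * intros [<-|Hy]; [right; constructor|left; now apply Hin].
      * intros [y' Hy|y' Hy]; [right; now apply Hin|left; now destruct Hy].
Qed.

Lemma dist_Z_lt (x d : R) : dist_Z x < d <-> exists b : Z, Rabs (x - IZR b) < d.
Proof.
  destruct (dist_Z_min x) as [m [E H]]. split.
  - intros h. exists m. lra.
  - intros [b h]. specialize (H b). lra.
Qed.

(** Since [d < 1 / 2], each counted pair has exactly one integer [b] within [d], so pairs and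
    integer triples correspond. *)
Lemma Ntilde_list (eta xi Q d : R) (f F : R -> R) : 0 < Q -> d < 1 / 2 ->
  (forall x, Icc eta xi x -> F x = f x) \/ (forall x, Icc eta xi x -> F x = - f x) ->
  exists l, NoDup l /\ Ntilde f eta xi Q d = INR (length l) /\
    forall z, List.In z l <-> near_set eta xi Q d F z.
Proof.
  intros HQ Hd HF.
  destruct (cardinal_list _ _ (near_points_finite f eta xi Q d)) as [l0 [Hl0 [Hlen Hin0]]].
  assert (Hdist : forall x y, Icc eta xi x -> dist_Z (y * f x) < d <->
    exists b : Z, Rabs (y * F x - IZR b) < d).
  { intros x y Hx. rewrite dist_Z_lt. destruct HF as [HF|HF]; rewrite (HF x Hx); [tauto|].
    split; intros [b Hb]; exists (- b)%Z; rewrite opp_IZR, <- Rabs_Ropp.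
    - replace (- (y * - f x - - IZR b)) with (y * f x - IZR b) by ring. assumption.
    - replace (- (y * f x - - IZR b)) with (y * - f x - IZR b) by ring. assumption. }
  set (bs := fun a q => epsilon (inhabits 0%Z)
    (fun b => Rabs (IZR q * F (IZR a / IZR q) - IZR b) < d)).
  set (phi := fun p : Z * nat => mkpt (Z.of_nat (snd p)) (fst p) (bs (fst p) (Z.of_nat (snd p)))).
  assert (Hx : forall a q, Q < IZR q -> eta * IZR q < IZR a <= xi * IZR q ->
    Icc eta xi (IZR a / IZR q)).
  { intros a q Hq Ha. unfold Icc.
    assert (E : IZR a = IZR a / IZR q * IZR q) by (field; lra).
    rewrite E in Ha. split; apply Rmult_le_reg_r with (IZR q); lra. }
  exists (map phi l0). split; [|split].
  - apply nodup_map_inj; [assumption|]. intros [a q] [a' q'] _ _ E.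
    unfold phi in E. simpl in E. injection E as E1 E2 _. f_equal; lia.
  - unfold Ntilde. rewrite length_map, Hlen. reflexivity.
  - intros z. rewrite in_map_iff. split.
    + intros [[a q] [<- Hp]]. apply Hin0 in Hp. destruct Hp as [Hq [Ha Hn]].
      rewrite INR_IZR_INZ in Hq, Ha, Hn. unfold near_set, phi, xc; cbn [pq pa pb fst snd].
      split; [assumption|]. split; [assumption|]. unfold bs. apply epsilon_spec.
      apply Hdist; [apply Hx; lra|assumption].
    + intros [Hq [Ha Hn]]. assert (Hqz : (0 < pq z)%Z) by (apply lt_IZR; lra).
      exists (pa z, Z.to_nat (pq z)).
      assert (Hpx : Rabs (IZR (pq z) * F (IZR (pa z) / IZR (pq z)) - IZR (bs (pa z) (pq z))) < d).
      { unfold bs. apply epsilon_spec. exists (pb z). exact Hn. }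
      split.
      * unfold phi; cbn [fst snd]. rewrite Z2Nat.id by lia. apply pt_eq; cbn [pq pa pb]; auto.
        cut (bs (pa z) (pq z) - pb z = 0)%Z; [lia|]. apply Rabs_IZR_lt_1.
        rewrite minus_IZR. unfold xc in Hn.
        apply Rabs_lt_between in Hn, Hpx. apply Rabs_lt_between. lra.
      * apply Hin0. unfold near_points. rewrite INR_IZR_INZ, Z2Nat.id by lia.
        split; [assumption|]. split; [assumption|].
        apply Hdist; [apply Hx; lra|]. now exists (pb z).
Qed.

Lemma Rpower_pos (x y : R) : 0 < Rpower x y.
Proof. apply exp_pos. Qed.

Lemma Rpower_ge_1 (x y : R) : 1 <= x -> 0 <= y -> 1 <= Rpower x y.
Proof.
  intros Hx Hy. rewrite <- (Rpower_O x) by lra. apply Rle_Rpower; lra.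
Qed.

Lemma Rpower_base_large (b k x : R) : 0 < b -> 0 < k -> Rpower b (/ k) <= x -> b <= Rpower x k.
Proof.
  intros Hb Hk Hx. rewrite <- (Rpower_1 b) at 1 by assumption.
  rewrite <- (Rinv_l k) by lra. rewrite <- Rpower_mult.
  apply Rle_Rpower_l; [lra|]. split; [apply Rpower_pos|assumption].
Qed.

Lemma near_count_asymp (c eta xi kappa : R) (f g : R -> R) : cvx c f g -> eta < xi ->
  0 < kappa ->
  exists Q0 C, 0 < C /\ forall Q d l, Q0 <= Q -> Rpower Q (- 1 + kappa) <= d < 1 / 2 ->
    NoDup l -> (forall z, List.In z l <-> near_set eta xi Q d f z) ->
    Rabs (INR (length l) - 3 * (xi - eta) * d * Q ^ 2) <= C * (Q * Rpower (d * Q) (2 / 3)).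
Proof.
  intros H Hex Hk. pose proof (cvx_pos c f g H) as Hc.
  destruct (cvx_legendre c f g H) as [fs [gs [Hs HL]]].
  set (e := kappa / 6). assert (He : 0 < e) by (unfold e; lra).
  assert (Hw : 0 <= g (xi + 1) - g (eta - 1)).
  { pose proof (cvx_grad_mono c f g (eta - 1) (xi + 1) H). lra. }
  destruct (near_sum c e (g (xi + 1) - g (eta - 1)) (proj1 Hc) He Hw) as [C1 [HC1 G1]].
  destruct (near_sum c e (xi - eta) (proj1 Hc) He ltac:(lra)) as [C2 [HC2 G2]].
  set (C0 := 9600 / c ^ 2).
  assert (HC0 : 9600 <= C0).
  { unfold C0. apply Rmult_le_reg_r with (c ^ 2); [nra|].
    replace (9600 / c ^ 2 * c ^ 2) with 9600 by (field; lra). nra. }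
  set (C3 := (C1 + C2) * Rpower 2 e * Rpower C0 (/ 6)).
  assert (HC3 : 0 <= C3).
  { unfold C3. apply Rmult_le_pos; [|left; apply Rpower_pos].
    apply Rmult_le_pos; [lra|left; apply Rpower_pos]. }
  pose proof (Rinv_ge_1 c Hc) as Hic.
  (* The summands ensure in turn [1 <= Q], an arc length at most [xi - eta], and [/ c <= R0]. *)
  set (Q0 := 1 + / (xi - eta) ^ 2 + Rpower (C0 * (/ c) ^ 3) (/ kappa)).
  exists Q0, ((xi - eta) * (5 * 10 ^ 7 / c ^ 3) + 10 ^ 8 / c ^ 2 * C3 + 3 * C3 + 1).
  assert (Hc3 : 0 < / c ^ 3) by (apply Rinv_0_lt_compat, pow_lt; lra).
  assert (Hc2 : 0 < / c ^ 2) by (apply Rinv_0_lt_compat, pow_lt; lra).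
  assert (K1 : 0 <= (xi - eta) * (5 * 10 ^ 7 / c ^ 3)) by (unfold Rdiv; nra).
  assert (K2 : 0 <= 10 ^ 8 / c ^ 2 * C3) by (apply Rmult_le_pos; [unfold Rdiv|]; lra).
  split; [lra|]. intros Q d l HQ0 Hd Hl Hin.
  assert (P1 : 0 < / (xi - eta) ^ 2) by (apply Rinv_0_lt_compat, pow_lt; lra).
  pose proof (Rpower_pos (C0 * (/ c) ^ 3) (/ kappa)) as P2.
  unfold Q0 in HQ0. assert (HQ : 1 <= Q) by lra.
  assert (Hd0 : 0 < d) by (pose proof (Rpower_pos Q (- 1 + kappa)); lra).
  assert (HdQ : Rpower Q kappa <= d * Q).
  { replace kappa with (- 1 + kappa + 1) by ring. rewrite Rpower_plus, Rpower_1 by lra.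
    apply Rmult_le_compat_r; lra. }
  assert (HdQ0 : 0 < d * Q) by (apply Rmult_lt_0_compat; lra).
  set (S0 := Rpower (d * Q / C0) (/ 6)). set (R0 := S0 ^ 2).
  assert (HS0 : 0 < S0) by apply Rpower_pos.
  assert (HX : 0 < d * Q / C0) by (apply Rdiv_lt_0_compat; lra).
  assert (ER : forall n, S0 ^ n = Rpower (d * Q / C0) (INR n / 6)).
  { intros n. rewrite <- Rpower_pow by assumption. unfold S0. rewrite Rpower_mult.
    f_equal. field. }
  assert (HR3 : R0 ^ 3 * C0 = d * Q).
  { unfold R0. rewrite <- pow_mult, ER. replace (INR (2 * 3) / 6) with 1 by (simpl; field).
    rewrite Rpower_1 by assumption. field. lra. }
  assert (HR2 : R0 ^ 2 <= Rpower (d * Q) (2 / 3)).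
  { unfold R0. rewrite <- pow_mult, ER. replace (INR (2 * 2) / 6) with (2 / 3) by (simpl; field).
    apply Rle_Rpower_l; [lra|]. split; [assumption|].
    apply Rmult_le_reg_r with C0; [lra|]. replace (d * Q / C0 * C0) with (d * Q) by (field; lra).
    nra. }
  assert (HR : / c <= R0).
  { apply Rnot_lt_le. intros h.
    assert (R0 ^ 3 < (/ c) ^ 3).
    { assert (0 <= R0) by (unfold R0; apply pow2_ge_0). simpl. rewrite !Rmult_1_r.
      assert (R0 * R0 <= / c * / c) by (apply Rmult_le_compat; lra). nra. }
    assert (C0 * (/ c) ^ 3 <= Rpower Q kappa).
    { apply Rpower_base_large; [|assumption|lra].
      apply Rmult_lt_0_compat; [lra|apply pow_lt; lra]. }
    nra. }
  assert (HS1 : 1 <= S0) by (unfold R0 in HR; nra).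
  assert (HQS : Rpower Q e <= Rpower C0 (/ 6) * S0).
  { replace (Rpower Q e) with (Rpower (Rpower Q kappa) (/ 6))
      by (rewrite Rpower_mult; f_equal; unfold e; field).
    apply Rle_trans with (Rpower (d * Q) (/ 6)).
    - apply Rle_Rpower_l; [lra|]. split; [apply Rpower_pos|assumption].
    - unfold S0. rewrite Rpower_mult_distr by (assumption || lra).
      replace (C0 * (d * Q / C0)) with (d * Q) by (field; lra). lra. }
  set (Gs := (C1 + C2) * Rpower (2 * Q) e).
  assert (HGs : Gs <= C3 * S0).
  { unfold Gs, C3. rewrite <- Rpower_mult_distr by lra.
    replace ((C1 + C2) * Rpower 2 e * Rpower C0 (/ 6) * S0)
      with ((C1 + C2) * (Rpower 2 e * (Rpower C0 (/ 6) * S0))) by ring.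
    apply Rmult_le_compat_l; [lra|]. apply Rmult_le_compat_l; [left; apply Rpower_pos|assumption]. }
  pose proof (Rpower_pos (2 * Q) e) as Hpe.
  (* The ideal arc length, with [L0 ^ 2 * Q * R0 = d]. Dividing [xi - eta] into [n] equal arcs gives
     [L0 / 2 <= L <= L0], whence the factor [4] in [count_bound]. *)
  set (L0 := sqrt (d / (Q * R0))).
  assert (HL0pos : 0 < d / (Q * R0)).
  { apply Rmult_lt_0_compat; [assumption|]. apply Rinv_0_lt_compat. nra. }
  assert (HL0 : 0 < L0) by (now apply sqrt_lt_R0).
  assert (HL0sq : L0 ^ 2 = d / (Q * R0)) by (apply pow2_sqrt; lra).
  assert (HL0x : L0 <= xi - eta).
  { apply sqrt_le_of_sq; [lra|]. apply Rmult_le_reg_r with (Q * R0); [nra|].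
    replace (d / (Q * R0) * (Q * R0)) with d by (field; lra).
    assert (1 <= (xi - eta) ^ 2 * Q).
    { apply Rle_trans with ((xi - eta) ^ 2 * / (xi - eta) ^ 2); [right; field; lra|].
      apply Rmult_le_compat_l; [apply pow2_ge_0|lra]. }
    assert ((xi - eta) ^ 2 * Q * 1 <= (xi - eta) ^ 2 * Q * R0) by (apply Rmult_le_compat_l; lra).
    lra. }
  set (y := (xi - eta) / L0).
  assert (Hy : 1 <= y).
  { apply Rmult_le_reg_r with L0; [assumption|]. unfold y.
    replace ((xi - eta) / L0 * L0) with (xi - eta) by (field; lra). lra. }
  set (n := Z.to_nat (Int_part y + 1)).
  assert (Hn : y <= INR n <= 2 * y).
  { pose proof (Int_part_bounds y) as b.
    assert (0 <= Int_part y)%Z by (apply Int_part_le; lra).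
    unfold n. rewrite INR_IZR_INZ, Z2Nat.id by lia. rewrite plus_IZR. lra. }
  set (L := (xi - eta) / INR n).
  assert (Exi : xi - eta = y * L0) by (unfold y; field; lra).
  assert (HLL : 0 < L <= L0 /\ L0 <= 2 * L).
  { split; [split|].
    - apply Rdiv_lt_0_compat; lra.
    - apply Rmult_le_reg_r with (INR n); [lra|]. unfold L.
      replace ((xi - eta) / INR n * INR n) with (xi - eta) by (field; lra). nra.
    - apply Rmult_le_reg_r with (INR n); [lra|]. unfold L.
      replace (2 * ((xi - eta) / INR n) * INR n) with (2 * (xi - eta)) by (field; lra). nra. }
  assert (HQR : 0 < Q * R0) by nra.
  assert (EL0 : L0 ^ 2 * (Q * R0) = d) by (rewrite HL0sq; field; nra).
  assert (HB : Rabs (INR (length l) - 3 * (xi - eta) * d * Q ^ 2) <=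
    (xi - eta) * (5 * 10 ^ 7 / c ^ 3) * (Q * R0 ^ 2) +
    (10 ^ 8 / c ^ 2) * (Q * R0 * S0 * Gs) + 3 * (Q * Gs)).
  { apply (count_bound c Q d R0 S0 Gs eta xi L f g fs gs n l); auto; try lra.
    - unfold L. field. lra.
    - assert (L ^ 2 <= L0 ^ 2) by (apply pow_incr; lra).
      assert (L0 ^ 2 <= (2 * L) ^ 2) by (apply pow_incr; lra).
      assert (L ^ 2 * (Q * R0) <= L0 ^ 2 * (Q * R0)) by (apply Rmult_le_compat_r; lra).
      assert (L0 ^ 2 * (Q * R0) <= (2 * L) ^ 2 * (Q * R0)) by (apply Rmult_le_compat_r; lra).
      split; lra.
    - intros l' Hl' Hin'. apply Rle_trans with (C1 * Rpower (2 * Q) e).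
      + apply (G1 fs gs (g (eta - 1)) (2 * Q) l' Hs ltac:(lra) Hl').
        intros z Hz. destruct (Hin' z Hz) as [N1 [N2 N3]]. repeat split; try apply N1; lra.
      + apply Rmult_le_compat_r; lra.
    - intros l' Hl' Hin'. apply Rle_trans with (C2 * Rpower (2 * Q) e).
      + apply (G2 f g eta (2 * Q) l' H ltac:(lra) Hl').
        intros z Hz. destruct (Hin' z Hz) as [N1 [N2 N3]]. repeat split; try apply N1; lra.
      + apply Rmult_le_compat_r; lra. }
  apply Rle_trans with (1 := HB).
  set (X := Q * R0 ^ 2).
  assert (HX2 : X <= Q * Rpower (d * Q) (2 / 3)) by (apply Rmult_le_compat_l; lra).
  assert (HX0 : 0 <= X) by (apply Rmult_sq_nonneg; lra).
  assert (E1 : Q * R0 * S0 * Gs <= C3 * X).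
  { apply Rle_trans with (Q * R0 * S0 * (C3 * S0)).
    - apply Rmult_le_compat_l; [|assumption]. apply Rmult_le_pos; [|lra]. lra.
    - unfold X, R0. right. ring. }
  assert (E2 : Q * Gs <= C3 * X).
  { apply Rle_trans with (Q * (C3 * S0)); [apply Rmult_le_compat_l; lra|].
    replace (C3 * X) with (Q * (C3 * S0) * S0 ^ 3) by (unfold X, R0; ring).
    rewrite <- (Rmult_1_r (Q * (C3 * S0))) at 1. apply Rmult_le_compat_l.
    - apply Rmult_le_pos; [lra|]. apply Rmult_le_pos; lra.
    - apply pow_R1_Rle. assumption. }
  assert (E3 : 10 ^ 8 / c ^ 2 * (Q * R0 * S0 * Gs) <= 10 ^ 8 / c ^ 2 * (C3 * X)).
  { apply Rmult_le_compat_l; [unfold Rdiv|]; lra. }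
  set (K := (xi - eta) * (5 * 10 ^ 7 / c ^ 3)) in *.
  apply Rle_trans with ((K + 10 ^ 8 / c ^ 2 * C3 + 3 * C3 + 1) * X); [lra|].
  apply Rmult_le_compat_l; lra.
Qed.

Theorem theorem1 (eta xi : R) (f f1 f2 : R -> R) (theta eps : R)
  (Heta_xi : eta < xi)
  (Hf1 : forall x : R, Icc eta xi x -> D_in f f1 (Icc eta xi) x)
  (Hf2 : forall x : R, Icc eta xi x -> D_in f1 f2 (Icc eta xi) x)
  (Hf2_cont : forall x : R, Icc eta xi x -> continue_in f2 (Icc eta xi) x)
  (Hf2_away : exists c : R, 0 < c /\
     forall x : R, Icc eta xi x -> c <= Rabs (f2 x))
  (Htheta : 0 < theta < 1)
  (Hf2_Lip : Lip theta (Icc eta xi) f2)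
  (Heps : 0 < eps) :
  exists Q0 : R, forall c : R, 0 < c -> exists C : R, 0 < C /\
    forall Q delta : R, 1 <= Q -> Q0 <= Q ->
      Rpower Q (- ((1 + theta) / (3 - theta)) + eps) <= delta < 1 / 2 ->
      Ntilde f eta xi Q delta
        = 3 * (xi - eta) * delta * Q ^ 2 + Err f eta xi Q delta /\
      (c * T theta Q <= delta ->
         Rabs (Err f eta xi Q delta)
           <= C * (Rpower delta (2 / 3) * Rpower Q (5 / 3)
                   * Rpower (ln Q) (2 / 3))) /\
      (delta <= c * T theta Q ->
         Rabs (Err f eta xi Q delta)
           <= C * (Rpower delta (2 / (5 - theta))
                   * Rpower Q (3 * (3 - theta) / (5 - theta)))).
Proof.
  destruct (cvx_extend_signed eta xi f f1 f2 Heta_xi Hf1 Hf2 Hf2_cont Hf2_away)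
    as [c0 [F [G [HF HFf]]]].
  (* This is [1 - (1 + theta) / (3 - theta) + eps]: the lower bound on [delta] reads
     [delta >= Rpower Q (- 1 + kappa)]. *)
  set (kappa := (2 - 2 * theta) / (3 - theta) + eps).
  assert (Hk : 0 < kappa).
  { unfold kappa. assert (0 < (2 - 2 * theta) / (3 - theta)); [|lra].
    apply Rmult_lt_0_compat; [lra|]. apply Rinv_0_lt_compat. lra. }
  destruct (near_count_asymp c0 eta xi kappa F G HF Heta_xi Hk) as [Q1 [C1 [HC1 Has]]].
  (* [exp 1] makes [ln Q >= 1], so its positive powers only enlarge the first bound and its negative
     powers only shrink [T]. *)
  exists (Rmax Q1 (exp 1)). intros c Hc.
  (* The excess [2 / 3 - 2 / (5 - theta)] of the exponents of [delta]. In the second range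
     [Rpower delta a] is traded for a power of [Q], at the cost of [Rpower c a]. *)
  set (a := (4 - 2 * theta) / (3 * (5 - theta))).
  assert (Ha : 0 < a).
  { apply Rmult_lt_0_compat; [lra|]. apply Rinv_0_lt_compat. lra. }
  exists (C1 * (1 + Rpower c a)). pose proof (Rpower_pos c a) as Hca.
  split; [apply Rmult_lt_0_compat; lra|]. intros Q delta HQ HQ0 Hd.
  assert (HQ1 : Q1 <= Q) by (apply Rle_trans with (2 := HQ0), Rmax_l).
  assert (HlnQ : 1 <= ln Q).
  { rewrite <- (ln_exp 1). apply ln_le; [apply exp_pos|].
    apply Rle_trans with (2 := HQ0), Rmax_r. }
  split; [unfold Err; ring|].
  assert (Hd0 : 0 < delta).
  { pose proof (Rpower_pos Q (- ((1 + theta) / (3 - theta)) + eps)). lra. }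
  assert (HE : Rabs (Err f eta xi Q delta) <=
    C1 * (Rpower delta (2 / 3) * Rpower Q (5 / 3))).
  { destruct (Ntilde_list eta xi Q delta f F ltac:(lra) ltac:(lra) HFf) as [l [Hl [EN Hin]]].
    unfold Err. rewrite EN.
    replace (Rpower delta (2 / 3) * Rpower Q (5 / 3)) with (Q * Rpower (delta * Q) (2 / 3)).
    - apply Has; auto. split; [|lra].
      replace (- 1 + kappa) with (- ((1 + theta) / (3 - theta)) + eps)
        by (unfold kappa; field; lra). lra.
    - rewrite <- Rpower_mult_distr by lra.
      replace (5 / 3) with (1 + 2 / 3) by field. rewrite Rpower_plus, Rpower_1 by lra. ring. }
  set (X := Rpower delta (2 / 3) * Rpower Q (5 / 3)) in *.
  assert (HX : 0 < X) by (apply Rmult_lt_0_compat; apply Rpower_pos).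
  split; intros HT.
  - apply Rle_trans with (1 := HE). rewrite Rmult_assoc. apply Rmult_le_compat_l; [lra|].
    pose proof (Rpower_ge_1 (ln Q) (2 / 3) HlnQ ltac:(lra)) as h.
    set (w := Rpower (ln Q) (2 / 3)) in *.
    assert (X * 1 <= X * w) by (apply Rmult_le_compat_l; lra).
    assert (0 <= Rpower c a * (X * w)) by (apply Rmult_le_pos; [lra|apply Rmult_le_pos; lra]).
    lra.
  - set (Y := Rpower delta (2 / (5 - theta)) * Rpower Q (3 * (3 - theta) / (5 - theta))).
    assert (HY : 0 < Y) by (apply Rmult_lt_0_compat; apply Rpower_pos).
    assert (HXY : X <= Rpower c a * Y).
    (* [a] times the exponent of [Q] in [T]; then [b + 5 / 3] is the exponent of [Q] in the second
       bound. *)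
    { set (b := (2 - 4 * theta) / (3 * (5 - theta))).
      assert (Hda : Rpower delta a <= Rpower c a * Rpower Q b).
      { assert (HTp : 0 < T theta Q) by (apply Rmult_lt_0_compat; apply Rpower_pos).
        apply Rle_trans with (Rpower (c * T theta Q) a).
        - apply Rle_Rpower_l; [lra|]. lra.
        - rewrite <- Rpower_mult_distr by assumption.
          apply Rmult_le_compat_l; [lra|]. unfold T.
          rewrite <- Rpower_mult_distr by apply Rpower_pos.
          rewrite !Rpower_mult.
          replace ((1 - 2 * theta) / (2 - theta) * a) with b by (unfold a, b; field; lra).
          rewrite <- (Rmult_1_r (Rpower Q b)) at 2.
          apply Rmult_le_compat_l; [left; apply Rpower_pos|].
          rewrite <- (Rpower_O (ln Q)) by lra. apply Rle_Rpower; [assumption|].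
          assert (0 < (5 - theta) / (2 - theta)); [|nra].
          apply Rmult_lt_0_compat; [lra|]. apply Rinv_0_lt_compat. lra. }
      unfold X, Y.
      replace (2 / 3) with (2 / (5 - theta) + a) by (unfold a; field; lra).
      replace (3 * (3 - theta) / (5 - theta)) with (b + 5 / 3) by (unfold b; field; lra).
      rewrite !Rpower_plus.
      pose proof (Rpower_pos delta (2 / (5 - theta))) as p1.
      pose proof (Rpower_pos Q (5 / 3)) as p2.
      replace (Rpower c a * (Rpower delta (2 / (5 - theta)) * (Rpower Q b * Rpower Q (5 / 3))))
        with (Rpower delta (2 / (5 - theta)) * (Rpower c a * Rpower Q b) * Rpower Q (5 / 3)) by ring.
      apply Rmult_le_compat_r; [lra|]. apply Rmult_le_compat_l; lra. }
    apply Rle_trans with (1 := HE). rewrite Rmult_assoc.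
    apply Rmult_le_compat_l; [lra|]. lra.
Qed.
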